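(* Let $\mathcal K=\{H,J\}$ be a Krein space, $J=P_+-P_-$, $H=H_+\oplus H_-$, and let $A$ be a closed densely defined operator in $H$ such that $\mathcal D_+\oplus\mathcal D_-$ is a core of $A$, where $\mathcal D_\pm=\mathcal D(A)\cap H_\pm$, with block entries $A_{11},A_{12},A_{21},A_{22}$. Assume: (i) $A$ is dissipative in $\mathcal K$; (ii) $-A_{22}$ (with domain $\mathcal D_-$) is maximal dissipative in the Hilbert space $H_-$; and that for some $\mu\in\mathbb C^+$: (iii) $F(\mu)=(A_{22}-\mu)^{-1}A_{21}$ (with domain $\mathcal D_+$) is bounded; (iv) $G(\mu)=A_{12}(A_{22}-\mu)^{-1}$ is a compact operator from $H_-$ to $H_+$. Then the following are equivalent: (1) there exists an $A$-invariant maximal nonnegative subspace $\mathcal L^+$ of $\mathcal K$ such that the restriction $A^+=A|_{\mathcal L^+}$ satisfies $\sigma(A^+)\subset\overline{\mathbb C^+}$; (2) $A$ is $m$-dissipative in $\mathcal K$.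
   Context: $H$ is a separable complex Hilbert space with inner product $(\cdot,\cdot)$; $P_+,P_-$ are complementary orthogonal projections, $P_++P_-=1$, $J=P_+-P_-$, $H_\pm=P_\pm(H)$. The Krein space $\mathcal K=\{H,J\}$ is $H$ equipped with the indefinite inner product $[x,y]=(Jx,y)$. $\mathbb C^+$ and $\mathbb C^-$ are the open upper and lower half-planes; $\overline{\mathbb C^+}$ is the closed upper half-plane. A (closed) subspace $\mathcal L$ is nonnegative if $[x,x]\ge 0$ for all $x\in\mathcal L$, and maximal nonnegative if it has no proper nonnegative extension. A densely defined operator $T$ in a Hilbert space is dissipative if $\operatorname{Im}(Tx,x)\ge 0$ for all $x\in\mathcal D(T)$, and maximal dissipative ($m$-dissipative) if it has no proper dissipative extension (equivalently, it is dissipative and $\mathbb C^-\subset\rho(T)$). $A$ is dissipative (respectively $m$-dissipative) in $\mathcal K$ if $JA$ is dissipative (respectively $m$-dissipative) in $H$. Block entries: $A_{11}=P_+AP_+$ and $A_{21}=P_-AP_+$ are regarded as operators from $\mathcal D_+\subset H_+$ to $H_+$ and $H_-$ respectively; $A_{12}=P_+AP_-$ and $A_{22}=P_-AP_-$ as operators from $\mathcal D_-\subset H_-$ to $H_+$ and $H_-$ respectively. $A$-invariance: a subspace $\mathcal L$ is $A$-invariant if $\mathcal D(A)\cap\mathcal L$ is dense in $\mathcal L$ and $Ax\in\mathcal L$ for all $x\in\mathcal D(A)\cap\mathcal L$. The restriction $A|_{\mathcal L}$ is the operator in $\mathcal L$ with domain $\mathcal D(A)\cap\mathcal L$. *)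

(* Defs.v *)
From HB Require Import structures.
From mathcomp Require Import all_boot all_order all_algebra.
From mathcomp Require Import complex sesquilinear.
From mathcomp Require Import boolp classical_sets functions cardinality reals.
From mathcomp Require Import topology normedtype.

Set Implicit Arguments.
Unset Strict Implicit.
Unset Printing Implicit Defensive.

Import Order.TTheory GRing.Theory Num.Theory Num.Def.
Import numFieldNormedType.Exports.

Local Open Scope classical_set_scope.
Local Open Scope complex_scope.
Local Open Scope ring_scope.

(* A possibly unbounded operator: only the values on [dom] are meaningful.
   Linearity is not built in; it is part of [operator_in] below. *)
Record partial_op (V : Type) := PartialOp { dom : set V; op_fun :> V -> V }.

Section Operators.
Variables (R : realType) (H : normedModType R[i]).
Implicit Types (L D : set H) (S T : partial_op H) (z : R[i]) (P : H -> H).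

Definition operator_in L T :=
  [/\ GRing.submod_closed [in dom T],
      dom T `<=` L,
      (forall a x y, dom T x -> dom T y -> T (a *: x + y) = a *: T x + T y) &
      forall x, dom T x -> L (T x)].

Definition densely_defined_in L T := L `<=` closure (dom T).

Definition extends S T :=
  dom T `<=` dom S /\ forall x, dom T x -> S x = T x.

Definition op_restr T D := PartialOp (dom T `&` D) T.

Definition op_opp T := PartialOp (dom T) (fun x => - T x).

Definition op_sub_scalar T z := PartialOp (dom T) (fun x => T x - z *: x).

Definition op_comp S T :=
  PartialOp [set x | dom T x /\ dom S (T x)] (fun x => S (T x)).

Definition op_postcomp P T := PartialOp (dom T) (fun x => P (T x)).

(* Meaningful when T is injective on its domain. *)
Definition op_inv T :=
  PartialOp (T @` dom T) (fun y => xget 0 [set x | dom T x /\ T x = y]).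

Definition graph T : set (H * H) := [set u | dom T u.1 /\ u.2 = T u.1].

Definition closed_op T := closed (graph T).

Definition is_core T D :=
  [/\ GRing.submod_closed [in D], D `<=` dom T &
      closure (graph (op_restr T D)) = graph T].

Definition bounded_op T :=
  exists M : R, forall x, dom T x -> `|T x| <= M%:C * `|x|.

Definition compact_op E F T :=
  [/\ dom T = E, (forall x, E x -> F (T x)) &
      precompact (T @` [set x | E x /\ `|x| <= 1])].

Definition resolvent_set L T : set R[i] :=
  [set z | [/\ set_inj (dom T) (op_sub_scalar T z),
               op_sub_scalar T z @` dom T = L &
               bounded_op (op_inv (op_sub_scalar T z))]].

Definition spectrum L T : set R[i] := ~` resolvent_set L T.

(* P A Q, as an operator defined on D(A) `&` Q(H). *)
Definition block P Q T :=
  PartialOp (dom T `&` range Q) (fun x => P (T (Q x))).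

Definition sum_set D1 D2 : set H := [set x + y | x in D1 & y in D2].

Definition invariant_under T L :=
  L `<=` closure (dom T `&` L) /\ forall x, (dom T `&` L) x -> L (T x).

End Operators.

Definition separable (T : topologicalType) :=
  exists D : set T, countable D /\ dense D.

Section InnerProduct.
Variables (R : realType) (H : normedModType R[i]) (ip : {dot H for conjC}).
Implicit Types (L : set H) (T : partial_op H) (P : H -> H).

Definition orthogonal_projection P :=
  (forall x, P (P x) = P x) /\ (forall x y, ip (P x) y = ip x (P y)).

Definition dissipative_in L T :=
  [/\ operator_in L T, densely_defined_in L T &
      forall x, dom T x -> 0 <= complex.Im (ip (T x) x)].

Definition m_dissipative_in L T :=
  dissipative_in L T /\
  forall S, dissipative_in L S -> extends S T -> dom S `<=` dom T.

(* The order of R[i] makes 0 <= ip (J x) x say that [x, x] is real and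
   nonnegative; it is always real since J is symmetric. *)
Definition nonnegative_subspace (J : H -> H) L :=
  [/\ GRing.submod_closed [in L], closed L & forall x, L x -> 0 <= ip (J x) x].

Definition max_nonnegative_subspace (J : H -> H) L :=
  nonnegative_subspace J L /\
  forall L', nonnegative_subspace J L' -> L `<=` L' -> L' = L.

Definition krein_dissipative (J : H -> H) T :=
  dissipative_in setT (op_postcomp J T).

Definition krein_m_dissipative (J : H -> H) T :=
  m_dissipative_in setT (op_postcomp J T).

End InnerProduct.

(* Main.v *)
Require Import Defs.
From HB Require Import structures.
From mathcomp Require Import all_boot all_order all_algebra.
From mathcomp Require Import complex sesquilinear.
From mathcomp Require Import boolp classical_sets functions cardinality reals.
From mathcomp Require Import topology normedtype sequences.
From mathcomp Require Import ring lra.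

Set Implicit Arguments.
Unset Strict Implicit.
Unset Printing Implicit Defensive.

Import Order.TTheory GRing.Theory Num.Theory Num.Def.
Import numFieldNormedType.Exports.

Local Open Scope classical_set_scope.
Local Open Scope complex_scope.
Local Open Scope ring_scope.

(* Fix t > 0 and let V = (A - it)(A + it)^-1 be the Cayley transform.  Its
   Potapov-Ginzburg transform S, which exchanges the H_- components of v and V v,
   is an everywhere defined contraction exactly when JA + it is onto, i.e. when A is
   m-dissipative in the Krein space.  Its corner P_+ S P_- is governed by
   A12 (A22 - it)^-1, which inherits compactness from G(mu) and is small for large t.

   A graph {u + K u} over H_+ is V-invariant iff S (u + K W u) = W u + K u for some
   W on H_+.  For r S with r < 1 a pair (K, W) is the limit of an explicit iteration;
   letting r -> 1 along an ultrafilter, compactness of the corner upgrades the weak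
   convergence of the pairs enough to pass to the limit, and it forces the spectral
   radius of W to be at most 1, which says that A restricted to the graph has its
   spectrum in the closed upper half-plane.

   Conversely, on an invariant maximal nonnegative L with such a spectrum A + it is
   onto L, and since the corner is a small contraction a fixed point argument solves
   (JA + it) h = xi for every xi, which gives maximality. *)

(** * Real-valued norms and inner products *)

(** The obstacle is the product [K (W u)] in the graph equation: weak limits of the two factors do
    not determine the limit of the product. The H_+ component of the equation reads W u = r (P_+ S u
    + P_+ S K W u) for u in H_+, so K enters W only through the compact corner. Hence W u converges
    in norm, and only then does K (W u) converge weakly to the right limit. An ultrafilter gives all
    bounded sequences their limits at once, so the limit maps are linear without extraction of
    subsequences.

    The power bounds found for W when r < 1 degenerate as r -> 1. What survives the limit is a lower
    bound for W - th on a circle |th| = rho > 1 free of eigenvalues of the limit W; it bounds the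
    k-th power of W by a multiple of rho^k, and compactness supplies such circles arbitrarily close
    to the unit circle.

    With v = (A + it) d, the vector (A - l) d is a multiple of v - ka (V v), where ka = (l + it) /
    (l - it), and |ka| < 1 when Im l < 0. The bound 1/8 on the corner A12 (A22 - it)^-1 turns the
    Lipschitz constant 4 in the converse into a contraction factor 1/2. *)

Section Hilbert.
Variables (R : realType) (H : completeNormedModType R[i]).
Variable ip : {dot H for conjC}.
Hypothesis ip_norm : forall x : H, `|x| ^+ 2 = ip x x.
Local Notation C := R[i].

(** Norms on [H] take values in [R[i]]; their real parts let [lra] and [nra] run over [R]. Likewise
    [rip] is the real inner product, and the complex one is recovered by testing against ['i%C *: x]
    as well. *)
Definition cmod (c : C) : R := complex.Re `|c|.
Definition nm (x : H) : R := complex.Re `|x|.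
Definition rip (x y : H) : R := complex.Re (ip x y).

Lemma cmodE c : `|c| = (cmod c)%:C.
Proof. by rewrite /cmod RRe_real // ger0_real. Qed.

Lemma nmE x : `|x| = (nm x)%:C.
Proof. by rewrite /nm RRe_real // ger0_real. Qed.

Lemma cmod_sqr c : cmod c ^+ 2 = complex.Re c ^+ 2 + complex.Im c ^+ 2.
Proof.
by apply: complexI; rewrite add_Re2_Im2 cmodE rmorphXn.
Qed.

Lemma cmod_ge0 c : 0 <= cmod c.
Proof. by rewrite -ler0c -cmodE normr_ge0. Qed.

Lemma nm_ge0 x : 0 <= nm x.
Proof. by rewrite -ler0c -nmE normr_ge0. Qed.
Hint Resolve nm_ge0 cmod_ge0 : core.

Lemma cmodM a b : cmod (a * b) = cmod a * cmod b.
Proof. by apply: complexI; rewrite rmorphM /= -!cmodE normrM. Qed.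

Lemma cmodX a n : cmod (a ^+ n) = cmod a ^+ n.
Proof. by apply: complexI; rewrite rmorphXn /= -!cmodE normrX. Qed.

Lemma cmodV a : cmod a^-1 = (cmod a)^-1.
Proof. by apply: complexI; rewrite fmorphV /= -!cmodE normfV. Qed.

Lemma cmodN a : cmod (- a) = cmod a.
Proof. by rewrite /cmod normrN. Qed.

Lemma cmodD a b : cmod (a + b) <= cmod a + cmod b.
Proof. by rewrite -lecR rmorphD /= -!cmodE ler_normD. Qed.

Lemma cmodR (r : R) : cmod r%:C = `|r|.
Proof.
apply/eqP; rewrite -(@eqrXn2 _ 2) // cmod_sqr /= expr0n addr0.
by rewrite real_normK // num_real.
Qed.

Lemma cmod_eq0 c : (cmod c == 0) = (c == 0).
Proof. by rewrite -(normr_eq0 c) cmodE -(inj_eq (@complexI _)). Qed.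

Lemma nmZ c x : nm (c *: x) = cmod c * nm x.
Proof. by apply: complexI; rewrite rmorphM /= -nmE normrZ cmodE nmE. Qed.

Lemma nmZr (r : R) x : nm (r%:C *: x) = `|r| * nm x.
Proof. by rewrite nmZ cmodR. Qed.

Lemma nmN x : nm (- x) = nm x.
Proof. by rewrite /nm normrN. Qed.

Lemma nmD x y : nm (x + y) <= nm x + nm y.
Proof. by rewrite -lecR rmorphD /= -!nmE ler_normD. Qed.

Lemma nmB x y : nm (x - y) <= nm x + nm y.
Proof. by rewrite -(nmN y) nmD. Qed.

Lemma nm_distC x y : nm (x - y) = nm (y - x).
Proof. by rewrite -nmN opprB. Qed.

Lemma nm0 : nm 0 = 0.
Proof. by rewrite /nm normr0. Qed.

Lemma nm_eq0 x : (nm x == 0) = (x == 0).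
Proof. by rewrite -(normr_eq0 x) nmE -(inj_eq (@complexI _)). Qed.

Lemma nm0_eq0 x : nm x = 0 -> x = 0.
Proof. by move=> /eqP; rewrite nm_eq0 => /eqP. Qed.

Lemma nm_gt0 x : (0 < nm x) = (x != 0).
Proof. by rewrite lt_def nm_ge0 andbT nm_eq0. Qed.

Lemma nm_tri y x z : nm (x - z) <= nm (x - y) + nm (y - z).
Proof. by apply: le_trans (nmD _ _); rewrite addrA subrK. Qed.

Lemma ipDl x y z : ip (x + y) z = ip x z + ip y z.
Proof. exact: linearDl. Qed.

Lemma ipZl c x y : ip (c *: x) y = c * ip x y.
Proof. exact: linearZl_LR. Qed.

Lemma ipZr c x y : ip x (c *: y) = c^*%C * ip x y.
Proof. exact: linearZr_LR. Qed.

Lemma ipC x y : ip x y = (ip y x)^*%C.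
Proof. by rewrite hermC expr0 mul1r. Qed.

Lemma ripDl x y z : rip (x + y) z = rip x z + rip y z.
Proof. by rewrite /rip ipDl; case: (ip x z); case: (ip y z). Qed.

Lemma ripC x y : rip x y = rip y x.
Proof. by rewrite /rip ipC; case: (ip y x). Qed.

Lemma ripDr x y z : rip x (y + z) = rip x y + rip x z.
Proof. by rewrite ripC ripDl !(ripC x). Qed.

Lemma ripZc c x y : rip (c *: x) y = rip x (c^*%C *: y).
Proof. by rewrite /rip ipZl ipZr; case: c => a b; rewrite /= opprK. Qed.

Lemma ripZl (r : R) x y : rip (r%:C *: x) y = r * rip x y.
Proof. by rewrite /rip ipZl; case: (ip x y) => a b /=; rewrite mul0r subr0. Qed.

Lemma ripZr (r : R) x y : rip x (r%:C *: y) = r * rip x y.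
Proof. by rewrite ripC ripZl ripC. Qed.

Lemma ripNl x y : rip (- x) y = - rip x y.
Proof.
have -> : - x = (-1 : R)%:C *: x by rewrite rmorphN /= scaleN1r.
by rewrite ripZl mulN1r.
Qed.

Lemma ripNr x y : rip x (- y) = - rip x y.
Proof. by rewrite ripC ripNl ripC. Qed.

Lemma ripBl x y z : rip (x - y) z = rip x z - rip y z.
Proof. by rewrite ripDl ripNl. Qed.

Lemma ripBr x y z : rip x (y - z) = rip x y - rip x z.
Proof. by rewrite ripDr ripNr. Qed.

Lemma rip0l x : rip 0 x = 0.
Proof. by have := ripZl 0 0 x; rewrite scaler0 mul0r. Qed.

Lemma rip0r x : rip x 0 = 0.
Proof. by rewrite ripC rip0l. Qed.

Lemma rip_nm x : rip x x = nm x ^+ 2.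
Proof. by apply: complexI; rewrite rmorphXn /= -nmE ip_norm /rip RRe_real // -ip_norm rpredX // ger0_real. Qed.

(** Through this identity dissipativity becomes the real inequality [0 <= rip (T x) ('i%C *: x)],
    the only form used below. *)
Lemma Im_ip x y : complex.Im (ip x y) = rip x ('i%C *: y).
Proof. by rewrite /rip ipZr; case: (ip x y) => a b /=; rewrite mul0r !mulN1r opprK add0r. Qed.

Lemma nmD_sqr x y : nm (x + y) ^+ 2 = nm x ^+ 2 + 2 * rip x y + nm y ^+ 2.
Proof. by rewrite -!rip_nm ripDl !ripDr (ripC y x); ring. Qed.

Lemma nmB_sqr x y : nm (x - y) ^+ 2 = nm x ^+ 2 - 2 * rip x y + nm y ^+ 2.
Proof. by rewrite nmD_sqr ripNr nmN; ring. Qed.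

(** Cauchy-Schwarz comes from the triangle inequality, which the normed module already provides:
    square it and compare with [nmD_sqr]. *)
Lemma rip_le x y : rip x y <= nm x * nm y.
Proof.
have := nmD_sqr x y; have := nmD x y.
have := nm_ge0 (x + y); have := nm_ge0 x; have := nm_ge0 y; nra.
Qed.

Lemma ler_rip x y : `|rip x y| <= nm x * nm y.
Proof. by rewrite ler_norml rip_le andbT lerNl -ripNl -(nmN x) rip_le. Qed.

Lemma rip_all_eq x y : (forall z, rip x z = rip y z) -> x = y.
Proof.
move=> h; apply/eqP; rewrite -subr_eq0 -nm_eq0 -sqrf_eq0 -rip_nm ripBl h.
by rewrite subrr.
Qed.

Lemma ipNl x z : ip (- x) z = - ip x z.
Proof. exact: linearNl. Qed.

Lemma ip0l z : ip 0 z = 0.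
Proof. exact: linear0l. Qed.

Lemma ip_all_eq x y : (forall z, ip x z = ip y z) -> x = y.
Proof. by move=> h; apply: rip_all_eq => z; rewrite /rip h. Qed.

Lemma nm_cauchy (u : nat -> H) :
  (forall e : R, 0 < e -> exists N, forall m n, (N <= m)%N -> (N <= n)%N ->
     nm (u m - u n) < e) ->
  exists l, forall e : R, 0 < e -> exists N, forall n, (N <= n)%N ->
     nm (u n - l) < e.
Proof.
move=> uC.
have /cvg_ex[l /cvgrPdist_lt ul] : cvg (u @ \oo).
  apply: cauchy_cvg; apply: cauchy_exP => e e0.
  have eE : e = (complex.Re e)%:C by rewrite RRe_real // gtr0_real.
  have re0 : 0 < complex.Re e by rewrite -ltcR -eE.
  have [N uN] := uC _ re0.
  exists (u N); exists N => // n /= Nn.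
  by rewrite -ball_normE /= eE nmE ltcR uN.
exists l => e e0; have /ul [N _ h] : 0 < e%:C by rewrite ltcR.
by exists N => n Nn; have := h n Nn; rewrite nmE ltcR nm_distC.
Qed.

Definition nclosed (S : set H) :=
  forall x, (forall e : R, 0 < e -> exists2 y, S y & nm (x - y) < e) -> S x.

Lemma closure_nmP (S : set H) x :
  closure S x <-> (forall e : R, 0 < e -> exists2 y, S y & nm (x - y) < e).
Proof.
split => [cS e e0|h B].
  have [] := cS (ball x e%:C).
    by apply: nbhsx_ballx; rewrite ltcR.
  by move=> y [Sy]; rewrite -ball_normE /= nmE ltcR => xy; exists y.
move=> /nbhs_ballP[e /= e0 sB].
have eE : e = (complex.Re e)%:C by rewrite RRe_real // gtr0_real.
have [|y Sy xy] := h (complex.Re e); first by rewrite -ltcR -eE.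
exists y; split => //; apply: sB; rewrite -ball_normE /= nmE eE ltcR //.
Qed.

Lemma closed_nmP (S : set H) : closed S <-> nclosed S.
Proof.
split=> [cS x h|h x /closure_nmP]; last exact: h.
by apply: cS; apply/closure_nmP.
Qed.

End Hilbert.

(** Pairing with an arbitrary vector turns a linear identity in [H] into a polynomial identity in
    [R[i]], which [ring] decides. *)
Ltac vec hip := apply: (ip_all_eq hip) => ?; rewrite ?(ipDl, ipNl, ipZl, ip0l); ring.

(** * Orthogonal projection, Riesz representation and fixed points *)

Section Projection.
Variables (R : realType) (H : completeNormedModType R[i]).
Variable ip : {dot H for conjC}.
Hypothesis ip_norm : forall x : H, `|x| ^+ 2 = ip x x.
Local Notation g := (rip ip).
Let nmge0 (x : H) : 0 <= nm x := nm_ge0 x.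
Let cmodge0 (c : R[i]) : 0 <= cmod c := cmod_ge0 c.
Hint Resolve nmge0 cmodge0 : core.

Lemma invS_lt (e : R) : 0 < e ->
  exists N, forall n, (N <= n)%N -> n.+1%:R^-1 < e.
Proof.
move=> e0; exists (Num.bound e^-1) => n Nn.
rewrite invf_plt ?posrE ?ltr0n //.
apply: lt_le_trans (archi_boundP _) _; first by rewrite invr_ge0 ltW.
by rewrite ler_nat (leq_trans Nn).
Qed.

Lemma expr_lt (q e : R) : 0 <= q -> q < 1 -> 0 < e ->
  exists N, forall n, (N <= n)%N -> q ^+ n < e.
Proof.
move=> q0 q1 e0; have : (fun n => q ^+ n) @ \oo --> (0 : R).
  by apply: cvg_expr; rewrite ger0_norm.
move=> /cvgrPdist_lt/(_ _ e0)[N _ Nq]; exists N => n /Nq /=.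
by rewrite sub0r normrN => /(le_lt_trans (ler_norm _)).
Qed.

Lemma le0_all (a M : R) : (forall e, 0 < e -> a <= M * e) -> a <= 0.
Proof.
move=> h; rewrite leNgt; apply/negP => a0.
have M0 : 0 < M by have := h _ ltr01; lra.
have := h (a / (2 * M)); rewrite divr_gt0 //; last by lra.
move=> /(_ isT); have -> : M * (a / (2 * M)) = a / 2 by field; lra.
by lra.
Qed.

Lemma sqr_le (a b : R) : 0 <= a -> a <= b -> a ^+ 2 <= b ^+ 2.
Proof. by move=> a0 ab; nra. Qed.

Lemma sqr_lt (a b : R) : 0 <= b -> a ^+ 2 < b ^+ 2 -> a < b.
Proof. by move=> b0; apply: contraTT; rewrite -!leNgt => /sqr_le; apply. Qed.

Lemma quad_eq0 (a b : R) : (forall t, 0 <= t ^+ 2 * b - 2 * t * a) -> a = 0.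
Proof.
move=> h; apply/eqP; rewrite -sqrf_eq0; apply/eqP/le_anti.
rewrite sqr_ge0 andbT.
have b0 : 0 <= b by have := h 1; have := h (-1); lra.
have s0 : 0 < (b + 1)^-1 by rewrite invr_gt0; lra.
have sb : (b + 1)^-1 * (b + 1) = 1 by rewrite mulVf //; lra.
have := h ((b + 1)^-1 * a); move: s0 sb; set s := (b + 1)^-1 => s0 sb.
have -> : (s * a) ^+ 2 * b - 2 * (s * a) * a = s * (a ^+ 2) * (s * (b + 1) - s - 2).
  by ring.
rewrite sb -mulrA pmulr_rge0 //; nra.
Qed.

(** Real scalars suffice for projecting with respect to [rip]; kernels of real-linear functionals,
    as in [riesz], are closed under no more than these. *)
Definition rsub (S : set H) :=
  S 0 /\ forall (r : R) x y, S x -> S y -> S (r%:C *: x + y).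

Lemma rsubD S x y : rsub S -> S x -> S y -> S (x + y).
Proof. by move=> [_ h] Sx Sy; have := h 1 _ _ Sx Sy; rewrite rmorph1 scale1r. Qed.

Lemma rsubZ S (r : R) x : rsub S -> S x -> S (r%:C *: x).
Proof. by move=> [S0 h] Sx; have := h r _ _ Sx S0; rewrite addr0. Qed.

(** A sequence minimising the distance to [S] is Cauchy by the parallelogram law; orthogonality of
    the remainder is the first variation of the distance in a real parameter. *)
Lemma proj_ex (S : set H) x : rsub S -> nclosed S ->
  exists2 p, S p & forall s, S s -> g (x - p) s = 0.
Proof.
move=> rS cS; have [S0 SP] := rS.
pose E := [set nm (x - s) | s in S].
have hE : has_inf E.
  split; first by exists (nm (x - 0)); exists 0.
  by exists 0 => _ [s _ <-]; exact: nm_ge0.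
pose d := inf E.
have dle s : S s -> d <= nm (x - s).
  by move=> Ss; apply: ge_inf; [case: hE | exists s].
have d0 : 0 <= d by apply: lb_le_inf; [case: hE | move=> _ [s _ <-]; exact: nm_ge0].
have /choice[s sP] : forall n, exists s, S s /\ nm (x - s) < d + n.+1%:R^-1.
  move=> n; have n0 : 0 < n.+1%:R^-1 :> R by rewrite invr_gt0 ltr0n.
  by have [_ [s Ss <-] sd] := inf_adherent n0 hE; exists s.
(* Parallelogram law for [x - s m] and [x - s n]; the midpoint of [s m] and [s n] lies in [S], so
   its distance [q] to [x] is at least [d]. *)
have mid m n : nm (s m - s n) ^+ 2 <=
    2 * nm (x - s m) ^+ 2 + 2 * nm (x - s n) ^+ 2 - 4 * d ^+ 2.
  have [[Sm _] [Sn _]] := (sP m, sP n).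
  have /dle : S ((2^-1 : R)%:C *: (s m + s n)).
    by apply: rsubZ => //; apply: rsubD.
  set q := nm (x - (2^-1)%:C *: _) => dq.
  have -> : s m - s n = (x - s n) - (x - s m).
    by vec ip_norm.
  have qE : nm ((x - s n) + (x - s m)) = 2 * q.
    rewrite -[2 in RHS]ger0_norm // -nmZr; congr nm.
    rewrite scalerBr scalerA -rmorphM /= divff ?pnatr_eq0 // rmorph1 scale1r.
    by rewrite rmorphMn rmorph1 scaler_nat mulr2n opprD addrACA [X in _ + X]addrC.
  have := nmB_sqr ip_norm (x - s n) (x - s m).
  have := nmD_sqr ip_norm (x - s n) (x - s m); rewrite qE.
  by nra.
have [|p pP] := @nm_cauchy _ _ s.
  (* With both distances at most [d + f], [mid] gives at most [8 * d * f + 4 * f ^+ 2], which for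
     [0 < f <= 1] is strictly below [f * (8 * d + 5)]. *)
  move=> e e0; pose f := Num.min 1 (e ^+ 2 / (8 * d + 5)).
  have f0 : 0 < f by rewrite lt_min ltr01 divr_gt0 ?exprn_gt0 //; lra.
  have [N NP] := invS_lt f0; exists N => m n Nm Nn.
  have f1 : f <= 1 by rewrite ge_min lexx.
  have fe : f * (8 * d + 5) <= e ^+ 2.
    by rewrite -ler_pdivlMr ?ge_min ?lexx ?orbT //; lra.
  have am : nm (x - s m) <= d + f
    by apply/ltW/(lt_trans (sP m).2); rewrite ltrD2l NP.
  have an : nm (x - s n) <= d + f
    by apply/ltW/(lt_trans (sP n).2); rewrite ltrD2l NP.
  have am2 : nm (x - s m) ^+ 2 <= (d + f) ^+ 2 by apply: sqr_le.
  have an2 : nm (x - s n) ^+ 2 <= (d + f) ^+ 2 by apply: sqr_le.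
  have mn := mid m n.
  apply: sqr_lt; first exact: ltW.
  by nra.
have Sp : S p.
  apply: cS => e /pP[N NP]; exists (s N); first by case: (sP N).
  by rewrite nm_distC NP.
have pd : nm (x - p) <= d.
  rewrite -subr_le0; apply: (@le0_all _ 2) => e e0.
  have [N NP] := pP e e0; have [M MP] := invS_lt e0.
  set k := maxn N M; have := NP k (leq_maxl _ _).
  have : nm (x - s k) < d + e.
    by apply: lt_trans (sP k).2 _; rewrite ltrD2l MP // leq_maxr.
  have := nm_tri (s k) x p; lra.
exists p => // t St; apply: (@quad_eq0 _ (nm t ^+ 2)) => r.
have /dle : S (p + r%:C *: t) by rewrite addrC; apply SP.
rewrite opprD addrA => h.
have : nm (x - p) ^+ 2 <= nm (x - p - r%:C *: t) ^+ 2.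
  by apply: sqr_le => //; lra.
rewrite (nmB_sqr ip_norm (x - p)) nmZr ripZr exprMn real_normK ?num_real //; lra.
Qed.

(** The representing vector is a multiple of the component of [x0] orthogonal to the closed kernel
    of [f], where [x0] is any point with [f x0 != 0]. *)
Lemma riesz (f : H -> R) (M : R) :
  (forall (r : R) x y, f (r%:C *: x + y) = r * f x + f y) ->
  (forall x, `|f x| <= M * nm x) ->
  exists y, forall x, f x = g x y.
Proof.
move=> fl fb.
have f0 : f 0 = 0.
  by apply/normr0_eq0/le_anti; rewrite normr_ge0 andbT (le_trans (fb 0)) // nm0 mulr0.
have fB x y : f (x - y) = f x - f y.
  by rewrite addrC -scaleN1r -(rmorph1 (real_complex R)) -rmorphN fl mulN1r addrC.
have [allz|/existsNP[x0 /eqP fx0]] := pselect (forall x, f x = 0).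
  by exists 0 => x; rewrite allz rip0r.
pose S := [set x | f x = 0].
have [||p Sp pP] := @proj_ex S x0.
- by split => // r x y; rewrite /S /= => fx fy; rewrite fl fx fy mulr0 addr0.
- move=> x h; apply/normr0_eq0/le_anti; rewrite normr_ge0 andbT.
  apply: (@le0_all _ `|M|) => e /h[y fy xy].
  rewrite -[f x]subr0 -fy -fB (le_trans (fb _)) //.
  apply: (@le_trans _ _ (`|M| * nm (x - y))).
    by apply: ler_wpM2r (ler_norm _); apply: nm_ge0.
  by apply: ler_wpM2l (ltW _).
have fz : f (x0 - p) = f x0 by rewrite fB Sp subr0.
set z := x0 - p in pP fz.
have z0 : nm z != 0.
  rewrite nm_eq0; apply: contra fx0 => /eqP z0.
  by rewrite -fz z0 f0.
exists ((f z / nm z ^+ 2)%:C *: z) => x.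
have Sx : S (x - (f x / f z)%:C *: z).
  rewrite /S /= fB -[_ *: z]addr0 fl f0 addr0 fz divfK // subrr //.
have := pP _ Sx; rewrite ripBr ripZr (rip_nm ip_norm) => /eqP.
rewrite subr_eq0 => /eqP zx; rewrite ripZr ripC zx fz.
by field; rewrite z0 fx0.
Qed.

Definition lin (f : H -> H) :=
  forall (c : R[i]) x y, f (c *: x + y) = c *: f x + f y.

Definition bd (f : H -> H) M := forall x, nm (f x) <= M * nm x.

Lemma lin0 f : lin f -> f 0 = 0.
Proof. by move=> h; have := h (-1) 0 0; rewrite !scaleN1r oppr0 addr0 addNr. Qed.

Lemma linD f : lin f -> forall x y, f (x + y) = f x + f y.
Proof. by move=> h x y; have := h 1 x y; rewrite !scale1r. Qed.

Lemma linZ f : lin f -> forall c x, f (c *: x) = c *: f x.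
Proof. by move=> h c x; have := h c x 0; rewrite (lin0 h) !addr0. Qed.

Lemma linN f : lin f -> forall x, f (- x) = - f x.
Proof. by move=> h x; rewrite -scaleN1r (linZ h) scaleN1r. Qed.

Lemma linB f : lin f -> forall x y, f (x - y) = f x - f y.
Proof. by move=> h x y; rewrite (linD h) (linN h). Qed.

(** One value of the adjoint at a time is enough to show that bounded linear maps are weakly
    continuous, see [wlim_map]. *)
Lemma adjoint_ex f M : lin f -> bd f M ->
  forall v, exists w, forall x, g (f x) v = g x w.
Proof.
move=> lf bf v; apply: (@riesz _ (M * nm v)) => [r x y|x].
  by rewrite lf ripDl ripZl.
apply: le_trans (ler_rip ip_norm _ _) _.
by rewrite mulrAC; apply: ler_wpM2r (bf x); apply: nm_ge0.
Qed.

Lemma geom_cauchy (u : nat -> H) (c q : R) : 0 <= q -> q < 1 ->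
  (forall n, nm (u n.+1 - u n) <= c * q ^+ n) ->
  exists l, forall n, nm (u n - l) <= c / (1 - q) * q ^+ n.
Proof.
move=> q0 q1 h.
have c0 : 0 <= c by have := h 0%N; rewrite expr0 mulr1; apply: le_trans.
pose c' := c / (1 - q); have c'0 : 0 <= c' by rewrite divr_ge0 //; lra.
have c'E : c = c' * (1 - q) by rewrite divfK //; lra.
have step n k : nm (u (n + k)%N - u n) <= c' * (q ^+ n - q ^+ (n + k)).
  elim: k => [|k IH]; first by rewrite addn0 !subrr nm0 mulr0.
  apply: le_trans (nm_tri (u (n + k)%N) _ _) _.
  by rewrite addnS; have := h (n + k)%N; rewrite exprS c'E; nra.
have step' n k : nm (u (n + k)%N - u n) <= c' * q ^+ n.
  by apply: le_trans (step n k) _; rewrite ler_wpM2l // gerBl exprn_ge0.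
have qe e : 0 < e -> exists N, c' * q ^+ N < e.
  move=> e0; have d0 : 0 < e / (c' + 1) by rewrite divr_gt0 //; lra.
  have [N /(_ _ (leqnn _))] := expr_lt q0 q1 d0.
  rewrite ltr_pdivlMr; last by lra.
  by have := exprn_ge0 N q0; exists N; nra.
have [|l lP] := @nm_cauchy _ _ u.
  move=> e e0; have [|N NP] := qe (e / 2); first by rewrite divr_gt0.
  exists N => m n Nm Nn.
  have := step' N (m - N)%N; have := step' N (n - N)%N; rewrite !subnKC // => a b.
  by apply: le_lt_trans (nm_tri (u N) _ _) _; rewrite (nm_distC (u N)); lra.
exists l => n; rewrite -subr_le0; apply: (@le0_all _ 1) => e /lP[N NP].
have := NP (n + N)%N (leq_addl _ _); have := step' n N.
have := nm_tri (u (n + N)%N) (u n) l; rewrite (nm_distC (u n) (u _)) -/c'; lra.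
Qed.

Lemma fixpoint (f : H -> H) (q : R) : q < 1 ->
  (forall x y, nm (f x - f y) <= q * nm (x - y)) -> exists x, f x = x.
Proof.
move=> q1 fq.
wlog q0 : q q1 fq / 0 <= q.
  move=> h; apply: (h (Num.max q 0)); rewrite ?le_max ?lexx ?orbT //.
    by rewrite gt_max q1 ltr01.
  move=> x y; apply: le_trans (fq x y) _.
  by apply: ler_wpM2r; [apply: nm_ge0 | rewrite le_max lexx].
pose u n := iter n f 0.
have h n : nm (u n.+1 - u n) <= nm (u 1%N - u 0%N) * q ^+ n.
  elim: n => [|n IH]; first by rewrite expr0 mulr1.
  apply: le_trans (fq _ _) _; rewrite exprS mulrCA.
  exact: ler_wpM2l.
have [l lP] := geom_cauchy q0 q1 h.
exists l; apply/eqP; rewrite -subr_eq0 -nm_eq0; apply/eqP/le_anti.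
rewrite nm_ge0 andbT.
set c := nm (u 1%N - u 0%N) / (1 - q) in lP.
apply: (@le0_all _ (2 * c)) => e e0.
have [N /(_ _ (leqnn _)) qN] := expr_lt q0 q1 e0.
have c0 : 0 <= c by rewrite divr_ge0 //; lra.
have := nm_tri (u N.+1) (f l) l; have := lP N.+1; have := fq (u N) l.
rewrite (nm_distC (f l) (u _)) -[u N.+1]/(f (u N)) exprS; have := lP N.
have Q0 : 0 <= q ^+ N by rewrite exprn_ge0.
have a1 : q * nm (u N - l) <= nm (u N - l) by rewrite ler_piMl // ltW.
have a2 : c * (q * q ^+ N) <= c * q ^+ N.
  by apply: ler_wpM2l => //; rewrite ler_piMl // ltW.
have a3 : c * q ^+ N <= c * e by apply: ler_wpM2l => //; rewrite ltW.
by lra.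
Qed.

End Projection.

Lemma ultra_fmap (S T : Type) (U : set_system S) (f : S -> T) :
  UltraFilter U -> UltraFilter (f @ U).
Proof.
move=> UU; split; first exact: fmap_proper_filter.
move=> G GF UG; rewrite predeqE => A; split; last exact: UG.
move=> GA; have [//|UnA] := in_ultra_setVsetC (f @^-1` A) UU.
have : G (A `&` ~` A) by apply: filterI => //; apply: UG.
by rewrite setICr => /filter_not_empty.
Qed.

(** * Limits along an ultrafilter *)

Section WeakLimits.
Variables (R : realType) (H : completeNormedModType R[i]).
Variable ip : {dot H for conjC}.
Hypothesis ip_norm : forall x : H, `|x| ^+ 2 = ip x x.
Variable U : set_system nat.
Hypothesis UU : UltraFilter U.
Local Notation g := (rip ip).
Let nmge0 (x : H) : 0 <= nm x := nm_ge0 x.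
Let cmodge0 (c : R[i]) : 0 <= cmod c := cmod_ge0 c.
Hint Resolve nmge0 cmodge0 : core.

Let u_ex (P : set nat) : U P -> exists n, P n.
Proof. exact: filter_ex. Qed.

Lemma ulim_ex (f : nat -> R) (M : R) : (\forall n \near U, `|f n| <= M) ->
  exists l : R, f @ U --> l.
Proof.
move=> fM; have UF := ultra_fmap f UU.
have := @segment_compact R (- M) M; rewrite compact_ultra.
have fs : (f @ U) [set` `[- M, M]].
  by rewrite /fmap /=; apply: filterS fM => n; rewrite /= in_itv /= ler_norml.
by move=> /(_ _ UF fs)[l [_ fl]]; exists l.
Qed.

Definition wlim (f : nat -> H) x := forall v, (fun n => g (f n) v) @ U --> g x v.
Definition slim (f : nat -> H) x := (fun n => nm (f n - x)) @ U --> (0 : R).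

Lemma ucvgP (f : nat -> R) (l : R) :
  f @ U --> l <-> forall e : R, 0 < e -> \forall n \near U, `|f n - l| < e.
Proof.
by split=> [/cvgrPdist_lt h e /h|h]; last (apply/cvgrPdist_lt => e /h);
  apply: filterS => n; rewrite distrC.
Qed.

Lemma ucvg_uniq (f : nat -> R) (a b : R) : f @ U --> a -> f @ U --> b -> a = b.
Proof. by move=> fa fb; apply: (cvg_unique _ fa fb). Qed.

Lemma ucvg_le (f : nat -> R) (a M : R) : f @ U --> a -> (\forall n \near U, f n <= M) -> a <= M.
Proof.
move=> /ucvgP fa fM; rewrite -subr_le0; apply: (@le0_all _ _ 1) => e /fa h.
have [n [h1 h2]] := u_ex (filterI h fM).
by move: h1; rewrite ltr_norml => /andP[]; lra.
Qed.

Lemma ucvg0_squeeze (f h : nat -> R) : (\forall n \near U, `|f n| <= h n) ->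
  h @ U --> (0 : R) -> f @ U --> (0 : R).
Proof.
move=> fh /ucvgP h0; apply/ucvgP => e /h0 he; apply: filterS2 fh he => n.
by rewrite !subr0 => h1 h2; apply: le_lt_trans h1 (le_lt_trans (ler_norm _) h2).
Qed.

Lemma ucvgM (c : R) (f : nat -> R) :
  f @ U --> (0 : R) -> (fun n => c * f n) @ U --> (0 : R).
Proof. by move=> f0; rewrite -(mulr0 c); apply: cvgMr. Qed.

Lemma slimP f x : slim f x <-> forall e : R, 0 < e -> \forall n \near U, nm (f n - x) < e.
Proof.
by split=> [/ucvgP h e /h|h]; last (apply/ucvgP => e /h);
  apply: filterS => n; rewrite subr0 ger0_norm.
Qed.

Lemma slim_squeeze f x (h : nat -> R) : (\forall n \near U, nm (f n - x) <= h n) ->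
  h @ U --> (0 : R) -> slim f x.
Proof. by move=> fh; apply: ucvg0_squeeze; apply: filterS fh => n; rewrite ger0_norm. Qed.

Lemma slim_cst x : slim (fun=> x) x.
Proof. by rewrite /slim; under eq_fun do rewrite subrr nm0; apply: cvg_cst. Qed.

Lemma slimD a b x y : slim a x -> slim b y -> slim (fun n => a n + b n) (x + y).
Proof.
move=> ax bx.
have ab : (fun n => nm (a n - x) + nm (b n - y)) @ U --> (0 : R).
  by rewrite -[0 : R]addr0; apply: cvgD ax bx.
apply: slim_squeeze ab.
by apply: nearW => n /=; rewrite opprD addrACA nmD.
Qed.

Lemma slimZ c a x : slim a x -> slim (fun n => c *: a n) (c *: x).
Proof.
move=> ax; have cx := ucvgM (cmod c) ax; apply: slim_squeeze cx.
by apply: nearW => n /=; rewrite -scalerBr nmZ.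
Qed.

Lemma slimN a x : slim a x -> slim (fun n => - a n) (- x).
Proof. by move=> /(slimZ (-1)); rewrite scaleN1r; under eq_fun do rewrite scaleN1r. Qed.

Lemma slimB a b x y : slim a x -> slim b y -> slim (fun n => a n - b n) (x - y).
Proof. by move=> ax /slimN; apply: slimD. Qed.

Lemma slim_map f (M : R) a x : lin f -> bd f M -> slim a x -> slim (fun n => f (a n)) (f x).
Proof.
move=> lf bf ax; have cx := ucvgM M ax; apply: slim_squeeze cx.
by apply: nearW => n /=; rewrite -(linB lf) bf.
Qed.

Lemma slim_bnd a x (M : R) : slim a x -> (\forall n \near U, nm (a n) <= M) -> nm x <= M.
Proof.
move=> /slimP ax aM; rewrite -subr_le0; apply: (@le0_all _ _ 1) => e /ax h.
have [n [h1 h2]] := u_ex (filterI h aM).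
by have := nm_tri (a n) x 0; rewrite !subr0 (nm_distC x); lra.
Qed.

Lemma slim_bounded a x : slim a x -> \forall n \near U, nm (a n) <= nm x + 1.
Proof.
move=> /slimP/(_ _ ltr01); apply: filterS => n h.
by have := nm_tri x (a n) 0; rewrite !subr0; lra.
Qed.

Lemma slim_ge a x (M : R) : slim a x -> (\forall n \near U, M <= nm (a n)) -> M <= nm x.
Proof.
move=> /slimP ax aM; rewrite -subr_le0; apply: (@le0_all _ _ 1) => e /ax h.
have [n [h1 h2]] := u_ex (filterI h aM).
by have := nm_tri x (a n) 0; rewrite !subr0; lra.
Qed.

Lemma slim_near a b x : (\forall n \near U, a n = b n) -> slim a x -> slim b x.
Proof.
move=> ab /slimP ax; apply/slimP => e /ax; apply: filterS2 ab => n -> //.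
Qed.

Lemma slim_wlim f x : slim f x -> wlim f x.
Proof.
move=> fx v; apply/ucvgP => e e0.
have d0 : 0 < e / (nm v + 1) by rewrite divr_gt0 //; have := nmge0 v; lra.
have /slimP/(_ _ d0) := fx; apply: filterS => n h.
rewrite -ripBl; apply: le_lt_trans (ler_rip ip_norm _ _) _.
by move: h; rewrite ltr_pdivlMr; have := nmge0 v; have := nmge0 (f n - x); nra.
Qed.

Lemma wlim_near a b x : (\forall n \near U, a n = b n) -> wlim a x -> wlim b x.
Proof.
move=> ab ax v; have /ucvgP h := ax v; apply/ucvgP => e /h.
by apply: filterS2 ab => n ->.
Qed.

Lemma wlim_unique f x y : wlim f x -> wlim f y -> x = y.
Proof.
by move=> fx fy; apply: (rip_all_eq ip_norm) => v; apply: ucvg_uniq (fx v) (fy v).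
Qed.

Lemma slim_unique f x y : slim f x -> slim f y -> x = y.
Proof. by move=> /slim_wlim fx /slim_wlim; apply: wlim_unique. Qed.

Lemma wlimD a b x y : wlim a x -> wlim b y -> wlim (fun n => a n + b n) (x + y).
Proof.
by move=> ax bx v; under eq_fun do rewrite ripDl; rewrite ripDl; apply: cvgD.
Qed.

Lemma wlimZ c a x : wlim a x -> wlim (fun n => c *: a n) (c *: x).
Proof.
by move=> ax v; under eq_fun do rewrite ripZc; rewrite ripZc; apply: ax.
Qed.

Lemma wlimN a x : wlim a x -> wlim (fun n => - a n) (- x).
Proof. by move=> /(wlimZ (c := -1)); rewrite scaleN1r; under eq_fun do rewrite scaleN1r. Qed.

Lemma wlimB a b x y : wlim a x -> wlim b y -> wlim (fun n => a n - b n) (x - y).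
Proof. by move=> ax /wlimN; apply: wlimD. Qed.

Lemma wlim_map f (M : R) a x : lin f -> bd f M -> wlim a x -> wlim (fun n => f (a n)) (f x).
Proof.
move=> lf bf ax v; have [w wP] := adjoint_ex ip_norm lf bf v.
by under eq_fun do rewrite wP; rewrite wP; apply: ax.
Qed.

Lemma wlim_bnd a x (M : R) : wlim a x -> (\forall n \near U, nm (a n) <= M) -> nm x <= M.
Proof.
move=> ax aM.
have : g x x <= M * nm x.
  apply: (ucvg_le (ax x)); apply: filterS aM => n h.
  by apply: le_trans (rip_le ip_norm _ _) _; apply: ler_wpM2r.
rewrite (rip_nm ip_norm).
have [->|x0] := eqVneq (nm x) 0.
  by have [n h _] := u_ex aM; apply: le_trans h.
by rewrite expr2 ler_pM2r // lt_def x0 nmge0.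
Qed.

(** Weak compactness of balls: the scalar limits along [U] exist for all test vectors
    simultaneously, they form a bounded real-linear functional, and [riesz] represents it by a
    vector. *)
Lemma wlim_ex (f : nat -> H) (M : R) : (\forall n \near U, nm (f n) <= M) ->
  exists x, wlim f x.
Proof.
move=> fM.
have /choice[h hP] : forall v, exists l : R, (fun n => g (f n) v) @ U --> l.
  move=> v; apply: (@ulim_ex _ (M * nm v)); apply: filterS fM => n fn.
  by apply: le_trans (ler_rip ip_norm _ _) _; apply: ler_wpM2r.
have [||x xP] := @riesz _ _ _ ip_norm h M.
- move=> r x y; apply: ucvg_uniq (hP _) _.
  under eq_fun do rewrite ripDr ripZr.
  by apply: cvgD (hP y); apply: cvgMr.
- move=> x; rewrite ler_norml; apply/andP; split.
    rewrite lerNl; apply: (@ucvg_le (fun n => - g (f n) x)).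
      by apply: cvgN.
    apply: filterS fM => n fn; rewrite -ripNl.
    by apply: le_trans (rip_le ip_norm _ _) _; rewrite nmN; apply: ler_wpM2r.
  apply: (ucvg_le (hP x)); apply: filterS fM => n fn.
  by apply: le_trans (rip_le ip_norm _ _) _; apply: ler_wpM2r.
by exists x => v; rewrite ripC -xP.
Qed.

End WeakLimits.

(** * Invariant graphs of strict contractions *)

Section Riccati.
Variables (R : realType) (H : completeNormedModType R[i]).
Variable ip : {dot H for conjC}.
Hypothesis ip_norm : forall x : H, `|x| ^+ 2 = ip x x.
Variables Pp Pm : {linear H -> H}.
Hypothesis Pp_proj : orthogonal_projection ip Pp.
Hypothesis Pm_proj : orthogonal_projection ip Pm.
Hypothesis PpDPm : forall x, Pp x + Pm x = x.
Local Notation g := (rip ip).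
Let nmge0 (x : H) : 0 <= nm x := nm_ge0 x.
Let cmodge0 (c : R[i]) : 0 <= cmod c := cmod_ge0 c.
Hint Resolve nmge0 cmodge0 : core.

Lemma Pp_idem x : Pp (Pp x) = Pp x. Proof. by case: Pp_proj. Qed.
Lemma Pm_idem x : Pm (Pm x) = Pm x. Proof. by case: Pm_proj. Qed.

Lemma PpPm x : Pp (Pm x) = 0.
Proof.
have -> : Pm x = x - Pp x by rewrite -{2}(PpDPm x) addrC addKr.
by rewrite linearB /= Pp_idem subrr.
Qed.

Lemma PmPp x : Pm (Pp x) = 0.
Proof.
have -> : Pp x = x - Pm x by rewrite -{2}(PpDPm x) addrK.
by rewrite linearB /= Pm_idem subrr.
Qed.

Lemma lin_Pp : lin Pp. Proof. by move=> c x y; rewrite linearP. Qed.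
Lemma lin_Pm : lin Pm. Proof. by move=> c x y; rewrite linearP. Qed.

Lemma rip_Pp x y : g (Pp x) y = g x (Pp y).
Proof. by case: Pp_proj => _ h; rewrite /rip h. Qed.

Lemma rip_Pm x y : g (Pm x) y = g x (Pm y).
Proof. by case: Pm_proj => _ h; rewrite /rip h. Qed.

Lemma pythag x : nm x ^+ 2 = nm (Pp x) ^+ 2 + nm (Pm x) ^+ 2.
Proof.
by rewrite -{1}(PpDPm x) (nmD_sqr ip_norm) rip_Pp PpPm rip0r mulr0 addr0.
Qed.

Lemma sqr_leP (a b : R) : 0 <= b -> a ^+ 2 <= b ^+ 2 -> a <= b.
Proof. by move=> b0; apply: contraTT; rewrite -!ltNge => ba; nra. Qed.

Lemma nm_Pp x : nm (Pp x) <= nm x.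
Proof. by apply: sqr_leP => //; rewrite (pythag x); have := sqr_ge0 (nm (Pm x)); lra. Qed.

Lemma nm_Pm x : nm (Pm x) <= nm x.
Proof. by apply: sqr_leP => //; rewrite (pythag x); have := sqr_ge0 (nm (Pp x)); lra. Qed.

Lemma le0_expr (a M q : R) : 0 <= q -> q < 1 -> (forall n, a <= M * q ^+ n) -> a <= 0.
Proof.
move=> q0 q1 h; apply: (@le0_all _ _ `|M|) => e e0.
have [N /(_ _ (leqnn _)) qN] := expr_lt q0 q1 e0.
apply: le_trans (h N) _; apply: (@le_trans _ _ (`|M| * q ^+ N)).
  by apply: ler_wpM2r (ler_norm _); rewrite exprn_ge0.
by apply: ler_wpM2l => //; rewrite ltW.
Qed.

Lemma eq_expr (x y : H) (M q : R) : 0 <= q -> q < 1 ->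
  (forall n, nm (x - y) <= M * q ^+ n) -> x = y.
Proof.
move=> q0 q1 h; apply/eqP; rewrite -subr_eq0 -nm_eq0; apply/eqP/le_anti.
by rewrite nmge0 (le0_expr q0 q1 h).
Qed.

Lemma fix_unique (f : H -> H) (q : R) x y : q < 1 ->
  (forall x y, nm (f x - f y) <= q * nm (x - y)) -> x = f x -> y = f y -> x = y.
Proof.
move=> q1 h fx fy; apply/eqP; rewrite -subr_eq0 -nm_eq0; apply/eqP/le_anti.
by have := h x y; rewrite -fx -fy; have := nmge0 (x - y); nra.
Qed.

(* If [T] exchanges the [Pm]-components of [v] and [V v] (the Potapov-Ginzburg
   transform of [V]), the last clause says that [V] maps [u + K u] to
   [W u + K (W u)] for [u] in the range of [Pp], so that the graph of [K] is
   invariant under [V]. *)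
Definition invpair (T K W : H -> H) :=
  [/\ lin K, lin W, (forall u, nm (K u) <= nm u),
      (forall u, Pm (K u) = K u /\ Pp (W u) = W u) &
      forall u, T (Pp u + K (W u)) = W u + K u].

Section Strict.
Variables (T : H -> H) (r : R).
Hypotheses (r0 : 0 <= r) (r1 : r < 1) (Tlin : lin T).
Hypothesis Tbd : forall x, nm (T x) <= r * nm x.

Let r2 : r ^+ 2 < 1. Proof. by rewrite expr_lt1. Qed.

(** Graph transform: in [T (Pp u + K w) = w + k] the H_+ component determines [w] by contraction,
    and the H_- component then defines the next [K]. A fixed point of [stepK], with its [solW], is
    an [invpair]. *)
Definition solW (K : H -> H) u := xget 0 [set w | w = Pp (T (Pp u + K w))].
Definition stepK (K : H -> H) u := Pm (T (Pp u + K (solW K u))).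

Section Step.
Variable K : H -> H.
Hypotheses (Klin : lin K) (Kbd : forall u, nm (K u) <= nm u).

Lemma solW_contr u w w' :
  nm (Pp (T (Pp u + K w)) - Pp (T (Pp u + K w'))) <= r * nm (w - w').
Proof.
rewrite -linearB /= -(linB Tlin) opprD addrACA subrr add0r -(linB Klin).
apply: le_trans (nm_Pp _) _; apply: le_trans (Tbd _) _.
exact: ler_wpM2l.
Qed.

Lemma solWE u : solW K u = Pp (T (Pp u + K (solW K u))).
Proof.
have [w wE] := fixpoint r1 (solW_contr u).
have h : [set w | w = Pp (T (Pp u + K w))] !=set0 by exists w.
by have := xgetPex 0 h.
Qed.

Lemma solW_lin : lin (solW K).
Proof.
move=> c x y; apply: (fix_unique r1 (solW_contr (c *: x + y))); first exact: solWE.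
rewrite {1}(solWE x) {1}(solWE y) -linearP /= -Tlin; congr (Pp (T _)).
by rewrite Klin linearP /= scalerDr addrACA.
Qed.

Lemma stepK_lin : lin (stepK K).
Proof.
move=> c x y; rewrite /stepK solW_lin Klin -linearP /= -Tlin; congr (Pm (T _)).
by rewrite linearP /= scalerDr addrACA.
Qed.

Lemma stepKE u : T (Pp u + K (solW K u)) = solW K u + stepK K u.
Proof. by rewrite {2}solWE PpDPm. Qed.

Lemma solW_Pp u : Pp (solW K u) = solW K u.
Proof. by rewrite solWE Pp_idem. Qed.

Lemma stepK_Pm u : Pm (stepK K u) = stepK K u.
Proof. exact: Pm_idem. Qed.

End Step.

(** Pythagoras on both sides of [Tbd]. Since [r < 1], regrouping gives [nm w ^+ 2 - nm b ^+ 2 <= nm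
    (Pp a) ^+ 2 - nm k ^+ 2]: the indefinite form does not increase from [Pp a + k] to [w + b]. *)
Lemma energy a b w k : Pm b = b -> Pp w = w -> Pm k = k ->
  T (Pp a + b) = w + k ->
  nm w ^+ 2 + nm k ^+ 2 <= r ^+ 2 * (nm (Pp a) ^+ 2 + nm b ^+ 2).
Proof.
move=> Pb Pw Pk Te.
have := Tbd (Pp a + b); rewrite Te => /(sqr_le (nmge0 _)); rewrite exprMn.
rewrite (pythag (w + k)) (pythag (Pp a + b)) !linearD /=.
rewrite -{1 2}Pk -{1 2}Pw -{1 2}Pb !Pp_idem !Pm_idem !PpPm !PmPp !addr0 !add0r.
by rewrite Pk Pw Pb.
Qed.

Definition Kn n := iter n stepK (fun=> 0).
Arguments Kn : simpl never.

Lemma Kn_Pm n u : Pm (Kn n u) = Kn n u.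
Proof. by case: n => [|n]; rewrite /Kn /=; [rewrite linear0 | exact: stepK_Pm]. Qed.

Lemma Kn_prop n : lin (Kn n) /\ forall u, nm (Kn n u) <= nm u.
Proof.
elim: n => [|n [Kl Kb]].
  by split=> [c x y|u]; rewrite /Kn /= ?scaler0 ?addr0 // nm0.
split; first exact: stepK_lin.
move=> u; apply: sqr_leP => //.
have := energy (Kn_Pm n _) (solW_Pp Kl Kb u) (Kn_Pm n.+1 u) (stepKE Kl Kb u).
have := sqr_le (nmge0 _) (Kb (solW (Kn n) u)).
have := sqr_le (nmge0 _) (nm_Pp u).
have := sqr_ge0 (nm (Pp u)); have := sqr_ge0 (nm (Kn n (solW (Kn n) u))).
set a := nm (Pp u) ^+ 2; set b := nm (Kn n _) ^+ 2; set c := nm (solW _ _) ^+ 2.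
move=> b0 a0; have : r ^+ 2 * (a + b) <= a + b.
  by rewrite ler_piMl ?addr_ge0 // ltW.
by lra.
Qed.

Let c := (1 - r ^+ 2)^-1.

Let c1 : 1 <= c. Proof. by rewrite /c invf_ge1; have := r2; have := sqr_ge0 r; lra. Qed.

(** Two vectors are needed because consecutive iterates evaluate the previous maps at different
    points, [solW (Kn j.+1) u] and [solW (Kn j) u']. Applying [energy] to the difference of the two
    step equations absorbs the distance of these points into the subtracted term; the indefinite
    form on the right does not increase, so each step gains a factor [r ^+ 2]. The value of [c] is
    what the base case asks for. *)
Lemma Kn_diff j u u' :
  nm (Kn j.+1 u - Kn j u') ^+ 2 - r ^+ 2 * nm (Pp (u - u')) ^+ 2 <=
  (r ^+ 2) ^+ j * c * (nm (Pp u) ^+ 2 - nm (Kn j.+1 u) ^+ 2).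
Proof.
elim: j u u' => [|j IH] u u'.
  have [Kl Kb] := Kn_prop 0.
  have := energy (Kn_Pm 0 _) (solW_Pp Kl Kb u) (Kn_Pm 1 u) (stepKE Kl Kb u).
  have K0 x : Kn 0 x = 0 by [].
  rewrite !K0 nm0 subr0 expr0 mul1r expr0n addr0.
  set k := nm (Kn 1 u) ^+ 2; set w := nm (solW _ _); set p := nm (Pp u) ^+ 2.
  have k0 : 0 <= k := sqr_ge0 _; have p0 : 0 <= p := sqr_ge0 _.
  have w0 := sqr_ge0 w; have q0 := sqr_ge0 (nm (Pp (u - u'))).
  have cE : c * (1 - r ^+ 2) = 1 by rewrite /c mulVf //; have := r2; lra.
  move=> wk; have s0 := sqr_ge0 r; have := r2; have := c1.
  move: c (r ^+ 2) cE s0 wk => C s cE s0 wk C1 s1.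
  have : s * p <= p by rewrite ler_piMl // ltW.
  have : 0 <= s * nm (Pp (u - u')) ^+ 2 by rewrite mulr_ge0.
  have : C * k <= C * (s * p) by apply: ler_wpM2l; lra.
  have : C * p - C * (s * p) = p by rewrite -[RHS]mul1r -cE; ring.
  by lra.
have [Kl Kb] := Kn_prop j; have [Kl' Kb'] := Kn_prop j.+1.
have e1 := stepKE Kl' Kb' u; have e2 := stepKE Kl Kb u'.
have E1 := energy (Kn_Pm _ _) (solW_Pp Kl' Kb' u) (Kn_Pm j.+2 u) e1.
have e3 : T (Pp (u - u') + (Kn j.+1 (solW (Kn j.+1) u) - Kn j (solW (Kn j) u'))) =
    (solW (Kn j.+1) u - solW (Kn j) u') + (Kn j.+2 u - Kn j.+1 u').
  rewrite -[Kn j.+2 u]/(stepK (Kn j.+1) u) -[Kn j.+1 u']/(stepK (Kn j) u').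
  by rewrite [RHS]addrACA -opprD -e1 -e2 -(linB Tlin) opprD linearB /= [in RHS]addrACA.
have E2 : nm (solW (Kn j.+1) u - solW (Kn j) u') ^+ 2 + nm (Kn j.+2 u - Kn j.+1 u') ^+ 2
    <= r ^+ 2 * (nm (Pp (u - u')) ^+ 2 +
         nm (Kn j.+1 (solW (Kn j.+1) u) - Kn j (solW (Kn j) u')) ^+ 2).
  by apply: energy e3; rewrite linearB /= ?Kn_Pm ?(solW_Pp Kl' Kb') ?(solW_Pp Kl Kb).
move: E1; have := IH (solW (Kn j.+1) u) (solW (Kn j) u').
rewrite !linearB /= !(solW_Pp Kl' Kb') !(solW_Pp Kl Kb) => {}IH E1.
rewrite linearB /= in E2.
rewrite [_ ^+ j.+1]exprS; have s0 := sqr_ge0 r; have s1 := r2; have C1 := c1.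
move: (nm (Pp u - Pp u')) (nm (Kn j.+2 u - _)) E2 => P L E2.
move: (nm (_ - Kn j _)) (nm (solW _ _ - _)) E2 IH => D X E2 IH.
move: (nm (Kn j.+1 _)) (nm (solW _ _)) E1 IH => kw w E1 IH.
have := ler_wpM2l s0 IH; move: (nm (Pp u)) (nm (Kn j.+2 u)) E1 => p k E1 IH'.
have X0 := sqr_ge0 X; have p0 := sqr_ge0 p; have kw0 := sqr_ge0 kw.
have sj : 0 <= (r ^+ 2) ^+ j by rewrite exprn_ge0.
move: (r ^+ 2) ((r ^+ 2) ^+ j) s0 s1 sj E1 E2 IH' => s t s0 s1 t0 E1 E2 IH'.
have e1' : s * (s * X ^+ 2) <= X ^+ 2.
  by rewrite mulrA ler_piMl // mulr_ile1 // ltW.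
have e2' : s * p ^+ 2 <= p ^+ 2 by rewrite ler_piMl // ltW.
have e3' : s * kw ^+ 2 <= kw ^+ 2 by rewrite ler_piMl // ltW.
have : s * t * c * (w ^+ 2 - kw ^+ 2) <= s * t * c * (p ^+ 2 - k ^+ 2).
  by apply: ler_wpM2l; [rewrite !mulr_ge0 //; lra | lra].
by move: IH'; rewrite !mulrA; lra.
Qed.

Lemma Kn_cauchy u n : nm (Kn n.+1 u - Kn n u) <= c * nm u * r ^+ n.
Proof.
have C1 := c1; apply: sqr_leP.
  by rewrite !mulr_ge0 ?exprn_ge0 //; lra.
have := Kn_diff n u u; rewrite subrr linear0 nm0 expr0n mulr0 subr0.
move=> /le_trans; apply.
have -> : (c * nm u * r ^+ n) ^+ 2 = c ^+ 2 * nm u ^+ 2 * (r ^+ 2) ^+ n.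
  by rewrite exprMn exprMn -!exprM mulnC.
have t0 : 0 <= (r ^+ 2) ^+ n by rewrite exprn_ge0 ?sqr_ge0.
have := sqr_le (nmge0 _) (nm_Pp u); have := sqr_ge0 (nm (Kn n.+1 u)).
have := sqr_ge0 (nm u).
move: (_ ^+ n) t0 (nm (Kn _ _) ^+ 2) (nm u ^+ 2) (nm _ ^+ 2) => t t0 k a b a0 k0 ba.
have : c * a <= c ^+ 2 * a by apply: ler_wpM2r => //; rewrite ler_eXnr.
have : c * (b - k) <= c * a by apply: ler_wpM2l; lra.
move=> h1 h2; have := ler_wpM2l t0 (le_trans h1 h2); lra.
Qed.

(** [K] is the limit of the iterates and [W] is solved from it. Powers of [W] stay bounded because
    the indefinite form does not increase along its orbits, while on the graph of [K] it dominates
    the squared norm. *)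
Lemma strict_fixed : exists K W, invpair T K W /\
  exists D : R, forall k u, nm (iter k W u) <= D * nm u.
Proof.
have C1 := c1.
have /choice[K KP] : forall u, exists l, forall n,
    nm (Kn n u - l) <= c * nm u / (1 - r) * r ^+ n.
  by move=> u; apply: geom_cauchy => // n; apply: Kn_cauchy.
have Klin : lin K.
  move=> a x y; apply: (@eq_expr _ _ (c * nm (a *: x + y) / (1 - r) +
    (cmod a * (c * nm x / (1 - r)) + c * nm y / (1 - r))) _ r0 r1) => n.
  have [Kl _] := Kn_prop n.
  apply: le_trans (nm_tri (Kn n (a *: x + y)) _ _) _.
  rewrite mulrDl; apply: lerD; first by rewrite nm_distC KP.
  rewrite Kl opprD addrACA -scalerBr; apply: le_trans (nmD _ _) _.
  rewrite nmZ mulrDl -mulrA; apply: lerD; last exact: KP.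
  exact: ler_wpM2l (KP _ _).
have KPm u : Pm (K u) = K u.
  apply: (@eq_expr _ _ (2 * (c * nm u / (1 - r))) _ r0 r1) => n.
  apply: le_trans (nm_tri (Kn n u) _ _) _; have := KP u n.
  have : nm (Pm (K u) - Kn n u) <= nm (Kn n u - K u).
    by rewrite -{1}(Kn_Pm n u) -linearB /= (nm_distC (Kn n u)) nm_Pm.
  by lra.
have Kbd u : nm (K u) <= nm u.
  rewrite -subr_le0; apply: (le0_expr r0 r1 (M := c * nm u / (1 - r))) => n.
  have [_ Kb] := Kn_prop n; have := Kb u; have := KP u n.
  by have := nm_tri (Kn n u) (K u) 0; rewrite !subr0 (nm_distC (K u)); lra.
pose W := solW K.
have WPp u : Pp (W u) = W u by apply: solW_Pp.
(* What remains is [stepK K u = K u]: the solution [W u] differs from [wn] by a multiple of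
   [r ^+ n], hence so does [stepK K u] from [Kn n.+1 u]. *)
have TE u : T (Pp u + K (W u)) = W u + K u.
  rewrite stepKE //; congr (_ + _).
  have r1' : 0 < 1 - r by have := r1; lra.
  pose d := c * nm (W u) / (1 - r).
  have d0 : 0 <= d by rewrite divr_ge0 ?mulr_ge0 ?(ltW r1') //; lra.
  pose B := d / (1 - r) + d + c * nm u / (1 - r) * r.
  apply: (@eq_expr _ _ B _ r0 r1) => n.
  have [Kl Kb] := Kn_prop n.
  set wn := solW (Kn n) u.
  have E : nm (T (Pp u + K (W u)) - T (Pp u + Kn n wn)) <=
      r * (d * r ^+ n + nm (W u - wn)).
    rewrite -(linB Tlin) opprD addrACA subrr add0r; apply: le_trans (Tbd _) _.
    apply: ler_wpM2l => //; apply: le_trans (nm_tri (Kn n (W u)) _ _) _.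
    apply: lerD; first by rewrite nm_distC KP.
    by rewrite -(linB Kl).
  have Wn : nm (W u - wn) <= d / (1 - r) * r ^+ n.
    have : nm (W u - wn) <= nm (T (Pp u + K (W u)) - T (Pp u + Kn n wn)).
      have e1 : W u = Pp (T (Pp u + K (W u))) by apply: solWE.
      have e2 : wn = Pp (T (Pp u + Kn n wn)) by apply: solWE.
      by rewrite {1}e1 {1}e2 -linearB; apply: nm_Pp.
    move=> h; have := le_trans h E; have dn0 : 0 <= d * r ^+ n.
      by rewrite mulr_ge0 ?exprn_ge0.
    rewrite [d / _ * _]mulrAC ler_pdivlMr //.
    have : r * (d * r ^+ n) <= d * r ^+ n by rewrite ler_piMl // ltW.
    by lra.
  apply: le_trans (nm_tri (Kn n.+1 u) _ _) _.
  have h1 : nm (stepK K u - Kn n.+1 u) <= d * r ^+ n + nm (W u - wn).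
    rewrite -[Kn n.+1 u]/(stepK (Kn n) u) /stepK -linearB /=.
    apply: le_trans (nm_Pm _) (le_trans E _).
    have sn0 : 0 <= d * r ^+ n + nm (W u - wn).
      by rewrite addr_ge0 // mulr_ge0 // exprn_ge0.
    by rewrite ler_piMl // ltW.
  have := KP u n.+1; rewrite exprS /B; move: h1 Wn.
  by rewrite !mulrDl -!mulrA; lra.
exists K, W; split.
  by split => //; apply: solW_lin.
have q_le u : nm (W u) ^+ 2 - nm (K (W u)) ^+ 2 <= nm (Pp u) ^+ 2 - nm (K u) ^+ 2.
  have := energy (KPm _) (WPp u) (KPm u) (TE u).
  have : r ^+ 2 * (nm (Pp u) ^+ 2 + nm (K (W u)) ^+ 2) <=
      nm (Pp u) ^+ 2 + nm (K (W u)) ^+ 2.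
    by rewrite ler_piMl ?addr_ge0 ?sqr_ge0 // ltW.
  by lra.
have qk k u : nm (iter k.+1 W u) ^+ 2 - nm (K (iter k.+1 W u)) ^+ 2 <= nm u ^+ 2.
  elim: k => [|k IH].
    apply: le_trans (q_le u) _; have := sqr_le (nmge0 _) (nm_Pp u).
    by have := sqr_ge0 (nm (K u)); lra.
  by apply: le_trans IH; rewrite [iter k.+2 _ _]iterS; apply: le_trans (q_le _) _;
     rewrite [Pp _]WPp.
(* The sharper norm [r] of [K] makes the form at least [1 - r ^+ 2] times the squared norm, which is
   where the power bound [c] comes from. *)
have Kr u : nm (K u) <= r * nm u.
  apply: sqr_leP; first exact: mulr_ge0.
  have := energy (KPm _) (WPp u) (KPm u) (TE u).
  have := sqr_le (nmge0 _) (nm_Pp u); have := sqr_le (nmge0 _) (Kbd (W u)).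
  rewrite exprMn; have := sqr_ge0 r; have := sqr_ge0 (nm (K (W u))); have := r2.
  move: (r ^+ 2) (nm (K (W u)) ^+ 2) => s a s1 a0 s0 h1 h2 h3.
  have : s * a <= a by rewrite ler_piMl // ltW.
  have : s * nm (Pp u) ^+ 2 <= s * nm u ^+ 2 by apply: ler_wpM2l.
  by lra.
exists c => -[|k] u; first by rewrite /=; have := nmge0 u; nra.
apply: sqr_leP; first by rewrite mulr_ge0 //; lra.
have := qk k u; have := sqr_le (nmge0 _) (Kr (iter k.+1 W u)).
have := sqr_ge0 (nm u); rewrite !exprMn.
move: (nm (iter _ _ _) ^+ 2) (nm u ^+ 2) => a b b0 h1 h2.
have h3 : (1 - r ^+ 2) * a <= b by lra.
have : a <= c * b by rewrite mulrC /c ler_pdivlMr 1?mulrC //; have := r2; lra.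
have : c * b <= c ^+ 2 * b by apply: ler_wpM2r => //; rewrite ler_eXnr.
by lra.
Qed.

End Strict.
End Riccati.

(** * Growth of powers from lower bounds on a circle, and diagonal limits *)

Section PowerGrowth.
Variables (R : realType) (H : completeNormedModType R[i]).
Variable ip : {dot H for conjC}.
Hypothesis ip_norm : forall x : H, `|x| ^+ 2 = ip x x.
Let nmge0 (x : H) : 0 <= nm x := nm_ge0 x.
Let cmodge0 (c : R[i]) : 0 <= cmod c := cmod_ge0 c.
Hint Resolve nmge0 cmodge0 : core.

Lemma sum_even_odd (f : nat -> H) n :
  \sum_(m < n.*2) f m = \sum_(m < n) f m.*2 + \sum_(m < n) f m.*2.+1.
Proof.
elim: n => [|n IH]; first by rewrite !big_ord0 addr0.
by rewrite doubleS !big_ord_recr /= IH -!addrA; congr (_ + _); rewrite addrCA.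
Qed.

(* Splitting into even and odd parts replaces Cauchy's estimate on the circle. *)
Lemma coef_bound s (v : nat -> H) (t B : R) : 0 < t ->
  (forall z, cmod z = t -> nm (\sum_(m < 2 ^ s) z ^+ m *: v m) <= B) ->
  forall m, (m < 2 ^ s)%N -> t ^+ m * nm (v m) <= B.
Proof.
elim: s v t B => [|s IH] v t B t0 h m.
  rewrite expn0 ltnS leqn0 => /eqP ->.
  have := h t%:C; rewrite cmodR gtr0_norm // => /(_ erefl).
  by rewrite big_ord1 !expr0 scale1r mul1r.
have sq z : cmod z = t ^+ 2 -> exists2 y, y ^+ 2 = z & cmod y = t.
  move=> zt; exists (sqrtc z); first by rewrite sqr_sqrtc.
  apply/eqP; rewrite -(@eqrXn2 _ 2) // ?(ltW t0) //.
  by rewrite -cmodX sqr_sqrtc zt.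
have t20 : 0 < t ^+ 2 by rewrite exprn_gt0.
pose E z := \sum_(m < 2 ^ s) z ^+ m *: v m.*2.
pose O z := \sum_(m < 2 ^ s) z ^+ m *: v m.*2.+1.
have pE y : \sum_(m < 2 ^ s.+1) y ^+ m *: v m = E (y ^+ 2) + y *: O (y ^+ 2).
  rewrite expnS mul2n (sum_even_odd (fun m => y ^+ m *: v m)); congr (_ + _).
    by apply: eq_bigr => i _; rewrite -exprM mul2n.
  by rewrite scaler_sumr; apply: eq_bigr => i _; rewrite scalerA -exprM mul2n exprS.
have two (x : H) : nm (x + x) = 2 * nm x.
  by rewrite -mulr2n -scaler_nat -(rmorph_nat (real_complex R)) nmZr ger0_norm.
have hE z : cmod z = t ^+ 2 -> nm (E z) <= B.
  move=> /sq[y <- yt]; have := h y yt; have := h (- y); rewrite cmodN => /(_ yt).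
  rewrite !pE sqrrN => h1 h2; have := nmD (E (y ^+ 2) + y *: O (y ^+ 2)) (E (y ^+ 2) + - y *: O (y ^+ 2)).
  by rewrite scaleNr addrACA subrr addr0 two; move: h1 h2; rewrite scaleNr; lra.
have hO z : cmod z = t ^+ 2 -> nm (O z) <= B / t.
  move=> /sq[y <- yt]; have := h y yt; have := h (- y); rewrite cmodN => /(_ yt).
  rewrite !pE sqrrN => h1 h2; have := nmB (E (y ^+ 2) + y *: O (y ^+ 2)) (E (y ^+ 2) + - y *: O (y ^+ 2)).
  rewrite opprD addrACA subrr add0r scaleNr opprK two nmZ yt ler_pdivlMr //.
  by move: h1 h2; rewrite scaleNr; lra.
rewrite expnS mul2n => ms.
have mh : (m./2 < 2 ^ s)%N.
  by rewrite -ltn_double; apply: leq_ltn_trans ms; rewrite -{2}(odd_double_half m) leq_addl.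
have tm k : t ^+ k.*2 = (t ^+ 2) ^+ k by rewrite -exprM mul2n.
rewrite -(odd_double_half m); case: (odd m); last first.
  rewrite /= add0n tm; exact: (IH (fun m => v m.*2) (t ^+ 2) _ t20 hE).
rewrite /= add1n exprS tm -mulrA [t * _]mulrC -ler_pdivlMr //.
exact: (IH (fun m => v m.*2.+1) (t ^+ 2) _ t20 hO).
Qed.

Lemma lin_iter W k : lin W -> lin (iter k W) (H := H).
Proof. by move=> lW; elim: k => [|k IH] c x y //=; rewrite IH lW. Qed.

(* The constant does not see the power bound [D], which only serves to make the
   remainder of the telescoping sum [\sum_(m < n) z ^+ m *: iter m W x] negligible. *)
Lemma power_growth (W : H -> H) (rho c D : R) (x : H) : lin W ->
  1 < rho -> 0 < c ->
  (forall th y, cmod th = rho -> (exists z, y = \sum_(m < z.1) z.2 ^+ m *: iter m W x) ->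
     c * nm y <= nm (W y - th *: y)) ->
  (forall k, nm (iter k W x) <= D * nm x) ->
  forall k, nm (iter k W x) <= rho ^+ k * (2 * rho / c * nm x).
Proof.
move=> lW rho1 c0 low pb k.
have rho0 : 0 < rho by lra.
have [N NP] : exists N, forall n, (N <= n)%N -> `|D| * rho^-1 ^+ n <= 1.
  have d0 : 0 < (`|D| + 1)^-1 by rewrite invr_gt0; have := normr_ge0 D; lra.
  have i0 : 0 <= rho^-1 by rewrite invr_ge0 ltW.
  have i1 : rho^-1 < 1 by rewrite invf_lt1.
  have [N NP] := expr_lt i0 i1 d0; exists N => n /NP.
  have D0 := normr_ge0 D; rewrite -[(`|D| + 1)^-1]mul1r ltr_pdivlMr; last by lra.
  by have := exprn_ge0 n i0; lra.
(* The truncation length [2 ^ s] is a power of two, as [coef_bound] requires, and lies beyond both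
   [k] and the index from which [rho ^+ n] dominates [D]. *)
pose s := maxn N k.
have sN : (N <= 2 ^ s)%N by apply: leq_trans (ltnW (ltn_expl s _)) => //; rewrite leq_maxl.
have sk : (k < 2 ^ s)%N by apply: leq_ltn_trans (ltn_expl s _) => //; rewrite leq_maxr.
have t0 : 0 < rho^-1 by rewrite invr_gt0.
have := @coef_bound s (fun m => iter m W x) rho^-1 (2 * rho / c * nm x) t0 _ k sk.
rewrite exprVn ler_pdivrMl ?exprn_gt0 //; apply.
move=> z zr; set n := (2 ^ s)%N; set p := \sum_(m < n) _.
have z0 : z != 0 by rewrite -cmod_eq0 zr gt_eqF.
have tz : cmod z^-1 = rho by rewrite cmodV zr invrK.
have := low z^-1 p tz; have pex : exists y : nat * R[i], p = \sum_(m < y.1) y.2 ^+ m *: iter m W x.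
  by exists (n, z).
move=> /(_ pex).
have tel : W p - z^-1 *: p = z ^+ n *: (z^-1 *: iter n W x) - z^-1 *: x.
  rewrite /p; elim: (n) => [|j IH].
    by rewrite !big_ord0 (lin0 lW) scaler0 subrr expr0 scale1r subrr.
  rewrite !big_ord_recr /= (linD lW) (linZ lW) scalerDr opprD addrACA IH.
  rewrite !scalerA [z ^+ j.+1]exprSr mulfK // [z^-1 * _]mulrC.
  by vec ip_norm.
rewrite tel => h.
have b1 : nm (z ^+ n *: (z^-1 *: iter n W x)) <= rho * nm x.
  rewrite !nmZ tz cmodX zr mulrCA; apply: ler_wpM2l; first exact: ltW.
  have := pb n; have := NP n sN.
  have e0 : 0 <= rho^-1 ^+ n by rewrite exprn_ge0 // ltW.
  move=> a1 a2.
  have a3 : D * nm x <= `|D| * nm x by apply: ler_wpM2r => //; apply: ler_norm.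
  have := ler_wpM2l e0 (le_trans a2 a3).
  by have := ler_wpM2r (nmge0 x) a1; lra.
have := nmB (z ^+ n *: (z^-1 *: iter n W x)) (z^-1 *: x).
rewrite [nm (z^-1 *: x)]nmZ tz mulrAC ler_pdivlMr //; lra.
Qed.

Variable U : set_system nat.
Hypothesis UU : UltraFilter U.
Hypothesis Uoo : forall N, U [set n | (N <= n)%N].

(** For each [n] choose a solution of [Q n k] for the largest solvable [k <= n]; monotonicity in [k]
    makes it solve all smaller ones. A fixed [k] is both solvable and below [n] for [U]-most [n]. *)
Lemma diagonal_choice (T : Type) (x0 : T) (Q : nat -> nat -> T -> Prop) :
  (forall n k x, Q n k.+1 x -> Q n k x) ->
  (forall k, U [set n | exists x, Q n k x]) ->
  exists x, forall k, U [set n | Q n k (x n)].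
Proof.
move=> Qm QU.
have Qle n k l x : (k <= l)%N -> Q n l x -> Q n k x.
  by move=> /subnK <-; elim: (l - k)%N => [//|j IH]; rewrite addSn => /Qm.
have /choice[x xP] : forall n, exists x, forall k, (k <= n)%N -> (exists y, Q n k y) -> Q n k x.
  move=> n; suff: forall m, exists x, forall k, (k <= m)%N -> (exists y, Q n k y) -> Q n k x by [].
  elim=> [|m [x IH]].
    have [[y Qy]|nQ] := pselect (exists y, Q n 0%N y).
      by exists y => k; rewrite leqn0 => /eqP ->.
    by exists x0 => k; rewrite leqn0 => /eqP ->.
  have [[y Qy]|nQ] := pselect (exists y, Q n m.+1 y).
    by exists y => k km _; apply: Qle Qy.
  by exists x => k; rewrite leq_eqVlt => /orP[/eqP -> //|]; rewrite ltnS; apply: IH.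
exists x => k; have /filterI/(_ (Uoo k)) := QU k.
by apply: filterS => n [ex kn]; apply: xP.
Qed.

Lemma ucvg_invS : (fun n => (n.+2%:R : R)^-1) @ U --> (0 : R).
Proof.
apply/(ucvgP UU) => e e0; have [N NP] := invS_lt e0.
have := Uoo N; apply: filterS => n /= Nn.
by rewrite subr0 ger0_norm ?invr_ge0 // NP // ltnW.
Qed.

Lemma ucvg_C (th : nat -> R[i]) (M : R) : (\forall n \near U, cmod (th n) <= M) ->
  exists t : R[i], (fun n => cmod (th n - t)) @ U --> (0 : R).
Proof.
have reim (z : R[i]) : `|complex.Re z| <= cmod z /\ `|complex.Im z| <= cmod z.
  split; apply: sqr_leP => //; rewrite real_normK ?num_real // cmod_sqr;
  by have := sqr_ge0 (complex.Re z); have := sqr_ge0 (complex.Im z); lra.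
have cm (z : R[i]) : cmod z <= `|complex.Re z| + `|complex.Im z|.
  apply: sqr_leP; first by rewrite addr_ge0.
  rewrite cmod_sqr -(real_normK (num_real (complex.Re z))) -(real_normK (num_real (complex.Im z))).
  by have := normr_ge0 (complex.Re z); have := normr_ge0 (complex.Im z); nra.
move=> thM.
have [a ra] : exists a : R, (fun n => complex.Re (th n)) @ U --> a.
  by apply: (ulim_ex UU (M := M)); apply: filterS thM => n; apply: le_trans (reim _).1.
have [b rb] : exists b : R, (fun n => complex.Im (th n)) @ U --> b.
  by apply: (ulim_ex UU (M := M)); apply: filterS thM => n; apply: le_trans (reim _).2.
exists (a +i* b)%C; apply/(ucvgP UU) => e e0.
have e20 : 0 < e / 2 by rewrite divr_gt0.
move/(ucvgP UU)/(_ _ e20): ra => ra; move/(ucvgP UU)/(_ _ e20): rb.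
apply: filterS2 ra => n ha hb; rewrite subr0 ger0_norm //.
apply: le_lt_trans (cm _) _; move: ha hb; case: (th n) => x y /=; lra.
Qed.

End PowerGrowth.

(** * Invariant graphs of contractions with a compact corner *)

Section InvariantPair.
Variables (R : realType) (H : completeNormedModType R[i]).
Variable ip : {dot H for conjC}.
Hypothesis ip_norm : forall x : H, `|x| ^+ 2 = ip x x.
Variables Pp Pm : {linear H -> H}.
Hypothesis Pp_proj : orthogonal_projection ip Pp.
Hypothesis Pm_proj : orthogonal_projection ip Pm.
Hypothesis PpDPm : forall x, Pp x + Pm x = x.
Local Notation g := (rip ip).
Let nmge0 (x : H) : 0 <= nm x := nm_ge0 x.
Let cmodge0 (c : R[i]) : 0 <= cmod c := cmod_ge0 c.
Hint Resolve nmge0 cmodge0 : core.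
Variable U : set_system nat.
Hypothesis UU : UltraFilter U.
Hypothesis Uoo : forall N, U [set n | (N <= n)%N].
Local Notation wlim := (wlim ip U).
Local Notation slim := (@slim R H U).
Local Notation nmPp := (nm_Pp ip_norm Pp_proj PpDPm).
Local Notation nmPm := (nm_Pm ip_norm Pp_proj PpDPm).

Variable S : H -> H.
Hypothesis Slin : lin S.
Hypothesis Sbd : forall x, nm (S x) <= nm x.
Hypothesis Shalf : forall y, nm (Pp (S (Pm y))) <= 2^-1 * nm (Pm y).
Hypothesis Scomp : forall x l (M : R), (forall n, Pm (x n) = x n) ->
  (\forall n \near U, nm (x n) <= M) -> wlim x l ->
  slim (fun n => Pp (S (x n))) (Pp (S l)).

Let r n : R := 1 - n.+2%:R^-1.

Let r01 n : 0 <= r n /\ r n < 1.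
Proof.
have a : 0 < n.+2%:R^-1 :> R by rewrite invr_gt0 ltr0n.
have b : n.+2%:R^-1 <= 1 :> R by rewrite invf_le1 ?ltr0n // ler1n.
by rewrite /r; move: (n.+2%:R^-1) a b => t a b; split; lra.
Qed.

Lemma strict_invpairs : exists KW : nat -> (H -> H) * (H -> H), forall n,
  invpair Pp Pm (fun x => (r n)%:C *: S x) (KW n).1 (KW n).2 /\
  exists D : R, forall k u, nm (iter k (KW n).2 u) <= D * nm u.
Proof.
suff /choice[f fP] : forall n, exists KW : (H -> H) * (H -> H),
  invpair Pp Pm (fun x => (r n)%:C *: S x) KW.1 KW.2 /\
  exists D : R, forall k u, nm (iter k KW.2 u) <= D * nm u by exists f.
move=> n; have [r0 r1] := r01 n.
have [||K [W KW]] := strict_fixed ip_norm Pp_proj Pm_proj PpDPm r0 r1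
    (T := fun x => (r n)%:C *: S x).
- by move=> c x y; rewrite Slin scalerDr !scalerA mulrC.
- by move=> x; rewrite nmZr ger0_norm //; apply: ler_wpM2l.
by exists (K, W).
Qed.

Section Limit.
Variables KW : nat -> (H -> H) * (H -> H).
Hypothesis KWP : forall n,
  invpair Pp Pm (fun x => (r n)%:C *: S x) (KW n).1 (KW n).2 /\
  exists D : R, forall k u, nm (iter k (KW n).2 u) <= D * nm u.
Local Notation Kn n := (KW n).1.
Local Notation Wn n := (KW n).2.

Let Knlin n : lin (Kn n). Proof. by have [[]] := KWP n. Qed.
Let Wnlin n : lin (Wn n). Proof. by have [[]] := KWP n. Qed.
Let Knbd n u : nm (Kn n u) <= nm u. Proof. by have [[? ? h]] := KWP n. Qed.
Let KnPm n u : Pm (Kn n u) = Kn n u. Proof. by have [[_ _ _ h _] _] := KWP n; case: (h u). Qed.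
Let WnPp n u : Pp (Wn n u) = Wn n u. Proof. by have [[_ _ _ h _] _] := KWP n; case: (h u). Qed.
Let KWE n u : (r n)%:C *: S (Pp u + Kn n (Wn n u)) = Wn n u + Kn n u.
Proof. by have [[]] := KWP n. Qed.

Let WnE n u : Wn n u = (r n)%:C *: (Pp (S (Pp u)) + Pp (S (Kn n (Wn n u)))).
Proof.
rewrite -linearD /= -(linD Slin) -linearZ /= KWE linearD /= WnPp -KnPm.
by rewrite (PpPm Pp_proj PpDPm) addr0.
Qed.

(** The corner bound 1/2 enters here: [WnE] gives [nm (Wn n u) <= nm u + nm (Wn n u) / 2], a bound
    uniform in [n]. *)
Let Wn2 n u : nm (Wn n u) <= 2 * nm u.
Proof.
have [r0 r1] := r01 n.
have h : nm (Wn n u) <= nm (Pp (S (Pp u)) + Pp (S (Kn n (Wn n u)))).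
  by rewrite {1}WnE nmZr ger0_norm // ler_piMl // ltW.
have := nmD (Pp (S (Pp u))) (Pp (S (Kn n (Wn n u)))).
have := Shalf (Kn n (Wn n u)); rewrite KnPm; have := Knbd n (Wn n u).
have := nmPp (S (Pp u)); have := Sbd (Pp u); have := nmPp u; lra.
Qed.

Let slim_r a x : slim a x -> slim (fun n => (r n)%:C *: a n) x.
Proof.
move=> ax; have ab := slim_bounded UU ax.
have h : (fun n => nm (a n - x) + (nm x + 1) * n.+2%:R^-1) @ U --> (0 : R).
  rewrite -[0 : R]addr0; apply: cvgD => //.
  exact: (ucvgM UU _ (ucvg_invS (R := R) UU Uoo)).
apply: (slim_squeeze UU _ h); apply: filterS ab => n an.
have -> : (r n)%:C *: a n - x = (a n - x) - (n.+2%:R^-1)%:C *: a n.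
  by rewrite /r rmorphB rmorph1; vec ip_norm.
apply: le_trans (nmB _ _) _; apply: lerD => //.
rewrite nmZr ger0_norm ?invr_ge0 // mulrC; apply: ler_wpM2r => //.
by rewrite invr_ge0.
Qed.

Let wlim_r a x (M : R) : (\forall n \near U, nm (a n) <= M) ->
  wlim a x -> wlim (fun n => (r n)%:C *: a n) x.
Proof.
move=> aM ax.
have h : slim (fun n => (n.+2%:R^-1)%:C *: a n) 0.
  have h := ucvgM UU M (ucvg_invS (R := R) UU Uoo).
  apply: (slim_squeeze UU _ h); apply: filterS aM => n an.
  rewrite subr0 nmZr ger0_norm ?invr_ge0 // mulrC; apply: ler_wpM2r => //.
  by rewrite invr_ge0.
have := wlimB UU ax (slim_wlim ip_norm UU h); rewrite subr0.
apply: (wlim_near UU); apply: nearW => n.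
by rewrite /r rmorphB rmorph1 scalerBl scale1r.
Qed.

Lemma Kex : exists K : H -> H, forall u, wlim (fun n => Kn n u) (K u).
Proof.
suff /choice[K KP] : forall u, exists l, wlim (fun n => Kn n u) l by exists K.
by move=> u; apply: (wlim_ex ip_norm UU (M := nm u)); apply: nearW => n.
Qed.

Variable K : H -> H.
Hypothesis KP : forall u, wlim (fun n => Kn n u) (K u).
Arguments KP : clear implicits.

Let Klin : lin K.
Proof.
move=> c x y; apply: (wlim_unique ip_norm UU (KP _)).
have := wlimD UU (wlimZ (c := c) (KP x)) (KP y).
by apply: (wlim_near UU); apply: nearW => n; rewrite Knlin.
Qed.

Let Kbd u : nm (K u) <= nm u.
Proof. by apply: (wlim_bnd ip_norm UU (KP u)); apply: nearW => n. Qed.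

Let bdPm : bd Pm 1. Proof. by move=> x; rewrite mul1r; apply: nmPm. Qed.
Let bdPp : bd Pp 1. Proof. by move=> x; rewrite mul1r; apply: nmPp. Qed.
Let bdS : bd S 1. Proof. by move=> x; rewrite mul1r. Qed.

Let wPm a x : (forall n, Pm (a n) = a n) -> wlim a x -> Pm x = x.
Proof.
move=> Pa ax; have h := wlim_map ip_norm (@lin_Pm R H Pm) bdPm ax.
by apply: (wlim_unique ip_norm UU h); apply: (wlim_near UU) ax; apply: nearW => n; rewrite Pa.
Qed.

Let KPm u : Pm (K u) = K u.
Proof. exact: wPm (KP u). Qed.

(** The uniform bound on the [Kn n] allows the argument to move with [n], provided that it converges
    in norm. *)
Let Kseq a x : slim a x -> wlim (fun n => Kn n (a n)) (K x).
Proof.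
move=> ax.
have h : slim (fun n => Kn n (a n - x)) 0.
  by apply: (slim_squeeze UU _ ax); apply: nearW => n; rewrite subr0.
have := wlimD UU (slim_wlim ip_norm UU h) (KP x); rewrite add0r.
by apply: (wlim_near UU); apply: nearW => n; rewrite -(linD (Knlin n)) subrK.
Qed.

Let Wcomp a x (M : R) : (\forall n \near U, nm (a n) <= M) -> wlim (fun n => Kn n (Wn n (a n))) x ->
  slim (fun n => Pp (S (Kn n (Wn n (a n))))) (Pp (S x)).
Proof.
move=> aM; apply: (Scomp (M := 2 * M)); first by move=> n; rewrite KnPm.
apply: filterS aM => n an; have := Knbd n (Wn n (a n)); have := Wn2 n (a n); lra.
Qed.

(** A weak limit [e] of [Kn n (Wn n u)] is taken before it is known to be [K (W u)]. The compact
    corner in [WnE] then makes [Wn n u] converge in norm, after which [Kseq] identifies the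
    limit. *)
Lemma Wex : exists W : H -> H, forall u, slim (fun n => Wn n u) (W u).
Proof.
suff /choice[W WP] : forall u, exists l, slim (fun n => Wn n u) l by exists W.
move=> u; have uM : \forall n \near U, nm u <= nm u by apply: nearW.
have [|e eP] := wlim_ex ip_norm UU (f := fun n => Kn n (Wn n u)) (M := 2 * nm u).
  by apply: nearW => n; apply: le_trans (Knbd _ _) (Wn2 _ _).
have := slim_r (slimD UU (slim_cst UU (Pp (S (Pp u)))) (Wcomp uM eP)).
move=> h; exists (Pp (S (Pp u)) + Pp (S e)).
by apply: (slim_near UU) h; apply: nearW => n; rewrite -WnE.
Qed.

Variable W : H -> H.
Hypothesis WP : forall u, slim (fun n => Wn n u) (W u).
Arguments WP : clear implicits.

Let Wlin : lin W.
Proof.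
move=> c x y; apply: (slim_unique ip_norm UU (WP _)).
have := slimD UU (slimZ UU c (WP x)) (WP y).
by apply: (slim_near UU); apply: nearW => n; rewrite Wnlin.
Qed.

Let W2 u : nm (W u) <= 2 * nm u.
Proof. by apply: (slim_bnd UU (WP u)); apply: nearW => n; apply: Wn2. Qed.

Let WPp u : Pp (W u) = W u.
Proof.
have h := slim_map UU (@lin_Pp R H Pp) bdPp (WP u).
by apply: (slim_unique ip_norm UU h); apply: (slim_near UU) (WP u); apply: nearW => n; rewrite WnPp.
Qed.

Let Wseq a x : slim a x -> slim (fun n => Wn n (a n)) (W x).
Proof.
move=> ax; have h : slim (fun n => Wn n (a n - x)) 0.
  have h := ucvgM UU 2 ax.
  by apply: (slim_squeeze UU _ h); apply: nearW => n; rewrite subr0.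
have := slimD UU h (WP x); rewrite add0r.
by apply: (slim_near UU); apply: nearW => n; rewrite -(linD (Wnlin n)) subrK.
Qed.

Let KWlim u : S (Pp u + K (W u)) = W u + K u.
Proof.
have h := wlimD UU (slim_wlim ip_norm UU (slim_cst UU (Pp u))) (Kseq (WP u)).
have {}h := wlim_map ip_norm Slin bdS h.
have {}h := wlim_r (M := 3 * nm u) _ h.
have {}h : wlim (fun n => Wn n u + Kn n u) (S (Pp u + K (W u))).
  apply: (wlim_near UU) (h _); first by apply: nearW => n; rewrite KWE.
  apply: nearW => n; apply: le_trans (Sbd _) _; apply: le_trans (nmD _ _) _.
  have := nmPp u; have := Knbd n (Wn n u); have := Wn2 n u; lra.
exact: (wlim_unique ip_norm UU h (wlimD UU (slim_wlim ip_norm UU (WP u)) (KP u))).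
Qed.

Let Weq u : W u = Pp (S (Pp u)) + Pp (S (K (W u))).
Proof.
rewrite -linearD /= -(linD Slin) KWlim linearD /= WPp -KPm.
by rewrite (PpPm Pp_proj PpDPm) addr0.
Qed.

Definition noeig rho := forall th u, cmod th = rho -> Pp u = u -> W u = th *: u -> u = 0.

(** Otherwise there are unit vectors [u n] in H_+ and points [th n] of the circle with
    [Wn n (u n) - th n *: u n] tending to 0. A weak limit of the [u n] is in fact a norm limit,
    hence a unit eigenvector of [W] whose eigenvalue has modulus [rho], against [noeig]. *)
Let low_bound rho : 1 < rho -> noeig rho -> exists2 c : R, 0 < c &
  \forall n \near U, forall th u, cmod th = rho -> Pp u = u ->
     c * nm u <= nm (Wn n u - th *: u).
Proof.
move=> rho1 ne; apply: contrapT => ncx.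
pose Q n k (x : R[i] * H) := [/\ cmod x.1 = rho, Pp x.2 = x.2, nm x.2 = 1 &
  nm (Wn n x.2 - x.1 *: x.2) < k.+1%:R^-1].
have [||tu tuP] := diagonal_choice UU Uoo (0 : R[i], 0 : H) (Q := Q).
- move=> n k x [a b c d]; split => //; apply: lt_trans d _.
  by rewrite ltf_pV2 ?posrE ?ltr0n // ltr_nat.
- move=> k; have k0 : 0 < k.+1%:R^-1 :> R by rewrite invr_gt0 ltr0n.
  have [h|] := in_ultra_setVsetC [set n | forall th u, cmod th = rho -> Pp u = u ->
     k.+1%:R^-1 * nm u <= nm (Wn n u - th *: u)] UU.
    by exfalso; apply: ncx; exists k.+1%:R^-1.
  apply: filterS => n /existsNP[th /existsNP[u /not_implyP[tr /not_implyP[Pu]]]].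
  move=> /negP; rewrite -ltNge => h.
  have u0 : nm u != 0.
    by apply/eqP => u0; move: h; rewrite u0 mulr0 ltNge nmge0.
  have pu : 0 < nm u by rewrite lt_def u0 nmge0.
  have nv : nm ((nm u)^-1%:C *: u) = 1.
    by rewrite nmZr ger0_norm ?invr_ge0 // mulVf.
  exists (th, (nm u)^-1%:C *: u); split => //=; first by rewrite linearZ /= Pu.
  rewrite (linZ (Wnlin n)) [th *: _]scalerA mulrC -scalerA -scalerBr nmZr.
  by rewrite ger0_norm ?invr_ge0 // ltr_pdivrMl // mulrC.
pose th n : R[i] := (tu n).1; pose u n : H := (tu n).2.
have thr : \forall n \near U, cmod (th n) = rho.
  by apply: filterS (tuP 0%N) => n [].
have u1 : \forall n \near U, nm (u n) = 1 by apply: filterS (tuP 0%N) => n [].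
have u1' : \forall n \near U, nm (u n) <= 1 by apply: filterS u1 => n ->.
have Pu : \forall n \near U, Pp (u n) = u n by apply: filterS (tuP 0%N) => n [].
have res : slim (fun n => Wn n (u n) - th n *: u n) 0.
  apply/(slimP UU) => e /invS_lt[k /(_ k (leqnn _)) ke].
  by apply: filterS (tuP k) => n [_ _ _]; rewrite subr0 => /lt_trans; apply.
have [|t tP] := ucvg_C UU (th := th) (M := rho).
  by apply: filterS thr => n ->.
have tr : cmod t = rho.
  apply/eqP; rewrite -subr_eq0 -normr_eq0; apply/eqP/le_anti; rewrite normr_ge0 andbT.
  apply: (@le0_all _ _ 1) => e e0; have := tP => /(ucvgP UU)/(_ _ e0) h.
  have [n [h1 h2]] := filter_ex (filterI h thr).
  move: h1; rewrite subr0 ger0_norm // mul1r => h1.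
  move: (h1); have := cmodD (th n - t) t; rewrite subrK h2.
  have -> : cmod (th n - t) = cmod (t - th n) by rewrite -cmodN opprB.
  have := cmodD (t - th n) (th n); rewrite subrK h2.
  by move=> a1 a2 a3; rewrite ler_norml; lra.
have [l lP] := wlim_ex ip_norm UU u1'.
have [|e eP] := wlim_ex ip_norm UU (f := fun n => Kn n (Wn n (u n))) (M := 2 * 1).
  by apply: filterS u1' => n h; have := Knbd n (Wn n (u n)); have := Wn2 n (u n); lra.
have sp := Wcomp u1' eP.
have sth : slim (fun n => (t - th n) *: u n) 0.
  apply: (slim_squeeze UU _ tP); apply: filterS u1 => n h.
  by rewrite subr0 nmZ h mulr1 -cmodN opprB.
(* Solving [WnE] for the part not yet known to converge: the error [res], the change from [th n] to
   [t], the factor [r n] and the compact corner all have norm limits. *)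
have sv : slim (fun n => t *: u n - Pp (S (u n))) (Pp (S e)).
  have s1 : slim (fun n => - (n.+2%:R^-1)%:C *: Pp (S (u n))) 0.
    apply: (slim_squeeze UU _ (ucvg_invS (R := R) UU Uoo)); apply: filterS u1' => n h.
    rewrite subr0 -rmorphN nmZr normrN ger0_norm ?invr_ge0 //.
    rewrite ler_piMr ?invr_ge0 //; have := nmPp (S (u n)); have := Sbd (u n); lra.
  have := slimD UU (slimD UU sth (slimN UU res)) (slimD UU s1 (slim_r sp)).
  rewrite oppr0 !add0r; apply: (slim_near UU); apply: filterS Pu => n Pun.
  rewrite {1}WnE Pun /r rmorphB rmorph1; vec ip_norm.
have lv : Pp (S e) = t *: l - Pp (S l).
  apply: (wlim_unique ip_norm UU (slim_wlim ip_norm UU sv)).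
  apply: (wlimB UU); first exact: wlimZ.
  exact: (wlim_map ip_norm (@lin_Pp R H Pp) bdPp (wlim_map ip_norm Slin bdS lP)).
(* Since [cmod t = rho > 1] and [Pp] after [S] is a contraction, the map [v |-> t *: v - Pp (S v)]
   is bounded below by [rho - 1]; norm convergence of its values gives that of [u]. *)
have su : slim u l.
  have h := ucvgM UU (rho - 1)^-1 sv.
  apply: (slim_squeeze UU _ h); apply: nearW => n.
  rewrite lv ler_pdivlMl; last by lra.
  have -> : t *: u n - Pp (S (u n)) - (t *: l - Pp (S l)) =
      t *: (u n - l) - Pp (S (u n - l)).
    by rewrite (linB Slin) (linB (@lin_Pp R H Pp)); vec ip_norm.
  have := nm_tri (Pp (S (u n - l))) (t *: (u n - l)) 0; rewrite !subr0 nmZ tr.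
  have := nmPp (S (u n - l)); have := Sbd (u n - l); lra.
have l1 : 1 <= nm l by apply: (slim_ge UU su); apply: filterS u1 => n ->.
have Pl : Pp l = l.
  have h := slim_map UU (@lin_Pp R H Pp) bdPp su.
  by apply: (slim_unique ip_norm UU h); apply: (slim_near UU) su; apply: filterS Pu => n ->.
have Wl : W l = t *: l.
  apply: (slim_unique ip_norm UU (Wseq su)).
  have := slimD UU (slimB UU res sth) (slimZ UU t su); rewrite subr0 add0r.
  by apply: (slim_near UU); apply: nearW => n; vec ip_norm.
by have := ne _ _ tr Pl Wl => l0; move: l1; rewrite l0 nm0; lra.
Qed.

(** [power_growth] applies to each [Wn n] with its own power bound [D], but its constant depends
    only on [rho] and [c], so the estimate passes to the limit. *)
Let Wgrow rho : 1 < rho -> noeig rho -> exists C : R, forall k u, Pp u = u ->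
  nm (iter k W u) <= rho ^+ k * (C * nm u).
Proof.
move=> rho1 /(low_bound rho1)[c c0 low].
exists (2 * rho / c) => k u Pu.
have s : slim (fun n => iter k (Wn n) u) (iter k W u).
  elim: k => [|k IH]; first exact: slim_cst.
  exact: Wseq IH.
apply: (slim_bnd UU s); apply: filterS low => n low.
have [_ [D DP]] := KWP n.
apply: (power_growth ip_norm (Wnlin n) rho1 c0 (D := D)) => // th y tr [z ->].
apply: low => //; rewrite linear_sum /=; apply: eq_bigr => -[m _] _ /=.
by rewrite linearZ /=; case: m => [|m] /=; rewrite ?Pu ?WnPp.
Qed.

(** Riesz argument for compact perturbations. If every circle between 1 and [ra] carried an
    eigenvalue, there would be eigenvalues of distinct moduli bounded away from 1 and orthonormal
    [y k] with [W (y k) - th k *: y k] orthogonal to [y k], so [cmod (th k) <= nm (W (y k))]. But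
    [y] is weakly null, so the corner term of [Weq] tends to 0 in norm, while the other term has
    norm at most 1. *)
Lemma noeig_ex ra : 1 < ra -> exists rho, [/\ 1 < rho, rho < ra & noeig rho].
Proof.
move=> ra1; apply: contrapT => nex.
(* Starting at [k.+2] keeps all radii at least [1 + (ra - 1) / 2], the gap that yields the
   contradiction; distinct radii make the eigenvalues distinct. *)
pose rk k : R := ra - (ra - 1) * k.+2%:R^-1.
have rk1 k : 1 + (ra - 1) / 2 <= rk k /\ rk k < ra.
  have a : 0 < k.+2%:R^-1 :> R by rewrite invr_gt0 ltr0n.
  have b : k.+2%:R^-1 <= 2^-1 :> R by rewrite lef_pV2 ?posrE ?ltr0n // ler_nat.
  by rewrite /rk; move: (k.+2%:R^-1) a b => t a b; split; nra.
have /choice[p pP] : forall k, exists p : R[i] * H,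
    [/\ cmod p.1 = rk k, Pp p.2 = p.2, W p.2 = p.1 *: p.2 & p.2 <> 0].
  move=> k; apply: contrapT => h; apply: nex; exists (rk k).
  have [a b] := rk1 k; split => //; first by lra.
  by move=> th u tr Pu Wu; apply: contrapT => u0; apply: h; exists (th, u).
pose th k : R[i] := (p k).1; pose x k : H := (p k).2.
have thr k : cmod (th k) = rk k by have [] := pP k.
have xPp k : Pp (x k) = x k by have [] := pP k.
have xW k : W (x k) = th k *: x k by have [] := pP k.
have x0 k : x k <> 0 by have [] := pP k.
have th_inj i j : i != j -> th i - th j != 0.
  move=> ij; rewrite subr_eq0; apply: contra ij => /eqP tij.
  have := thr i; rewrite tij thr /rk => /addrI/oppr_inj/mulfI.
  have ra0 : ra - 1 != 0 by rewrite subr_eq0 gt_eqF.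
  by move=> /(_ ra0)/invr_inj/eqP; rewrite eqr_nat !eqSS eq_sym.
pose P := fix P k (y : H) : H :=
  if k is k'.+1 then W (P k' y) - th k' *: P k' y else y.
have Plin k : lin (P k).
  elim: k => [|k IH] c a b //=; rewrite IH Wlin; vec ip_norm.
have Pbd k : exists M, 0 <= M /\ bd (P k) M.
  elim: k => [|k [M [M0 IH]]]; first by exists 1; split => // a; rewrite mul1r.
  exists ((2 + cmod (th k)) * M); split=> [|a].
    by rewrite mulr_ge0 // addr_ge0.
  rewrite /= -mulrA; apply: le_trans (nmB _ _) _; rewrite nmZ.
  have := W2 (P k a); have := IH a; have := cmodge0 (th k) => c0 ia.
  have := ler_wpM2l c0 ia; lra.
have PW k y : P k (W y) = W (P k y).
  by elim: k => [//|k IH] /=; rewrite IH (linB Wlin) (linZ Wlin).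
(* [E k] stands in for the span of the first [k] eigenvectors: it contains them, and as a kernel of
   a bounded map inside H_+ it is closed. *)
pose E k := [set y | Pp y = y /\ P k y = 0].
have ES k y : E k y -> E k.+1 y.
  by move=> [Py y0]; split => //=; rewrite y0 (lin0 Wlin) scaler0 subr0.
have Ele j k y : (j <= k)%N -> E j y -> E k y.
  by move=> /subnK <-; elim: (k - j)%N => [//|m IH]; rewrite addSn => /IH/ES.
have Elin k c a b : E k a -> E k b -> E k (c *: a + b).
  move=> [Pa a0] [Pb b0]; split; first by rewrite linearP /= Pa Pb.
  by rewrite Plin a0 b0 scaler0 addr0.
have E0 k : E k 0 by split; rewrite ?linear0 // (lin0 (Plin k)).
have EZ k c a : E k a -> E k (c *: a).
  by move=> Ea; have := Elin k c a 0 Ea (E0 k); rewrite addr0.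
have Ex i k : P i (x k) = (\prod_(j < i) (th k - th j)) *: x k.
  elim: i => [|i IH]; first by rewrite big_ord0 scale1r.
  rewrite /= IH big_ord_recr /= (linZ Wlin) xW; vec ip_norm.
have Exk k : E k.+1 (x k).
  by split => //; rewrite Ex big_ord_recr /= subrr mulr0 scale0r.
have nEx k : ~ E k (x k).
  move=> [_]; rewrite Ex => /eqP; rewrite scaler_eq0 => /orP[|/eqP]; last exact: x0.
  apply/negP; apply/prodf_neq0 => j _; apply: th_inj.
  by rewrite neq_ltn ltn_ord orbT.
have /choice[y yP] : forall k, exists y, [/\ E k.+1 y, nm y = 1 & forall e, E k e -> g y e = 0].
  move=> k; have [||q Eq qP] := @proj_ex _ _ _ ip_norm (E k) (x k).
  - by split; [exact: E0 | move=> s a b; apply: Elin].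
  - move=> a h; have [M [M0 MP]] := Pbd k; split.
      apply/eqP; rewrite -subr_eq0 -nm_eq0; apply/eqP/le_anti; rewrite nmge0 andbT.
      apply: (@le0_all _ _ 2) => e /h[b [Pb _] ab].
      have -> : Pp a - a = Pp (a - b) - (a - b) by rewrite linearB /= Pb; vec ip_norm.
      by apply: le_trans (nmB _ _) _; have := nmPp (a - b); lra.
    apply/eqP; rewrite -nm_eq0; apply/eqP/le_anti; rewrite nmge0 andbT.
    apply: (@le0_all _ _ M) => e /h[b [_ Pb] ab].
    rewrite -[P k a]subr0 -Pb -(linB (Plin k)); apply: le_trans (MP _) _.
    by apply: ler_wpM2l => //; apply: ltW.
  have z0 : nm (x k - q) != 0.
    rewrite nm_eq0 subr_eq0; apply/negP => /eqP xq; apply: (@nEx k).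
    by rewrite xq.
  exists ((nm (x k - q))^-1%:C *: (x k - q)); split.
  - by apply: EZ; rewrite addrC -scaleN1r; apply: Elin => //; apply: ES.
  - by rewrite nmZr ger0_norm ?invr_ge0 // mulVf.
  - by move=> e /qP; rewrite ripZl => ->; rewrite mulr0.
have yW k : E k (W (y k) - th k *: y k).
  have [[Py Pky] _ _] := yP k; split.
    by rewrite linearB /= WPp linearZ /= Py.
  by rewrite (linB (Plin k)) (linZ (Plin k)) PW.
have yort l k : (l < k)%N -> g (y k) (y l) = 0.
  have [_ _ h] := yP k; have [El _ _] := yP l => lk.
  by apply: h; apply: Ele El.
have y1 k : nm (y k) = 1 by have [] := yP k.
(* The weak limit of an orthonormal sequence is orthogonal to each [y j], hence to itself. *)
have [|l lP] := wlim_ex ip_norm UU (f := y) (M := 1).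
  by apply: nearW => n; rewrite y1.
have ly j : g l (y j) = 0.
  apply: (ucvg_uniq UU (lP (y j))); apply/(ucvgP UU) => e e0.
  by have := Uoo j.+1; apply: filterS => n /= /yort ->; rewrite subrr normr0.
have l0 : l = 0.
  apply/nm0_eq0/eqP; rewrite -sqrf_eq0 -(rip_nm ip_norm); apply/eqP.
  apply: (ucvg_uniq UU (lP l)); apply/(ucvgP UU) => e e0.
  by apply: nearW => n /=; rewrite ripC ly subrr normr0.
have bK : bd K 1 by move=> u; rewrite mul1r.
have := wlim_map ip_norm Klin bK (wlim_map ip_norm Wlin W2 lP).
rewrite l0 (lin0 Wlin) (lin0 Klin) => h.
have := Scomp (M := 2) (fun n => KPm _) _ h; rewrite (lin0 Slin) linear0.
have nK : \forall n \near U, nm (K (W (y n))) <= 2.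
  by apply: nearW => n; have := Kbd (W (y n)); have := W2 (y n); rewrite y1; lra.
have e0 : 0 < (ra - 1) / 2 by rewrite divr_gt0 //; lra.
move=> /(_ nK)/(slimP UU)/(_ _ e0)/filter_ex[n]; rewrite subr0 => hn.
have [[Py _] _ yo] := yP n.
have up : nm (W (y n)) <= 1 + nm (Pp (S (K (W (y n))))).
  rewrite {1}Weq Py; apply: le_trans (nmD _ _) _; apply: lerD => //.
  by apply: le_trans (nmPp _) _; rewrite -(y1 n).
have lo : cmod (th n) <= nm (W (y n)).
  apply: sqr_leP => //.
  have -> : W (y n) = th n *: y n + (W (y n) - th n *: y n) by rewrite addrC subrK.
  have : g (th n *: y n) (W (y n) - th n *: y n) = 0.
    by rewrite ripZc; apply: yo; apply: EZ.
  set e := W (y n) - _ => o.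
  by rewrite (nmD_sqr ip_norm) o mulr0 addr0 nmZ y1 mulr1; have := sqr_ge0 (nm e); lra.
by move: up lo hn; rewrite thr; have [] := rk1 n; lra.
Qed.

(** The last clause encodes that [W] has spectral radius at most 1 on H_+: for a circle radius [rho]
    below the inverse of [cmod k], [Wgrow] bounds the norm by a multiple of [(cmod k * rho) ^+ N],
    which is eventually small. *)
Lemma limit_pair : [/\ invpair Pp Pm S K W, (forall u, nm (W u) <= 2 * nm u) &
  forall k : R[i], cmod k < 1 -> exists N, forall u, Pp u = u ->
    nm (k ^+ N *: iter N W u) <= 2^-1 * nm u].
Proof.
split => // k k1.
have [k0|k0] := eqVneq k 0.
  by exists 1%N => u _; rewrite k0 expr1 scale0r nm0 mulr_ge0 // invr_ge0.
have ck : 0 < cmod k by rewrite lt_def cmod_eq0 k0 cmodge0.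
have [rho [rho1 rhok /(Wgrow rho1)[C CP]]] : exists rho, [/\ 1 < rho, rho < (cmod k)^-1 & noeig rho].
  by apply: noeig_ex; rewrite invf_gt1.
have q0 : 0 <= cmod k * rho by rewrite mulr_ge0 //; lra.
have q1 : cmod k * rho < 1 by rewrite mulrC -ltr_pdivlMr // mul1r.
have d0 : 0 < (2 * (`|C| + 1))^-1 by rewrite invr_gt0; have := normr_ge0 C; lra.
have [N /(_ _ (leqnn _)) NP] := expr_lt q0 q1 d0.
exists N => u Pu; rewrite nmZ cmodX.
have kN : 0 <= cmod k ^+ N by rewrite exprn_ge0.
apply: le_trans (ler_wpM2l kN (CP N u Pu)) _; rewrite mulrA -exprMn.
have C0 := normr_ge0 C.
have : (cmod k * rho) ^+ N * (2 * (`|C| + 1)) < 1.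
  by rewrite -ltr_pdivlMr ?mul1r //; lra.
move: NP; have := exprn_ge0 N q0; move: (_ ^+ N) => t t0 _ tC.
have : t * C <= 2^-1.
  by have := ler_wpM2l t0 (ler_norm C); lra.
by move=> /(ler_wpM2r (nmge0 u)); rewrite -mulrA.
Qed.

End Limit.

Theorem invpair_ex : exists K W, [/\ invpair Pp Pm S K W,
  (forall u, nm (W u) <= 2 * nm u) &
  forall k : R[i], cmod k < 1 -> exists N, forall u, Pp u = u ->
    nm (k ^+ N *: iter N W u) <= 2^-1 * nm u].
Proof.
have [KW KWP] := strict_invpairs; have [K KP] := Kex KWP; have [W WP] := Wex KWP.
by exists K, W; apply: (limit_pair KWP KP WP).
Qed.

End InvariantPair.

(** * Maximal dissipative operators *)

Section Dissipative.
Variables (R : realType) (H : completeNormedModType R[i]).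
Variable ip : {dot H for conjC}.
Hypothesis ip_norm : forall x : H, `|x| ^+ 2 = ip x x.
Local Notation g := (rip ip).
Let nmge0 (x : H) : 0 <= nm x := nm_ge0 x.
Let cmodge0 (c : R[i]) : 0 <= cmod c := cmod_ge0 c.
Hint Resolve nmge0 cmodge0 : core.
Variable U : set_system nat.
Hypothesis UU : UltraFilter U.
Hypothesis Uoo : forall N, U [set n | (N <= n)%N].

Lemma submodE (D : set H) : GRing.submod_closed [in D] <->
  D 0 /\ forall (c : R[i]) x y, D x -> D y -> D (c *: x + y).
Proof.
split=> [[D0 DP]|[D0 DP]].
  split; first by have := D0; rewrite inE.
  by move=> c x y Dx Dy; have := DP c x y; rewrite !inE; apply.
by split; rewrite ?inE // => c x y; rewrite !inE; apply: DP.
Qed.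

Lemma ripi x y : g ('i%C *: x) ('i%C *: y) = g x y.
Proof.
rewrite ripZc scalerA; congr (g x _); rewrite -[RHS]scale1r; congr (_ *: _).
by apply/eqP; rewrite eq_complex /=; apply/andP; split; apply/eqP; ring.
Qed.

Lemma ripiN x y : g ('i%C *: x) y = - g x ('i%C *: y).
Proof.
rewrite ripZc -ripNr -scaleNr; congr (g x (_ *: _)).
by apply/eqP; rewrite eq_complex /= oppr0 !eqxx.
Qed.

Lemma ripii x : g x ('i%C *: x) = 0.
Proof. by have := ripiN x x; rewrite ripC; lra. Qed.

Lemma rip_cmod c x y : g (c *: x) (c *: y) = cmod c ^+ 2 * g x y.
Proof.
rewrite ripZc scalerA -ripZr cmod_sqr; congr (g x (_ *: y)).
by apply/eqP; rewrite eq_complex; case: c => a b /=; apply/andP; split; apply/eqP; ring.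
Qed.

Lemma ripcvg a b x y : slim U a x -> slim U b y ->
  (fun n => g (a n) (b n)) @ U --> g x y.
Proof.
move=> ax bY.
have h : (fun n => g (a n - x) (b n)) @ U --> (0 : R).
  have h := ucvgM UU (nm y + 1) ax.
  apply: (ucvg0_squeeze UU _ h); have := slim_bounded UU bY.
  apply: filterS => n bn; apply: le_trans (ler_rip ip_norm _ _) _.
  by rewrite mulrC; apply: ler_wpM2r.
have bY' := slim_wlim ip_norm UU bY.
have -> : (fun n => g (a n) (b n)) = (fun n => g (a n - x) (b n) + g (b n) x).
  by apply/funext => n; rewrite ripBl (ripC _ (b n) x) subrK.
by rewrite -[g x y]add0r ripC; apply: cvgD h (bY' x).
Qed.

Lemma ucvg_ge (f : nat -> R) (a M : R) : f @ U --> a -> (\forall n \near U, M <= f n) -> M <= a.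
Proof.
move=> fa fM; rewrite -lerN2; apply: (@ucvg_le _ U UU (fun n => - f n)).
  exact: cvgN.
by apply: filterS fM => n; rewrite lerN2.
Qed.

Section MaximalDissipative.
Variables (L : set H) (T : partial_op H).
Hypothesis T_mdiss : m_dissipative_in ip L T.
Hypothesis L_sub : forall (c : R[i]) x y, L x -> L y -> L (c *: x + y).

Let Top : operator_in L T. Proof. by case: T_mdiss => -[]. Qed.
Let T0 : dom T 0. Proof. by case: Top => /submodE[]. Qed.
Let TP c x y : dom T x -> dom T y -> dom T (c *: x + y).
Proof. by case: Top => /submodE[_ h] _ _ _; apply: h. Qed.
Let TL x : dom T x -> L x. Proof. by case: Top => _ h _ _; apply: h. Qed.
Let Tlin c x y : dom T x -> dom T y -> T (c *: x + y) = c *: T x + T y.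
Proof. by case: Top => _ _ h _; apply: h. Qed.
Let TR x : dom T x -> L (T x). Proof. by case: Top => _ _ _; apply. Qed.
Let L0 : L 0. Proof. exact: TL. Qed.
Let Tim x : dom T x -> 0 <= g (T x) ('i%C *: x).
Proof. by case: T_mdiss => -[_ _ h] _ /h; rewrite (Im_ip ip). Qed.
Let TZ c x : dom T x -> dom T (c *: x).
Proof. by move=> Dx; have := TP c Dx T0; rewrite addr0. Qed.
Let T00 : T 0 = 0.
Proof. by have := Tlin (-1) T0 T0; rewrite !scaleN1r oppr0 addr0 addNr. Qed.
(** Maximality in usable form: a pair that can be adjoined to the graph dissipatively already
    belongs to it. If [x] were outside [dom T], sending it to [y] would define a proper extension;
    if it is inside, [y - T x] is orthogonal to the dense domain. *)
Lemma m_diss_ext x y : L x -> L y ->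
  (forall z (c : R[i]), dom T z -> 0 <= g (T z + c *: y) ('i%C *: (z + c *: x))) ->
  dom T x /\ T x = y.
Proof.
move=> Lx Ly h.
have Dx : dom T x.
  apply: contrapT => nDx.
  pose D := [set v | exists z (c : R[i]), dom T z /\ v = z + c *: x].
  pose S := PartialOp D (fun v => xget 0 [set w | exists z (c : R[i]),
     [/\ dom T z, v = z + c *: x & w = T z + c *: y]]).
  have uniq z c z' c' : dom T z -> dom T z' -> z + c *: x = z' + c' *: x ->
      z = z' /\ c = c'.
    move=> Dz Dz' e.
    have e1 : (c - c') *: x = (-1) *: z + z'.
      apply/eqP; rewrite -subr_eq0; apply/eqP; rewrite -(subrr (z' + c' *: x)) -{1}e.
      by vec ip_norm.
    have [cc|cc] := eqVneq c c'; first by move: e; rewrite cc => /addIr.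
    exfalso; apply: nDx; rewrite -[x](scalerK (a := c - c')) ?subr_eq0 //.
    by apply: TZ; rewrite e1; apply: TP.
  have SE z c : dom T z -> S (z + c *: x) = T z + c *: y.
    move=> Dz; rewrite /S /=.
    set Q := (X in xget 0 X).
    have ne : Q !=set0 by exists (T z + c *: y), z, c.
    have [z' [c' [Dz' e ->]]] := xgetPex 0 ne.
    by have [-> ->] := uniq _ _ _ _ Dz Dz' e.
  have [Tdiss Tmax] := T_mdiss; have [_ Tdense _] := Tdiss.
  apply: nDx; apply: (Tmax S); last by exists 0, 1; rewrite scale1r add0r.
    split.
    - split.
      + apply/submodE; split; first by exists 0, 0; rewrite scale0r addr0.
        move=> c _ _ [z [a [Dz ->]]] [z' [a' [Dz' ->]]].
        by exists (c *: z + z'), (c * a + a'); split; [exact: TP | vec ip_norm].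
      + by move=> _ [z [c [Dz ->]]]; rewrite addrC; apply: L_sub => //; apply: TL.
      + move=> c _ _ [z [a [Dz ->]]] [z' [a' [Dz' ->]]].
        have -> : c *: (z + a *: x) + (z' + a' *: x) = (c *: z + z') + (c * a + a') *: x.
          by vec ip_norm.
        by rewrite !SE ?Tlin //; [vec ip_norm | exact: TP].
      + move=> _ [z [c [Dz ->]]]; rewrite SE // addrC; apply: L_sub => //; exact: TR.
    - move=> u /Tdense; apply: closure_subset => z Dz; exists z, 0.
      by rewrite scale0r addr0.
    - by move=> _ [z [c [Dz ->]]]; rewrite (Im_ip ip) SE //; apply: h.
  split=> [z Dz|z Dz]; first by exists z, 0; rewrite scale0r addr0.
  by have := SE z 0 Dz; rewrite !scale0r !addr0.
split => //.
pose d := y - T x.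
have Ld : L d.
  by rewrite /d addrC -scaleN1r; apply: L_sub => //; apply: TR.
have dz z : dom T z -> g d z = 0.
  move=> Dz; apply: (@quad_eq0 _ _ 0) => t.
  (* The multiples of [x] are chosen to cancel in the argument, leaving only [d] in the value; an
     affine function of [r] that is nonnegative for all real [r] has zero slope. *)
  have k r : 0 <= g (T z) ('i%C *: z) + r * g d z.
    have := h (- (r%:C * 'i%C) *: x + z) (r%:C * 'i%C) (TP _ Dx Dz).
    rewrite Tlin //.
    have -> : - (r%:C * 'i%C) *: T x + T z + (r%:C * 'i%C) *: y =
      T z + r%:C *: ('i%C *: d) by rewrite /d; vec ip_norm.
    have -> : - (r%:C * 'i%C) *: x + z + (r%:C * 'i%C) *: x = z by vec ip_norm.
    by rewrite ripDl ripZl ripi.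
  suff -> : g d z = 0 by lra.
  apply/eqP; rewrite -sqrf_eq0; apply/eqP/le_anti; rewrite sqr_ge0 andbT leNgt.
  apply/negP => d0; have := k (- (g (T z) ('i%C *: z) + 1) / g d z).
  rewrite divfK; first by lra.
  by apply/eqP => e; move: d0; rewrite e expr0n ltxx.
apply/eqP; rewrite eq_sym -subr_eq0 -/d -nm_eq0; apply/eqP/le_anti; rewrite nmge0 andbT.
have [[_ Tdense _] _] := T_mdiss.
apply: (@le0_all _ _ 1) => e e0; have [z Dz dze] := (closure_nmP _ _).1 (Tdense _ Ld) e e0.
have [->|d0] := eqVneq (nm d) 0; first by lra.
have d1 : 0 < nm d by rewrite lt_def d0 nmge0.
rewrite mul1r -(ler_pM2l d1) -expr2 -(rip_nm ip_norm).
have -> : g d d = g d (d - z) by rewrite (ripBr _ d d z) (dz z Dz) subr0.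
by apply: le_trans (rip_le ip_norm _ _) _; apply: ler_wpM2l => //; apply: ltW.
Qed.

Variable b : R.
Hypothesis b0 : 0 < b.
Hypothesis L_closed : nclosed L.

Let B x := T x + (b%:C * 'i%C) *: x.

Let Blow x : dom T x -> b * nm x <= nm (B x).
Proof.
move=> Dx; have [->|x0] := eqVneq (nm x) 0; first by rewrite mulr0.
have x1 : 0 < nm x by rewrite lt_def x0 nmge0.
rewrite -(ler_pM2r x1) -mulrA -expr2 -(rip_nm ip_norm).
have -> : nm x = nm ('i%C *: x).
  apply/eqP; rewrite -(@eqrXn2 _ 2) // -!(rip_nm ip_norm) ripi //.
apply: le_trans (rip_le ip_norm _ _).
by rewrite /B ripDl -scalerA ripZl ripi; have := Tim Dx; lra.
Qed.

Let Blin c x y : dom T x -> dom T y -> B (c *: x + y) = c *: B x + B y.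
Proof. by move=> Dx Dy; rewrite /B Tlin //; vec ip_norm. Qed.

(** The range is closed by the lower bound [Blow], and a vector orthogonal to it can be adjoined to
    the graph of [T], which forces it to vanish. *)
Lemma m_diss_surj f : L f -> exists2 x, dom T x & T x + (b%:C * 'i%C) *: x = f.
Proof.
move=> Lf.
pose Rg := [set f | exists2 x, dom T x & B x = f].
have LB x : dom T x -> L (B x).
  move=> Dx; rewrite /B addrC; apply: L_sub; first exact: TL.
  exact: TR.
have RgP (c : R[i]) u v : Rg u -> Rg v -> Rg (c *: u + v).
  move=> [x Dx <-] [y Dy <-]; exists (c *: x + y); first exact: TP.
  exact: Blin.
have B0 : B 0 = 0 by rewrite /B T00 scaler0 addr0.
have Rg0 : Rg 0 by exists 0.
have Rgc : nclosed Rg.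
  move=> u hu.
  have /choice[x xP] : forall n, exists x, dom T x /\ nm (u - B x) < n.+1%:R^-1.
    move=> n; have n0 : 0 < n.+1%:R^-1 :> R by rewrite invr_gt0 ltr0n.
    by have [_ [x Dx <-] ux] := hu _ n0; exists x.
  have dist m n : b * nm (x m - x n) <= nm (u - B (x m)) + nm (u - B (x n)).
    have Dmn : dom T (x m - x n).
      by rewrite addrC -scaleN1r; apply: TP; [case: (xP n) | case: (xP m)].
    apply: le_trans (Blow Dmn) _.
    have -> : B (x m - x n) = (u - B (x n)) - (u - B (x m)).
      rewrite addrC -scaleN1r Blin; [vec ip_norm | by case: (xP n) | by case: (xP m)].
    by rewrite [X in _ <= X]addrC; apply: nmB.
  have [|l lP] := @nm_cauchy _ _ x.
    move=> e e0; have d0 : 0 < b * e / 2 by rewrite divr_gt0 // mulr_gt0.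
    have [N NP] := invS_lt d0; exists N => m n Nm Nn.
    rewrite -(ltr_pM2l b0); apply: le_lt_trans (dist m n) _.
    have := lt_trans (xP m).2 (NP _ Nm); have := lt_trans (xP n).2 (NP _ Nn); lra.
  have xl : slim U x l.
    apply/(slimP UU) => e /lP[N NP]; have := Uoo N.
    by apply: filterS => n /= /NP.
  have Bu : slim U (fun n => B (x n)) u.
    apply/(slimP UU) => e /invS_lt[N NP]; have := Uoo N.
    by apply: filterS => n /= /NP; rewrite nm_distC; apply: lt_trans (xP n).2.
  pose y := u - (b%:C * 'i%C) *: l.
  have Ty : slim U (fun n => T (x n)) y.
    have := slimB UU Bu (slimZ UU (b%:C * 'i%C) xl).
    by apply: (slim_near UU); apply: nearW => n; rewrite /B; vec ip_norm.
  have Lu : L u by apply: L_closed => e /hu[_ [z Dz <-] uz]; exists (B z) => //; apply: LB.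
  have Ll : L l.
    apply: L_closed => e /lP[N /(_ _ (leqnn _)) h]; exists (x N); last by rewrite nm_distC.
    by apply: TL; case: (xP N).
  have Ly : L y.
    have -> : y = - (b%:C * 'i%C) *: l + u by rewrite /y; vec ip_norm.
    exact: L_sub.
  (* Closedness of [T] is obtained from maximality: the form on the enlarged graph is a limit of its
     values on the graph of [T]. *)
  have [Dl Tl] : dom T l /\ T l = y.
    apply: m_diss_ext => // z c Dz.
    apply: (ucvg_ge (ripcvg (slimD UU (slim_cst UU (T z)) (slimZ UU c Ty))
      (slimZ UU 'i%C (slimD UU (slim_cst UU z) (slimZ UU c xl))))).
    apply: nearW => n; rewrite addrC [z + _]addrC -Tlin //; last by case: (xP n).
    by apply: Tim; apply: TP => //; case: (xP n).
  by exists l => //; rewrite /B Tl /y; vec ip_norm.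
have [||p [x Dx Bx] pP] := @proj_ex _ _ _ ip_norm Rg f.
- by split => // r u v; apply: RgP.
- exact: Rgc.
pose y := f - p.
have Ly : L y by rewrite /y addrC -scaleN1r; apply: L_sub => //; rewrite -Bx; apply: LB.
have oy z (c : R[i]) : dom T z -> g (B z) (c *: y) = 0.
  move=> Dz; rewrite ripC ripZc -/y; apply: pP; exists (c^*%C *: z); first exact: TZ.
  by have := Blin (c^*%C) Dz T0; rewrite B0 !addr0.
(* Orthogonality to the range says that the adjoint sends [y] to [k]. Adjoining the pair [(y, k)]
   makes the cross terms [e1] and [e2] cancel and adds only the nonnegative term [e3]. *)
pose k := (b%:C * 'i%C) *: y.
have Lk : L k by have := L_sub (b%:C * 'i%C) Ly L0; rewrite addr0.
have [Dy Ty] : dom T y /\ T y = k.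
  apply: m_diss_ext => // z c Dz.
  have e1 : g (T z) ('i%C *: (c *: y)) = - b * g z (c *: y).
    have := oy z ('i%C * c) Dz; rewrite /B !ripDl -[(b%:C * _) *: z]scalerA ripZl.
    by rewrite -[('i%C * c) *: y]scalerA ripi; lra.
  have e2 : g (c *: k) ('i%C *: z) = b * g z (c *: y).
    have -> : c *: k = b%:C *: ('i%C *: (c *: y)) by rewrite /k; vec ip_norm.
    by rewrite ripZl ripi [g z (c *: y)]ripC.
  have e3 : g (c *: k) ('i%C *: (c *: y)) = cmod c ^+ 2 * (b * nm y ^+ 2).
    have -> : 'i%C *: (c *: y) = c *: ('i%C *: y) by vec ip_norm.
    by rewrite rip_cmod /k -scalerA ripZl ripi (rip_nm ip_norm).
  rewrite [_ *: (z + _)]scalerDr (ripDl _ (T z) (c *: k)) !ripDr e1 e2 e3.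
  have : 0 <= cmod c ^+ 2 * (b * nm y ^+ 2).
    by rewrite mulr_ge0 ?sqr_ge0 // mulr_ge0 ?sqr_ge0 // ltW.
  by have := Tim Dz; lra.
have y0 : y = 0.
  have := oy y ('i%C) Dy; rewrite /B Ty /k.
  have -> : (b%:C * 'i%C) *: y + (b%:C * 'i%C) *: y = (2 * b)%:C *: ('i%C *: y).
    by rewrite rmorphM rmorph_nat; vec ip_norm.
  rewrite ripZl ripi (rip_nm ip_norm) => /eqP; rewrite mulf_eq0 sqrf_eq0 nm_eq0.
  by case/orP => [|/eqP //]; have := b0; rewrite mulf_eq0 pnatr_eq0 /= => /gt_eqF ->.
by exists x => //; rewrite -[LHS]/(B x) Bx; apply/esym/eqP; rewrite -subr_eq0 -/y y0.
Qed.

End MaximalDissipative.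
End Dissipative.

(** * Maximal nonnegative subspaces *)

Section GraphSubspaces.
Variables (R : realType) (H : completeNormedModType R[i]).
Variable ip : {dot H for conjC}.
Hypothesis ip_norm : forall x : H, `|x| ^+ 2 = ip x x.
Variables Pp Pm : {linear H -> H}.
Hypothesis Pp_proj : orthogonal_projection ip Pp.
Hypothesis Pm_proj : orthogonal_projection ip Pm.
Hypothesis PpDPm : forall x, Pp x + Pm x = x.
Local Notation g := (rip ip).
Let nmge0 (x : H) : 0 <= nm x := nm_ge0 x.
Let cmodge0 (c : R[i]) : 0 <= cmod c := cmod_ge0 c.
Hint Resolve nmge0 cmodge0 : core.
Local Notation Ppi := (Pp_idem Pp_proj).
Local Notation PpPm0 := (PpPm Pp_proj PpDPm).
Local Notation PmPp0 := (PmPp Pm_proj PpDPm).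
Local Notation nmPp := (nm_Pp ip_norm Pp_proj PpDPm).
Local Notation nmPm := (nm_Pm ip_norm Pp_proj PpDPm).
Local Notation J := (fun x => Pp x - Pm x).

Lemma Pm_of_Pp x : Pp x = x -> Pm x = 0.
Proof. by move=> <-; apply: PmPp0. Qed.

Lemma Pp_of_Pm x : Pm x = x -> Pp x = 0.
Proof. by move=> <-; apply: PpPm0. Qed.

Lemma rip_PpPm x y : g (Pp x) (Pm y) = 0.
Proof. by rewrite (rip_Pp Pp_proj) PpPm0 rip0r. Qed.

Lemma rip_PmPp x y : g (Pm x) (Pp y) = 0.
Proof. by rewrite (rip_Pm Pm_proj) PmPp0 rip0r. Qed.

Lemma decomp_eq x y : Pp x = Pp y -> Pm x = Pm y -> x = y.
Proof. by move=> e1 e2; rewrite -(PpDPm x) -(PpDPm y) e1 e2. Qed.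

Lemma ipJ x : ip (J x) x = (nm (Pp x) ^+ 2 - nm (Pm x) ^+ 2)%:C.
Proof.
have e (P : {linear H -> H}) : orthogonal_projection ip P -> ip (P x) x = (nm (P x) ^+ 2)%:C.
  by move=> [Pi Ps]; rewrite -{1}Pi Ps -ip_norm nmE rmorphXn.
by rewrite ipDl ipNl !e // rmorphB.
Qed.

(** For maximality, subtract from a vector of a larger nonnegative subspace the graph point with the
    same H_+ part: the difference lies in H_-, where the form is minus the squared norm. *)
Lemma graph_max_nonneg (K : H -> H) : lin K -> (forall u, nm (K u) <= nm u) ->
  (forall u, Pm (K u) = K u) ->
  max_nonnegative_subspace ip J [set v | Pm v = K (Pp v)].
Proof.
move=> Kl Kb KPm; split.
  split.
  - apply/submodE; split => /=; first by rewrite !linear0 (lin0 Kl).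
    by move=> c x y hx hy; rewrite !linearP /= hx hy Kl.
  - apply/closed_nmP => v h /=; apply/eqP; rewrite -subr_eq0 -nm_eq0.
    apply/eqP/le_anti; rewrite nmge0 andbT.
    apply: (@le0_all _ _ 2) => e /h[y yE vy].
    have -> : Pm v - K (Pp v) = Pm (v - y) - K (Pp (v - y)).
      by rewrite !linearB /= (linB Kl) yE; vec ip_norm.
    apply: le_trans (nmB _ _) _.
    by have := nmPm (v - y); have := Kb (Pp (v - y)); have := nmPp (v - y); lra.
  - by move=> x /= xE; rewrite ipJ ler0c subr_ge0 xE sqr_le.
move=> L' [/submodE[L0 LP] _ Lnn] sub; apply/seteqP; split=> // x Lx /=.
pose d := (-1) *: (Pp x + K (Pp x)) + x.
have Ld : L' d.
  apply: LP => //; apply: sub; rewrite /= !linearD /= Ppi PmPp0 KPm add0r.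
  by rewrite (Pp_of_Pm (KPm _)) addr0.
have := Lnn _ Ld; rewrite ipJ ler0c.
have -> : Pp d = 0.
  by rewrite /d linearP linearD /= Ppi (Pp_of_Pm (KPm _)) addr0 scaleN1r addNr.
have -> : Pm d = Pm x - K (Pp x).
  by rewrite /d linearP linearD /= PmPp0 KPm add0r scaleN1r addrC.
rewrite nm0 expr0n sub0r oppr_ge0 => h.
apply/eqP; rewrite -subr_eq0 -nm_eq0 -sqrf_eq0; apply/eqP/le_anti.
by rewrite h sqr_ge0.
Qed.

(** On [L] the norm is controlled by the H_+ part, so [Pp] has closed image there. A nonzero [e] in
    H_+ orthogonal to that image would make [L] plus the multiples of [e] closed and nonnegative, so
    [e] would lie in [L] and be orthogonal to itself. *)
Lemma max_nonneg_onto (L : set H) : max_nonnegative_subspace ip J L ->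
  (forall v, L v -> nm (Pm v) <= nm (Pp v)) /\
  (forall u, Pp u = u -> exists2 v, L v & Pp v = u).
Proof.
move=> [[/submodE[L0 LP] /closed_nmP Lc Lnn] Lmax].
have Lle v : L v -> nm (Pm v) <= nm (Pp v).
  move=> /Lnn; rewrite ipJ ler0c subr_ge0 => h.
  exact: (sqr_leP _ h).
split=> // u Pu.
pose E := [set a | exists2 v, L v & Pp v = a].
have [||p [v Lv Pv] pP] := @proj_ex _ _ _ ip_norm E u.
- split; first by exists 0; rewrite ?linear0.
  move=> r _ _ [v Lv <-] [w Lw <-]; exists (r%:C *: v + w); first exact: LP.
  by rewrite linearP.
- move=> a ha.
  have /choice[v vP] : forall n, exists v, L v /\ nm (a - Pp v) < n.+1%:R^-1.
    move=> n; have n0 : 0 < n.+1%:R^-1 :> R by rewrite invr_gt0 ltr0n.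
    by have [_ [v Lv <-] av] := ha _ n0; exists v.
  have [|l lP] := @nm_cauchy _ _ v.
    move=> e e0; have d0 : 0 < e / 4 by rewrite divr_gt0.
    have [N NP] := invS_lt d0; exists N => m n Nm Nn.
    have Lmn : L (v m - v n).
      by rewrite addrC -scaleN1r; apply: LP; [case: (vP n) | case: (vP m)].
    have h1 := lt_trans (vP m).2 (NP _ Nm); have h2 := lt_trans (vP n).2 (NP _ Nn).
    have h3 : nm (Pp (v m - v n)) <= nm (a - Pp (v m)) + nm (a - Pp (v n)).
      by rewrite linearB /=; apply: le_trans (nm_tri a _ _) _; rewrite (nm_distC (Pp _) a).
    have := Lle _ Lmn; have := nmD (Pp (v m - v n)) (Pm (v m - v n)); rewrite PpDPm.
    lra.
  exists l.
    apply: Lc => e /lP[N /(_ _ (leqnn _)) h]; exists (v N); last by rewrite nm_distC.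
    by case: (vP N).
  apply/eqP; rewrite -subr_eq0 -nm_eq0; apply/eqP/le_anti; rewrite nmge0 andbT.
  apply: (@le0_all _ _ 2) => e e0; have [N NP] := lP e e0; have [N' NP'] := invS_lt e0.
  pose k := maxn N N'.
  have h1 := NP k (leq_maxl _ _).
  have h2 := lt_trans (vP k).2 (NP' k (leq_maxr _ _)).
  have := nm_tri (Pp (v k)) (Pp l) a; rewrite -linearB /=.
  by have := nmPp (l - v k); rewrite (nm_distC l) (nm_distC (Pp (v k)) a); lra.
pose e := u - p.
have Pe : Pp e = e by rewrite /e linearB /= Pu -Pv Ppi.
have [e0|e0] := eqVneq (nm e) 0.
  exists v => //; apply/esym/eqP; rewrite Pv -subr_eq0.
  by rewrite -[u - p]/e (nm0_eq0 e0).
have oe w (c : R[i]) : L w -> g e (c *: Pp w) = 0.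
  by move=> Lw; apply: pP; exists (c *: w); rewrite ?linearZ // -[_ *: w]addr0; apply: LP.
have ope w c : L w -> nm (Pp (w + c *: e)) ^+ 2 = nm (Pp w) ^+ 2 + cmod c ^+ 2 * nm e ^+ 2.
  move=> Lw; rewrite linearD /= linearZ /= Pe (nmD_sqr ip_norm) nmZ exprMn.
  by rewrite [g (Pp w) _]ripC ripZc oe // mulr0 addr0.
(* Orthogonality of [e] to the H_+ parts of [L] controls the coefficient [c], so along a convergent
   sequence the multiples of [e] converge on their own. *)
have ce w c : L w -> cmod c * nm e <= nm (w + c *: e).
  move=> Lw; apply: le_trans (nmPp _); apply: sqr_leP => //.
  by rewrite ope // exprMn; have := sqr_ge0 (nm (Pp w)); lra.
pose L' := [set x | exists w (c : R[i]), L w /\ x = w + c *: e].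
have LL' : L `<=` L' by move=> w Lw; exists w, 0; rewrite scale0r addr0.
have L'L : L' = L.
  apply: Lmax => //; split.
  - apply/submodE; split; first exact: LL'.
    move=> c _ _ [w [a [Lw ->]]] [w' [a' [Lw' ->]]].
    by exists (c *: w + w'), (c * a + a'); split; [exact: LP | vec ip_norm].
  - apply/closed_nmP => x hx.
    have /choice[q qP] : forall n, exists q : H * R[i], L q.1 /\ nm (x - (q.1 + q.2 *: e)) < n.+1%:R^-1.
      move=> n; have n0 : 0 < n.+1%:R^-1 :> R by rewrite invr_gt0 ltr0n.
      by have [_ [w [c [Lw ->]]] h] := hx _ n0; exists (w, c).
    have e1 : 0 < nm e by rewrite lt_def e0 nmge0.
    have [|l lP] := @nm_cauchy _ _ (fun n => (q n).2 *: e).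
      move=> d d0; have d20 : 0 < d / 2 by rewrite divr_gt0.
      have [N NP] := invS_lt d20; exists N => m n Nm Nn.
      have h1 := lt_trans (qP m).2 (NP _ Nm); have h2 := lt_trans (qP n).2 (NP _ Nn).
      rewrite -scalerBl nmZ.
      have Lmn : L ((q m).1 - (q n).1).
        by rewrite addrC -scaleN1r; apply: LP; [case: (qP n) | case: (qP m)].
      apply: le_lt_trans (ce _ _ Lmn) _.
      have -> : (q m).1 - (q n).1 + ((q m).2 - (q n).2) *: e =
        (x - ((q n).1 + (q n).2 *: e)) - (x - ((q m).1 + (q m).2 *: e)) by vec ip_norm.
      by apply: le_lt_trans (nmB _ _) _; lra.
    have Ll : L (x - l).
      apply: Lc => d d0; have d20 : 0 < d / 2 by rewrite divr_gt0.
      have [N NP] := lP _ d20; have [N' NP'] := invS_lt d20.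
      pose k := maxn N N'; exists (q k).1; first by case: (qP k).
      have h1 := NP k (leq_maxl _ _).
      have h2 := lt_trans (qP k).2 (NP' k (leq_maxr _ _)).
      have -> : x - l - (q k).1 = (x - ((q k).1 + (q k).2 *: e)) + ((q k).2 *: e - l).
        by vec ip_norm.
      by apply: le_lt_trans (nmD _ _) _; lra.
    (* The limit of multiples of [e] is again a multiple: the real products with [e] and ['i%C *: e]
       read off its coefficient continuously. *)
    have le : l = (g l e / nm e ^+ 2)%:C *: e + ((g l ('i%C *: e)) / nm e ^+ 2)%:C *: ('i%C *: e).
      have ce2 (c : R[i]) : c *: e = (g (c *: e) e / nm e ^+ 2)%:C *: e +
          ((g (c *: e) ('i%C *: e)) / nm e ^+ 2)%:C *: ('i%C *: e).
        have ci : c *: e = (complex.Re c)%:C *: e + (complex.Im c)%:C *: ('i%C *: e).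
          by rewrite scalerA -scalerDl mulrC -complexE.
        have -> : g (c *: e) e = complex.Re c * nm e ^+ 2.
          by rewrite ci ripDl !ripZl (rip_nm ip_norm) ripC ripii mulr0 addr0.
        have -> : g (c *: e) ('i%C *: e) = complex.Im c * nm e ^+ 2.
          by rewrite {1}ci ripDl !ripZl ripii ripi (rip_nm ip_norm) mulr0 add0r.
        by rewrite !mulfK ?expf_neq0.
      apply/eqP; rewrite -subr_eq0 -nm_eq0; apply/eqP/le_anti; rewrite nmge0 andbT.
      apply: (@le0_all _ _ 3) => d /lP[N /(_ _ (leqnn _))].
      set c := (q N).2 => h.
      pose f a := (g a e / nm e ^+ 2)%:C *: e + ((g a ('i%C *: e)) / nm e ^+ 2)%:C *: ('i%C *: e).
      have -> : l - ((g l e / nm e ^+ 2)%:C *: e + ((g l ('i%C *: e)) / nm e ^+ 2)%:C *: ('i%C *: e))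
         = (l - c *: e) - f (l - c *: e).
        rewrite {1}(ce2 c) /f !ripBl !mulrBl !rmorphB; vec ip_norm.
      have fb a : nm (f a) <= 2 * nm a.
        have e20 : 0 < nm e ^+ 2 by rewrite exprn_gt0.
        have ie : nm ('i%C *: e) = nm e.
          by apply/eqP; rewrite -(@eqrXn2 _ 2) // -!(rip_nm ip_norm) ripi.
        apply: le_trans (nmD _ _) _; rewrite !nmZr ie !normrM normfV (ger0_norm (sqr_ge0 (nm e))).
        have h1 := ler_rip ip_norm a e; have := ler_rip ip_norm a ('i%C *: e); rewrite ie => h2.
        have k (z : R) : `|z| <= nm a * nm e -> `|z| / nm e ^+ 2 * nm e <= nm a.
          by move=> hz; rewrite expr2 invfM mulrA mulfVK // ler_pdivrMr.
        by have := k _ h1; have := k _ h2; lra.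
      apply: le_trans (nmB _ _) _; have := fb (l - c *: e); rewrite nm_distC in h; lra.
    exists (x - l), ((g l e / nm e ^+ 2)%:C + ((g l ('i%C *: e)) / nm e ^+ 2)%:C * 'i%C); split => //.
    by rewrite scalerDl -scalerA -le subrK.
  - move=> _ [w [c [Lw ->]]]; rewrite ipJ ler0c ope //.
    have -> : Pm (w + c *: e) = Pm w.
      by rewrite addrC linearP (Pm_of_Pp Pe) scaler0 add0r.
    have := sqr_le (nmge0 _) (Lle _ Lw).
    have : 0 <= cmod c ^+ 2 * nm e ^+ 2 by rewrite mulr_ge0 ?sqr_ge0.
    by lra.
have Le : L e by rewrite -L'L; exists 0, 1; rewrite scale1r add0r.
have := oe _ 1 Le; rewrite scale1r Pe (rip_nm ip_norm) => /eqP.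
by rewrite sqrf_eq0 (negPf e0).
Qed.

End GraphSubspaces.

(** * Dissipative operators in a Krein space *)

Section Krein.
Variables (R : realType) (H : completeNormedModType R[i]).
Variable ip : {dot H for conjC}.
Hypothesis ip_norm : forall x : H, `|x| ^+ 2 = ip x x.
Variables Pp Pm : {linear H -> H}.
Hypothesis Pp_proj : orthogonal_projection ip Pp.
Hypothesis Pm_proj : orthogonal_projection ip Pm.
Hypothesis PpDPm : forall x, Pp x + Pm x = x.
Local Notation g := (rip ip).
Let nmge0 (x : H) : 0 <= nm x := nm_ge0 x.
Let cmodge0 (c : R[i]) : 0 <= cmod c := cmod_ge0 c.
Hint Resolve nmge0 cmodge0 : core.
Local Notation Ppi := (Pp_idem Pp_proj).
Local Notation Pmi := (Pm_idem Pm_proj).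
Local Notation PpPm0 := (PpPm Pp_proj PpDPm).
Local Notation PmPp0 := (PmPp Pm_proj PpDPm).
Local Notation nmPp := (nm_Pp ip_norm Pp_proj PpDPm).
Local Notation nmPm := (nm_Pm ip_norm Pp_proj PpDPm).
Local Notation J := (fun x => Pp x - Pm x).
Local Notation Ppm := (Pp_of_Pm Pp_proj PpDPm).
Local Notation Pmp := (Pm_of_Pp Pm_proj PpDPm).
Local Notation PpD := (linD (@lin_Pp R H Pp)).
Local Notation PpB := (linB (@lin_Pp R H Pp)).
Local Notation PpZ := (linZ (@lin_Pp R H Pp)).
Local Notation PmD := (linD (@lin_Pm R H Pm)).
Local Notation PmB := (linB (@lin_Pm R H Pm)).
Local Notation PmZ := (linZ (@lin_Pm R H Pm)).
Local Notation deq := (decomp_eq PpDPm).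

Variable A : partial_op H.
Hypothesis AP : forall (c : R[i]) x y, dom A x -> dom A y -> dom A (c *: x + y).
Hypothesis A0 : dom A 0.
Hypothesis Alin : forall (c : R[i]) x y, dom A x -> dom A y ->
  A (c *: x + y) = c *: A x + A y.
Hypothesis Adense : forall h (e : R), 0 < e -> exists2 x, dom A x & nm (h - x) < e.
Hypothesis Acore : forall h, dom A h -> forall e : R, 0 < e -> exists x z,
  [/\ dom A x /\ Pp x = x, dom A z /\ Pm z = z, nm (h - (x + z)) < e &
      nm (A h - A (x + z)) < e].
Hypothesis AJ : forall x, dom A x -> 0 <= g (Pp (A x) - Pm (A x)) ('i%C *: x).

Lemma A00 : A 0 = 0.
Proof. by have := Alin (-1) A0 A0; rewrite !scaleN1r oppr0 addr0 addNr. Qed.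

Lemma AB x y : dom A x -> dom A y -> dom A (x - y).
Proof. by move=> Dx Dy; rewrite addrC -scaleN1r; apply: AP. Qed.

Lemma ABlin x y : dom A x -> dom A y -> A (x - y) = A x - A y.
Proof. by move=> Dx Dy; rewrite addrC -scaleN1r Alin // scaleN1r addrC. Qed.

Lemma AD x y : dom A x -> dom A y -> dom A (x + y).
Proof. by move=> Dx Dy; rewrite -[x]scale1r; apply: AP. Qed.

Lemma ADlin x y : dom A x -> dom A y -> A (x + y) = A x + A y.
Proof. by move=> Dx Dy; rewrite -{1}[x]scale1r Alin // scale1r. Qed.

Lemma Dm_Im z : dom A z -> Pm z = z -> g (Pm (A z)) ('i%C *: z) <= 0.
Proof.
move=> Dz Pz; have := AJ Dz; rewrite ripBl -{2}Pz -linearZ /=.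
by rewrite (rip_PpPm Pp_proj PpDPm); lra.
Qed.

(** As [J] is -1 on H_-, [AJ] makes the imaginary part of (A22 z, z) nonpositive; testing A22 z - c
    z against ['i%C *: z] then gives the bound. *)
Lemma Dm_bound (c : R[i]) z : dom A z -> Pm z = z ->
  complex.Im c * nm z <= nm (Pm (A z) - c *: z).
Proof.
move=> Dz Pz; have [->|z0] := eqVneq (nm z) 0; first by rewrite mulr0.
have z1 : 0 < nm z by rewrite lt_def z0 nmge0.
rewrite -(ler_pM2r z1) -mulrA -expr2.
have iz : nm ('i%C *: z) = nm z.
  by apply/eqP; rewrite -(@eqrXn2 _ 2) // -!(rip_nm ip_norm) ripi.
have := ler_rip ip_norm (Pm (A z) - c *: z) ('i%C *: z); rewrite iz.
apply: le_trans; rewrite -normrN; apply: le_trans (ler_norm _).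
have ci : c *: z = (complex.Re c)%:C *: z + (complex.Im c)%:C *: ('i%C *: z).
  by rewrite scalerA -scalerDl mulrC -complexE.
rewrite ripBl ci ripDl !ripZl ripii ripi (rip_nm ip_norm).
by have := Dm_Im Dz Pz; lra.
Qed.

(** Only some power of [X] contracts. The estimate telescopes [u - iter N X u]; for existence, the
    Neumann sum [Gf] is cut at [N] terms and the remainder is handled by a fixed point. *)
Lemma neumann (X : H -> H) : lin X -> (forall u, nm (X u) <= 2 * nm u) ->
  (forall u, Pp (X u) = X u) ->
  (exists N, forall u, Pp u = u -> nm (iter N X u) <= 2^-1 * nm u) ->
  exists C : R, (forall u, Pp u = u -> nm u <= C * nm (u - X u)) /\
    forall f, Pp f = f -> exists2 u, Pp u = u & u - X u = f.
Proof.
move=> Xl X2 XP [N XN].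
have Xk k f : nm (iter k X f) <= 2 ^+ k * nm f.
  elim: k => [|k IH]; first by rewrite mul1r.
  by rewrite exprS /=; have := X2 (iter k X f); lra.
have [C [C0 CP]] : exists C : R, 0 <= C /\ forall u, nm (u - iter N X u) <= C * nm (u - X u).
  elim: (N) => [|n [C [C0 IH]]]; first by exists 0; split => // u; rewrite subrr nm0 mul0r.
  exists (C + 2 ^+ n); split=> [|u]; first by rewrite addr_ge0 // exprn_ge0.
  have -> : u - iter n.+1 X u = (u - iter n X u) + iter n X (u - X u).
    by rewrite (linB (lin_iter n Xl)) -iterSr; vec ip_norm.
  by apply: le_trans (nmD _ _) _; rewrite mulrDl; apply: lerD.
exists (2 * C); split=> [u Pu|f Pf].
  have := CP u; have := XN u Pu; have := nm_tri (iter N X u) u 0; rewrite !subr0; lra.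
pose Gf n := iter n (fun v => f + X v) 0.
have GS n : Gf n + iter n X f = f + X (Gf n).
  elim: n => [|n IH]; first by rewrite /Gf /= (lin0 Xl) add0r addr0.
  have GSn : Gf n.+1 = f + X (Gf n) by [].
  by rewrite {1}GSn -addrA iterS -(linD Xl) IH -GSn.
have GP n : Pp (Gf n) = Gf n.
  by case: n => [|n]; rewrite /Gf /= ?linear0 // linearD /= XP Pf.
have XNP u : Pp u = u -> Pp (iter N X u) = iter N X u.
  by case: (N) => [//|n] Pu /=; rewrite XP.
pose F u := Gf N + iter N X (Pp u).
have Fc u u' : nm (F u - F u') <= 2^-1 * nm (u - u').
  rewrite /F opprD addrACA subrr add0r -(linB (lin_iter N Xl)) -PpB.
  by apply: le_trans (XN _ (Ppi _)) _; have := nmPp (u - u'); lra.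
have half : (2^-1 : R) < 1 by lra.
have [u uE] := fixpoint half Fc.
have Pu : Pp u = u by rewrite -uE /F PpD GP XNP ?Ppi.
have uE2 : u = Gf N + iter N X u by rewrite -{1}uE /F Pu.
exists u => //.
(* [f + X u] solves the same fixed point equation as [u], because [X] commutes with its powers;
   uniqueness yields [u = f + X u]. *)
have : f + X u = F (f + X u).
  rewrite /F PpD Pf XP (linD (lin_iter N Xl)) addrA GS -addrA; congr (_ + _).
  by rewrite -iterSr iterS -(linD Xl) -uE2.
move/(fix_unique half Fc)/(_ (esym uE)) => e.
by rewrite -{1}e addrK.
Qed.

(** * The resolvent of the block A22 at a point of the upper half-plane *)

Section Shift.
Variable c : R[i].
Hypothesis c0 : 0 < complex.Im c.
Variable Rc : H -> H.
Hypothesis RcP : forall y, Pm y = y ->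
  [/\ dom A (Rc y), Pm (Rc y) = Rc y & Pm (A (Rc y)) - c *: Rc y = y].

Lemma res_bound y : Pm y = y -> complex.Im c * nm (Rc y) <= nm y.
Proof. by move=> /RcP[D P E]; rewrite -[in leRHS]E; apply: Dm_bound. Qed.

Lemma shift_inj z : dom A z -> Pm z = z -> Pm (A z) = c *: z -> z = 0.
Proof.
move=> Dz Pz e; have := Dm_bound c Dz Pz; rewrite e subrr nm0.
move=> h; apply/nm0_eq0/le_anti; rewrite nmge0 andbT.
by rewrite -(ler_pM2l c0) mulr0.
Qed.

Lemma res_uniq z y : dom A z -> Pm z = z -> Pm (A z) - c *: z = y -> Rc y = z.
Proof.
move=> Dz Pz e.
have Py : Pm y = y by rewrite -e linearB linearZ /= Pmi Pz.
have [DR PR RE] := RcP Py.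
apply/eqP; rewrite -subr_eq0; apply/eqP; apply: shift_inj.
- exact: AB.
- by rewrite linearB /= PR Pz.
- rewrite ABlin // linearB scalerBr; apply/eqP; rewrite -subr_eq0; apply/eqP.
  have -> : Pm (A (Rc y)) - Pm (A z) - (c *: Rc y - c *: z) =
     (Pm (A (Rc y)) - c *: Rc y) - (Pm (A z) - c *: z) by vec ip_norm.
  by rewrite RE e subrr.
Qed.

Lemma res_lin (a : R[i]) y y' : Pm y = y -> Pm y' = y' -> Rc (a *: y + y') = a *: Rc y + Rc y'.
Proof.
move=> Py Py'; have [D P E] := RcP Py; have [D' P' E'] := RcP Py'.
apply: res_uniq; first exact: AP; first by rewrite linearP /= P P'.
by rewrite Alin // linearP /= -[in RHS]E -[in RHS]E'; vec ip_norm.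
Qed.

Lemma resG_lin (a : R[i]) y y' : Pm y = y -> Pm y' = y' ->
  Pp (A (Rc (a *: y + y'))) = a *: Pp (A (Rc y)) + Pp (A (Rc y')).
Proof.
move=> Py Py'; have [D P E] := RcP Py; have [D' P' E'] := RcP Py'.
by rewrite res_lin // Alin // linearP.
Qed.

End Shift.

Variable U : set_system nat.
Hypothesis UU : UltraFilter U.
Hypothesis Uoo : forall N, U [set n | (N <= n)%N].

(** * Compactness and smallness of A12 (A22 - it)^-1 *)

Section Compact.
Variable mu : R[i].
Hypothesis mu0 : 0 < complex.Im mu.
Let A12 := block Pp Pm A.
Let A22 := block Pm Pm A.
Hypothesis A22_mdiss : m_dissipative_in ip (range Pm) (op_opp A22).
Hypothesis A12_compact : compact_op (range Pm) (range Pp)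
  (op_comp A12 (op_inv (op_sub_scalar A22 mu))).

Let rangePm x : range Pm x <-> Pm x = x.
Proof. by split=> [[y _ <-]|<-]; [rewrite Pmi | exists x]. Qed.

Lemma A22_surj t y : 0 < t -> Pm y = y -> exists z,
  [/\ dom A z, Pm z = z & Pm (A z) - (t%:C * 'i%C) *: z = y].
Proof.
move=> t0 Py.
have [|||z [Dz /rangePm Pz] e] := @m_diss_surj _ _ _ ip_norm _ UU Uoo (range Pm) _ A22_mdiss _ t t0 _ (- y).
- by move=> c x1 y1 /rangePm h1 /rangePm h2; apply/rangePm; rewrite linearP /= h1 h2.
- move=> x1 hx; apply/rangePm; apply/eqP; rewrite -subr_eq0 -nm_eq0 eq_le nmge0 andbT.
  apply: (@le0_all _ _ 2) => e /hx[z /rangePm Pz xz].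
  have -> : Pm x1 - x1 = Pm (x1 - z) - (x1 - z) by rewrite PmB Pz; vec ip_norm.
  by have := nmB (Pm (x1 - z)) (x1 - z); have := nmPm (x1 - z); lra.
- by apply/rangePm; rewrite linearN /= Py.
exists z; split => //; move: e => /=; rewrite Pz => e.
by rewrite -[RHS]opprK -e; vec ip_norm.
Qed.

Let R_ := op_inv (op_sub_scalar A22 mu).

(** That A22 - mu maps onto H_- is read off from the domain clause of [compact_op]: the composite is
    defined on all of [range Pm]. *)
Lemma RmuP y : Pm y = y -> [/\ dom A (R_ y), Pm (R_ y) = R_ y & Pm (A (R_ y)) - mu *: R_ y = y].
Proof.
move=> /rangePm Py; have [De _ _] := A12_compact; move: Py; rewrite -De => -[[x Dx xy] _].
rewrite /R_ /=; case: xgetP => [z _ [[Dz /rangePm Pz] e]|/(_ x)]; last by case; split.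
by split => //; move: e => /=; rewrite Pz.
Qed.

Let Gm y := Pp (A (R_ y)).
Let CE y : Pm y = y -> op_comp A12 (op_inv (op_sub_scalar A22 mu)) y = Gm y.
Proof. by move=> /RmuP[_ P _]; rewrite /Gm -[in RHS]P. Qed.

Let R_lin := res_lin mu0 RmuP.
Let Gm_lin := resG_lin mu0 RmuP.

Let GmP_lin : lin (fun y => Gm (Pm y)).
Proof. by move=> c x y; rewrite linearP /= /Gm Gm_lin ?Pmi. Qed.

Let RP_lin : lin (fun y => R_ (Pm y)).
Proof. by move=> c x y; rewrite PmD PmZ R_lin ?Pmi. Qed.

Lemma Gm_lim x (M : R) : (forall n, Pm (x n) = x n) ->
  (\forall n \near U, nm (x n) <= M) -> exists l, slim U (fun n => Gm (x n)) l.
Proof.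
(* Scaling by [c], positive whatever the sign of [M], brings the sequence into the unit ball on
   which [compact_op] speaks. *)
move=> Px xM; pose c := `|M| + 1.
have c0 : 0 < c by rewrite /c ltr_wpDl.
have cn : c%:C != 0 :> R[i] by rewrite eq_complex /= eqxx andbT gt_eqF.
pose y n := c^-1%:C *: x n.
have Py n : Pm (y n) = y n by rewrite PmZ Px.
have xE n : Gm (x n) = c%:C *: Gm (y n).
  have := linZ GmP_lin c%:C (y n); rewrite PmZ !Py => <-.
  by rewrite /y scalerA -rmorphM mulfV ?gt_eqF // scale1r.
have [_ _] := A12_compact; rewrite precompactE compact_ultra.
have UF := ultra_fmap (fun n => Gm (y n)) UU.
case/(_ _ UF).
  apply: filterS xM => n xn /=; apply: subset_closure.
  exists (y n); last exact: CE.
  split; first exact/rangePm.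
  rewrite nmE -[1]/((1 : R)%:C) lecR nmZr ger0_norm ?invr_ge0 ?(ltW c0) //.
  by rewrite ler_pdivrMl // mulr1 /c; have := ler_norm M; lra.
move=> p [_ /cvgrPdist_lt yp]; exists (c%:C *: p).
have yp' : slim U (fun n => Gm (y n)) p.
  apply/(slimP UU) => e e0; have : 0 < e%:C :> R[i] by rewrite ltcR.
  by move=> /yp; apply: filterS => n; rewrite nmE ltcR nm_distC.
by apply: (slim_near UU _ (slimZ UU c%:C yp')); apply: nearW => n; rewrite xE.
Qed.

Lemma Gm_bounded : exists M : R, forall y, Pm y = y -> nm (Gm y) <= M * nm y.
Proof.
apply: contrapT => noM0; have noM := fun M h => noM0 (ex_intro _ M h).
have /choice[x xP] : forall n : nat, exists x, [/\ Pm x = x, nm x <= 1 & n%:R < nm (Gm x)].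
  move=> n; have /existsNP[y /not_implyP[Py /negP]] := noM n%:R; rewrite -ltNge => ny.
  have y0 : 0 < nm y.
    rewrite nm_gt0; apply/eqP => y0; move: ny; have := lin0 GmP_lin.
    by rewrite linear0 y0 => ->; rewrite nm0 mulr0 ltxx.
  have i0 : `|(nm y)^-1| = (nm y)^-1 by rewrite ger0_norm // invr_ge0.
  exists ((nm y)^-1%:C *: y); split; first by rewrite PmZ Py.
    by rewrite nmZr i0 mulVf // gt_eqF.
  have := linZ GmP_lin (nm y)^-1%:C y; rewrite PmZ !Py => ->.
  by rewrite nmZr i0 ltr_pdivlMl // mulrC.
have [|l xl] := @Gm_lim x 1 (fun n => let: And3 h _ _ := xP n in h).
  by apply: nearW => n; case: (xP n).
have [N NP] : exists N : nat, nm l + 1 < N%:R.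
  by have [N] := archi_boundP (addr_ge0 (nmge0 l) ler01); exists (Num.bound (nm l + 1)).
have [n [/= Nn n1]] := filter_ex (filterI (Uoo N) (slim_bounded UU xl)).
have [_ _] := xP n; have : (N%:R : R) <= n%:R by rewrite ler_nat.
by lra.
Qed.

(** Precompactness supplies some norm limit and boundedness the weak limit [Gm l]; uniqueness of
    weak limits identifies them. *)
Lemma Gm_comp x l (M : R) : (forall n, Pm (x n) = x n) ->
  (\forall n \near U, nm (x n) <= M) -> wlim ip U x l ->
  Pm l = l /\ slim U (fun n => Gm (x n)) (Gm l).
Proof.
move=> Px xM xl; have bPm : bd Pm 1 by move=> z; rewrite mul1r; apply: nmPm.
have Pl : Pm l = l.
  apply: (wlim_unique ip_norm UU (wlim_map ip_norm (@lin_Pm R H Pm) bPm xl)).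
  by apply: (wlim_near UU) xl; apply: nearW => n; rewrite Px.
split => //; have [l' xl'] := Gm_lim Px xM.
have [C CP] := Gm_bounded.
have bG : bd (fun y => Gm (Pm y)) `|C|.
  move=> y; apply: le_trans (CP _ (Pmi y)) _.
  apply: (le_trans (y := `|C| * nm (Pm y))); first by apply: ler_wpM2r => //; apply: ler_norm.
  by apply: ler_wpM2l => //; apply: nmPm.
suff -> : Gm l = l' by [].
have h := wlim_map ip_norm GmP_lin bG xl; rewrite Pl in h.
apply: (wlim_unique ip_norm UU h); apply: (wlim_near UU) (slim_wlim ip_norm UU xl').
by apply: nearW => n; rewrite Px.
Qed.

(** Smallness by contradiction: rescaled bad vectors for [t] tending to infinity are carried by the
    resolvent identity to a bounded sequence [v]. There [R_ (v n)] tends to 0, so the weak limit of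
    [v] is 0 by injectivity of [R_], and compactness sends [Gm (v n)] to 0 although its norm stays
    above 1/8. *)
Lemma small_resolvent : exists t Rt, [/\ 0 < t,
  (forall y, Pm y = y ->
    [/\ dom A (Rt y), Pm (Rt y) = Rt y & Pm (A (Rt y)) - (t%:C * 'i%C) *: Rt y = y]),
  (forall y, Pm y = y -> nm (Pp (A (Rt y))) <= 8^-1 * nm y) &
  forall x l (M : R), (forall n, Pm (x n) = x n) ->
    (\forall n \near U, nm (x n) <= M) -> wlim ip U x l ->
    slim U (fun n => Pp (A (Rt (x n)))) (Pp (A (Rt l)))].
Proof.
have /choice[Rt RtP] : forall t : R, exists Rt, 0 < t -> forall y, Pm y = y ->
    [/\ dom A (Rt y), Pm (Rt y) = Rt y & Pm (A (Rt y)) - (t%:C * 'i%C) *: Rt y = y].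
  move=> t; have [t0|t0] := boolP (0 < t); last by exists id.
  have /choice[r rP] : forall y, exists z, Pm y = y ->
      [/\ dom A z, Pm z = z & Pm (A z) - (t%:C * 'i%C) *: z = y].
    move=> y; have [Py|Py] := pselect (Pm y = y); last by exists 0.
    by have [z zP] := A22_surj t0 Py; exists z.
  by exists r.
have Im_it (t : R) : complex.Im (t%:C * 'i%C) = t by rewrite /= mulr1 mul0r addr0.
(* Resolvent identity: [s t y] is (A22 - mu) applied to [Rt t y], so [R_ (s t y) = Rt t y] and the
   corner at it is [Gm] after [s t]. *)
pose s t y := y + (t%:C * 'i%C - mu) *: Rt t y.
have sP t y : 0 < t -> Pm y = y -> Pm (s t y) = s t y /\ R_ (s t y) = Rt t y.
  move=> t0 Py; have [D P E] := RtP t t0 y Py; split; first by rewrite PmD PmZ P Py.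
  apply: (res_uniq mu0 RmuP) => //; rewrite /s; move: (Rt t y) E => z <-.
  by vec ip_norm.
have Rb t y : 0 < t -> Pm y = y -> t * nm (Rt t y) <= nm y.
  move=> t0 Py; have := res_bound (RtP t t0) Py; rewrite Im_it; exact.
have Rtl t : 0 < t -> lin (fun y => Rt t (Pm y)).
  move=> t0 c x y; rewrite linearP /= (res_lin _ (RtP t t0)) ?Pmi //.
  by rewrite Im_it.
have [t [t0 tb]] : exists t, 0 < t /\ forall y, Pm y = y -> nm (Pp (A (Rt t y))) <= 8^-1 * nm y.
  (* Adding [cmod mu] gives [cmod mu <= t n], which bounds the rescaled [s (t n) (y n)] by 1 + 1 +
     1. *)
  apply: contrapT => no; pose t n := cmod mu + n.+2%:R : R.
  have t0 n : 0 < t n by rewrite /t ltr_wpDl // ltr0n.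
  have /choice[y yP] : forall n, exists y, Pm y = y /\ 8^-1 * nm y < nm (Pp (A (Rt (t n) y))).
    move=> n; apply: contrapT => no'; apply: no; exists (t n); split => // y Py.
    by rewrite leNgt; apply/negP => h; apply: no'; exists y.
  have Py n : Pm (y n) = y n by case: (yP n).
  have y0 n : 0 < nm (y n).
    rewrite nm_gt0; apply/eqP => e; have [_] := yP n; have := lin0 (Rtl _ (t0 n)).
    by rewrite e linear0 => ->; rewrite nm0 mulr0 A00 linear0 nm0 ltxx.
  pose c n := (nm (y n))^-1.
  have c0 n : 0 < c n by rewrite invr_gt0.
  pose v n := (c n)%:C *: s (t n) (y n).
  have Pv n : Pm (v n) = v n by rewrite PmZ (sP _ _ (t0 n) (Py n)).1.
  have nmc n z : nm ((c n)%:C *: z) = c n * nm z by rewrite nmZr gtr0_norm.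
  have Rv n : R_ (v n) = (c n)%:C *: Rt (t n) (y n).
    have [Ps <-] := sP _ _ (t0 n) (Py n).
    by have := linZ RP_lin (c n)%:C (s (t n) (y n)); rewrite PmZ Ps.
  have Gv n : Gm (v n) = (c n)%:C *: Pp (A (Rt (t n) (y n))).
    have [Ps <-] := sP _ _ (t0 n) (Py n).
    by have := linZ GmP_lin (c n)%:C (s (t n) (y n)); rewrite PmZ Ps.
  have tR n := Rb _ _ (t0 n) (Py n).
  have v3 n : nm (v n) <= 3.
    rewrite nmc ler_pdivrMl //; apply: le_trans (nmD _ _) _; rewrite nmZ.
    have it_t : cmod ((t n)%:C * 'i%C) = t n.
      apply/eqP; rewrite -(@eqrXn2 _ 2) ?(ltW (t0 n)) // cmod_sqr /=; apply/eqP; ring.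
    have := cmodD ((t n)%:C * 'i%C) (- mu); rewrite cmodN it_t => h.
    have mt : cmod mu <= t n by rewrite /t lerDl ler0n.
    have := ler_wpM2r (nmge0 (Rt (t n) (y n))) h.
    have := ler_wpM2r (nmge0 (Rt (t n) (y n))) mt.
    by have := tR n; lra.
  have [l vl] := wlim_ex ip_norm UU (nearW _ v3).
  have [Pl Gvl] := Gm_comp Pv (nearW _ v3) vl.
  have bR : bd (fun y => R_ (Pm y)) (complex.Im mu)^-1.
    move=> z; rewrite ler_pdivlMl //.
    exact: le_trans (res_bound RmuP (Pmi z)) (nmPm z).
  have Rl := wlim_map ip_norm RP_lin bR vl; rewrite Pl in Rl.
  have R0 : slim U (fun n => R_ (Pm (v n))) 0.
    apply: (slim_squeeze UU _ (@ucvg_invS R U UU Uoo)); apply: nearW => n.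
    rewrite subr0 Pv Rv nmc ler_pdivrMl // ler_pdivlMr ?ltr0n //.
    apply: le_trans (tR n); rewrite mulrC; apply: ler_wpM2r => //.
    by rewrite /t lerDr.
  have Rl0 := wlim_unique ip_norm UU Rl (slim_wlim ip_norm UU R0).
  have l0 : l = 0.
    by have [_ _] := RmuP Pl; rewrite Rl0 A00 linear0 scaler0 subr0.
  have := slim_ge UU Gvl (M := 8^-1); rewrite l0.
  have := lin0 GmP_lin; rewrite linear0 => ->; rewrite nm0 => h.
  have : (8^-1 : R) <= 0; last by lra.
  apply: h; apply: nearW => n; rewrite Gv nmc ler_pdivlMl // mulrC.
  exact: ltW (yP n).2.
exists t, (Rt t); split=> //; first exact: RtP.
move=> x l M Px xM xl.
have bR : bd (fun y => Rt t (Pm y)) t^-1.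
  by move=> y; rewrite ler_pdivlMl //; apply: le_trans (Rb _ _ t0 (Pmi y)) (nmPm y).
have [Pl _] := Gm_comp Px xM xl.
have sl : wlim ip U (fun n => s t (x n)) (s t l).
  have := wlimD UU xl (wlimZ (c := t%:C * 'i%C - mu) (wlim_map ip_norm (Rtl t t0) bR xl)).
  by rewrite Pl; apply: (wlim_near UU); apply: nearW => n; rewrite Px.
have sM : \forall n \near U, nm (s t (x n)) <= M + cmod (t%:C * 'i%C - mu) * (t^-1 * M).
  apply: filterS xM => n xn; apply: le_trans (nmD _ _) _; apply: lerD => //.
  rewrite nmZ; apply: ler_wpM2l => //; have := bR (x n); rewrite Px => h; apply: le_trans h _.
  by apply: ler_wpM2l; rewrite // invr_ge0 ltW.
have Ps n : Pm (s t (x n)) = s t (x n) by case: (sP t (x n)).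
have [_ h] := Gm_comp Ps sM sl.
move: h; rewrite /Gm (sP t l t0 Pl).2; apply: (slim_near UU); apply: nearW => n.
by rewrite (sP t _ t0 (Px n)).2.
Qed.

End Compact.

(** * The Schur complement and the two implications *)

Section Resolvent.
Variable t : R.
Hypothesis t0 : 0 < t.
Local Notation it := (t%:C * 'i%C).
Variable Rt : H -> H.
Hypothesis RtP : forall y, Pm y = y ->
  [/\ dom A (Rt y), Pm (Rt y) = Rt y & Pm (A (Rt y)) - it *: Rt y = y].
Let G y := Pp (A (Rt y)).
Hypothesis Gb : forall y, Pm y = y -> nm (G y) <= 8^-1 * nm y.

Let nm_it (x : H) : nm (it *: x) = t * nm x.
Proof.
rewrite nmZ; congr (_ * _); apply/eqP; rewrite -(@eqrXn2 _ 2) ?(ltW t0) //.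
by rewrite cmod_sqr /=; apply/eqP; ring.
Qed.

Let Im_it : 0 < complex.Im it.
Proof. by rewrite /= mulr1 mul0r addr0. Qed.

Lemma G_lin (a : R[i]) y y' : Pm y = y -> Pm y' = y' -> G (a *: y + y') = a *: G y + G y'.
Proof. exact: (resG_lin Im_it RtP). Qed.

Lemma GB y y' : Pm y = y -> Pm y' = y' -> G (y - y') = G y - G y'.
Proof. by move=> Py Py'; rewrite addrC -scaleN1r G_lin // scaleN1r addrC. Qed.

Lemma G_Pp y : Pp (G y) = G y.
Proof. exact: Ppi. Qed.

(** [up h] and [um h] are the H_+ and H_- components of (A + it J) h, that is, of [J] applied to (JA
    + it) h. *)
Definition up h := Pp (A h) + it *: Pp h.
Definition um h := Pm (A h) - it *: Pm h.

Lemma up_Pp h : Pp (up h) = up h.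
Proof. by rewrite /up linearD linearZ /= !Ppi. Qed.

Lemma um_Pm h : Pm (um h) = um h.
Proof. by rewrite /um linearB linearZ /= !Pmi. Qed.

Lemma upB h k : dom A h -> dom A k -> up (h - k) = up h - up k.
Proof. by move=> Dh Dk; rewrite /up ABlin // !linearB /=; vec ip_norm. Qed.

Lemma umB h k : dom A h -> dom A k -> um (h - k) = um h - um k.
Proof. by move=> Dh Dk; rewrite /um ABlin // !linearB /=; vec ip_norm. Qed.

(* The Schur complement [A11 - A12 (A22 - it)^-1 A21] is dissipative: test [AJ] on
   the vector [x - (A22 - it)^-1 A21 x]. *)
Lemma schur_core x z : dom A x -> Pp x = x -> dom A z -> Pm z = z ->
  t * nm x <= nm (up (x + z) - G (um (x + z))).
Proof.
move=> Dx Px Dz Pz; have Pxm := Pmp Px; have Pzp := Ppm Pz.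
have PA : Pm (Pm (A x)) = Pm (A x) by rewrite Pmi.
have [Ds Ps Es] := RtP PA; set s := Rt _ in Ds Ps Es.
have Rz : Rt (um z) = z by apply: (res_uniq Im_it RtP); rewrite // /um Pz.
have e1 : um (x + z) = um z - (- Pm (A x)).
  by rewrite /um ADlin // [Pm (A x + A z)]linearD [Pm (x + z)]linearD /= Pxm Pz; vec ip_norm.
have e2 : G (um (x + z)) = Pp (A z) + Pp (A s).
  have -> : um (x + z) = 1 *: um z + Pm (A x) by rewrite e1; vec ip_norm.
  by rewrite G_lin ?um_Pm // scale1r /G Rz.
have e3 : up (x + z) - G (um (x + z)) = Pp (A (x - s)) + it *: x.
  by rewrite e2 /up ADlin // ABlin // [Pp (A x - A s)]linearB [Pp (A x + A z)]linearD [Pp (x + z)]linearD /= Px Pzp; vec ip_norm.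
have Dxs := AB Dx Ds.
have e4 : Pm (A (x - s)) = - (it *: s).
  by rewrite ABlin // linearB /= -[X in X - _]Es; vec ip_norm.
have e5 : 0 <= g (Pp (A (x - s))) ('i%C *: x).
  have := AJ Dxs; rewrite e4 opprK scalerBr ripDl !ripBr.
  have -> : g (Pp (A (x - s))) ('i%C *: s) = 0.
    by rewrite -Ps -linearZ /= (rip_PpPm Pp_proj PpDPm).
  have -> : g (it *: s) ('i%C *: x) = 0.
    by rewrite -Ps -Px -!linearZ /= (rip_PmPp Pm_proj PpDPm).
  rewrite -scalerA ripZl ripi (rip_nm ip_norm).
  have : 0 <= t * nm s ^+ 2 by rewrite mulr_ge0 ?sqr_ge0 // ltW.
  by lra.
rewrite e3; have [->|x0] := eqVneq (nm x) 0; first by rewrite mulr0.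
have x1 : 0 < nm x by rewrite lt_def x0 nmge0.
rewrite -(ler_pM2r x1) -mulrA -expr2.
have ix : nm ('i%C *: x) = nm x.
  by apply/eqP; rewrite -(@eqrXn2 _ 2) // -!(rip_nm ip_norm) ripi.
rewrite -{2}ix; apply: le_trans (rip_le ip_norm _ _).
by rewrite ripDl -scalerA ripZl ripi (rip_nm ip_norm); lra.
Qed.

(** Every term is continuous in the graph norm, [G] thanks to [Gb], so [schur_core] extends from the
    core to all of [dom A]. *)
Lemma schur_bound h : dom A h -> t * nm (Pp h) <= nm (up h - G (um h)).
Proof.
move=> Dh; rewrite -subr_le0; apply: (@le0_all _ _ (2 + 3 * t)) => e e0.
have [x [z [[Dx Px] [Dz Pz] h1 h2]]] := Acore Dh e0.
have Dxz := AD Dx Dz.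
have k := schur_core Dx Px Dz Pz.
have p : nm (Pp h) <= nm x + nm (h - (x + z)).
  have -> : Pp h = Pp (h - (x + z)) + x.
    by rewrite linearB linearD /= Px (Ppm Pz) addr0 subrK.
  by apply: le_trans (nmD _ _) _; have := nmPp (h - (x + z)); lra.
have m : nm (up (x + z) - G (um (x + z))) <=
    nm (up h - G (um h)) + (nm (up (h - (x + z))) + nm (G (um (h - (x + z))))).
  have -> : up (x + z) - G (um (x + z)) =
     (up h - G (um h)) - (up (h - (x + z)) - G (um (h - (x + z)))).
    rewrite upB // umB // (GB (um_Pm h) (um_Pm (x + z))).
    move: (up h) (up (x + z)) (G (um h)) (G (um (x + z))) => a b c d.
    by vec ip_norm.
  apply: le_trans (nmB _ _) _; rewrite lerD2l; exact: nmB.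
have eu : nm (up (h - (x + z))) <= e + t * e.
  apply: le_trans (nmD _ _) _; apply: lerD.
    by rewrite ABlin // ; apply/ltW/(le_lt_trans (nmPp _)).
  by rewrite nm_it; apply: ler_wpM2l; [exact: ltW | apply/ltW/(le_lt_trans (nmPp _))].
have em : nm (um (h - (x + z))) <= e + t * e.
  apply: le_trans (nmB _ _) _; apply: lerD.
    by rewrite ABlin // ; apply/ltW/(le_lt_trans (nmPm _)).
  by rewrite nm_it; apply: ler_wpM2l; [exact: ltW | apply/ltW/(le_lt_trans (nmPm _))].
have := Gb (um_Pm (h - (x + z))).
have tp := ler_wpM2l (ltW t0) p; have th := ler_wpM2l (ltW t0) (ltW h1).
have := nmge0 (um (h - (x + z))); have := mulr_gt0 t0 e0; lra.
Qed.

Lemma up_um_inj h : dom A h -> up h = 0 -> um h = 0 -> h = 0.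
Proof.
move=> Dh uh mh; have := schur_bound Dh; rewrite uh mh.
have -> : G 0 = 0.
  by have := GB (um_Pm 0) (um_Pm 0); rewrite !subrr.
rewrite subrr nm0 => th.
have P0 : Pp h = 0.
  by apply/nm0_eq0/le_anti; rewrite nmge0 andbT -(ler_pM2l t0) mulr0.
have Ph : Pm h = h by rewrite -[RHS]PpDPm P0 add0r.
apply: (shift_inj Im_it) => //.
by apply/eqP; rewrite -subr_eq0 -{2}Ph -/(um h) mh.
Qed.

(** For [u] in H_+ the vector [f u] of [L] has [up (f u) = u]. Adding [Rt y] with
    [y = Pm xi - um (f u)] corrects the H_- component and changes the H_+ component by [G y];
    requiring the latter to be [Pp xi] is a fixed point equation for [u]. *)
Lemma invariant_surj (L : set H) : max_nonnegative_subspace ip J L ->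
  (forall v, L v -> exists h, [/\ dom A h, L h, L (A h) & A h + it *: h = v]) ->
  forall xi, exists h, dom A h /\ up h + um h = xi.
Proof.
move=> Lmax Lres xi.
have [[/submodE[L0 LP] _ _] _] := Lmax.
have [Lle Lonto] := max_nonneg_onto ip_norm Pp_proj Pm_proj PpDPm Lmax.
have LB x y : L x -> L y -> L (x - y).
  by move=> Lx Ly; rewrite addrC -scaleN1r; apply: LP.
have /choice[f fP] : forall u, exists h, [/\ dom A h, L h, L (A h) & up h = Pp u].
  move=> u; have [v Lv Pv] := Lonto (Pp u) (Ppi u).
  have [h [Dh Lh LAh e]] := Lres v Lv; exists h; split => //.
  by rewrite /up -linearZ -linearD e.
pose wm h := A h - it *: h.
have Lw u : L (wm (f u)).
  have [_ Lh LA _] := fP u; apply: LB => //.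
  by have := LP it _ _ Lh L0; rewrite addr0.
have umw h : um h = Pm (wm h) by rewrite /wm /um PmB PmZ.
(* Write D for the left side and P for [nm (Pp (u - u'))]. As [wm] maps into [L], D is at most P
   plus twice the Schur term, and that term is at most P + D / 8; hence D <= 3 P + D / 4. *)
have lip u u' : nm (um (f u) - um (f u')) <= 4 * nm (Pp (u - u')).
  have [D1 _ _ E1] := fP u; have [D2 _ _ E2] := fP u'.
  have k := schur_bound (AB D1 D2); rewrite upB // umB // E1 E2 -linearB /= in k.
  have e1 : um (f u) - um (f u') = Pm (wm (f u) - wm (f u')) by rewrite (PmB (wm (f u)) (wm (f u'))) -!umw.
  have e2 : Pp (wm (f u) - wm (f u')) = Pp (u - u') - ((2 : R)%:C *: (it *: Pp (f u - f u'))).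
    rewrite [Pp (u - u')]linearB /= -E1 -E2 /wm /up.
    by rewrite !(PpB, PpZ); vec ip_norm.
  have l1 := Lle _ (LB _ _ (Lw u) (Lw u')).
  rewrite -e1 e2 in l1.
  have l2 := nmB (Pp (u - u')) ((2 : R)%:C *: (it *: Pp (f u - f u'))).
  rewrite nmZr nm_it ger0_norm // in l2.
  have l3 := nmB (Pp (u - u')) (G (um (f u) - um (f u'))).
  have Pd : Pm (um (f u) - um (f u')) = um (f u) - um (f u') by rewrite linearB /= !um_Pm.
  have := Gb Pd; lra.
have [||u uE] := @fixpoint _ _ (fun u => Pp xi - G (Pm xi) + G (um (f u))) 2^-1.
- by lra.
- move=> u u'.
  have -> : Pp xi - G (Pm xi) + G (um (f u)) - (Pp xi - G (Pm xi) + G (um (f u')))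
     = G (um (f u) - um (f u')).
    rewrite (GB (um_Pm (f u)) (um_Pm (f u'))).
    by move: (G _) (G _) (G _) => a b c; vec ip_norm.
  have Pd : Pm (um (f u) - um (f u')) = um (f u) - um (f u') by rewrite linearB /= !um_Pm.
  by have := Gb Pd; have := lip u u'; have := nmPp (u - u'); lra.
have [Df _ _ Ef] := fP u.
pose y := Pm xi - um (f u).
have Py : Pm y = y by rewrite /y linearB /= Pmi um_Pm.
have [DR PR ER] := RtP Py.
exists (f u + Rt y); split; first exact: AD.
have Pu : Pp u = u by rewrite -uE PpD PpB !G_Pp Ppi.
have -> : up (f u + Rt y) = up (f u) + G y.
  by rewrite /up ADlin // !PpD (Ppm PR) addr0 /G; vec ip_norm.
have -> : um (f u + Rt y) = um (f u) + y.
  by rewrite /um ADlin // !PmD PR -[y in RHS]ER; vec ip_norm.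
have Gy : G y = G (Pm xi) - G (um (f u)) by apply: GB; rewrite ?Pmi ?um_Pm.
rewrite Ef Pu -{1}uE Gy -[RHS]PpDPm /y.
by move: (G _) (G _) => a b; move: (um _) => c; vec ip_norm.
Qed.

Hypothesis Gcomp : forall x l (M : R), (forall n, Pm (x n) = x n) ->
  (\forall n \near U, nm (x n) <= M) -> wlim ip U x l ->
  slim U (fun n => G (x n)) (G l).
Hypothesis surj : forall xi, exists h, dom A h /\ up h + um h = xi.

Lemma invariant_graph : exists K W, [/\ lin K /\ lin W,
  (forall u, nm (K u) <= nm u) /\ (forall u, nm (W u) <= 2 * nm u),
  (forall u, Pm (K u) = K u /\ Pp (W u) = W u),
  (forall u, Pp u = u -> exists h, [/\ dom A h, A h + it *: h = u + K u &
     A h - it *: h = W u + K (W u)]) &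
  (forall k : R[i], cmod k < 1 -> exists N, forall u, Pp u = u ->
    nm (k ^+ N *: iter N W u) <= 2^-1 * nm u)].
Proof.
have /choice[s sP] := surj.
have Ds xi : dom A (s xi) by case: (sP xi).
have us xi : up (s xi) = Pp xi.
  by have [_ e] := sP xi; rewrite -[in RHS]e PpD up_Pp (Ppm (um_Pm _)) addr0.
have ms xi : um (s xi) = Pm xi.
  by have [_ e] := sP xi; rewrite -[in RHS]e PmD um_Pm (Pmp (up_Pp _)) add0r.
have inj := up_um_inj.
have slin : lin s.
  move=> c x y; apply/eqP; rewrite -subr_eq0; apply/eqP; apply: inj.
  - by apply: AB => //; apply: AP.
  - have e : up (c *: s x + s y) = c *: up (s x) + up (s y).
      by rewrite /up Alin // !linearP /=; vec ip_norm.
    rewrite upB //; last exact: AP.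
    by rewrite e !us linearP subrr.
  - have e : um (c *: s x + s y) = c *: um (s x) + um (s y).
      by rewrite /um Alin // !linearP /=; vec ip_norm.
    rewrite umB //; last exact: AP.
    by rewrite e !ms linearP subrr.
(* This is (A - it J)(A + it J)^-1. For [h = s xi], exchanging the H_- components of (A + it) h and
   (A - it) h gives [xi] and [S xi]. *)
pose S xi := A (s xi) - it *: Pp (s xi) + it *: Pm (s xi).
have Slin : lin S.
  by move=> c x y; rewrite /S slin Alin // !linearP /=; vec ip_norm.
have sE xi : xi = A (s xi) + (it *: Pp (s xi) - it *: Pm (s xi)).
  by have [_ {1}<-] := sP xi; rewrite /up /um -[in RHS](PpDPm (A (s xi))); vec ip_norm.
have Sbd xi : nm (S xi) <= nm xi.
  apply: sqr_leP => //.
  have -> : S xi = A (s xi) - (it *: Pp (s xi) - it *: Pm (s xi)) by rewrite /S; vec ip_norm.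
  have -> : nm xi = nm (A (s xi) + (it *: Pp (s xi) - it *: Pm (s xi))) by rewrite -sE.
  rewrite (nmB_sqr ip_norm) (nmD_sqr ip_norm).
  suff : 0 <= g (A (s xi)) (it *: Pp (s xi) - it *: Pm (s xi)) by lra.
  rewrite -scalerBr -scalerA ripZr mulr_ge0 ?(ltW t0) //.
  have := AJ (Ds xi); rewrite ripBl (rip_Pp Pp_proj) (rip_Pm Pm_proj) -ripBr.
  by rewrite PpZ PmZ -scalerBr.
have PpS xi : Pp (S xi) = Pp xi - (2 : R)%:C *: (it *: Pp (s xi)).
  rewrite -(us xi) /S /up PpD PpB !PpZ Ppi PpPm0; vec ip_norm.
have PmS xi : Pm (S xi) = Pm xi + (2 : R)%:C *: (it *: Pm (s xi)).
  rewrite -(ms xi) /S /um PmD PmB !PmZ Pmi PmPp0; vec ip_norm.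
(* On H_- the corner of [S] is -2it times the H_+ part of [s y], which [schur_bound] controls by
   [G y]; smallness and compactness both pass from [G] to the corner. *)
have bG y : Pm y = y -> nm (Pp (S y)) <= 2 * nm (G y).
  move=> Py; rewrite PpS (Ppm Py) sub0r nmN nmZr nm_it ger0_norm //.
  have := schur_bound (Ds y); rewrite us ms (Ppm Py) Py sub0r nmN; lra.
have Shalf y : nm (Pp (S (Pm y))) <= 2^-1 * nm (Pm y).
  have := bG _ (Pmi y); have := Gb (Pmi y); have := nmge0 (Pm y); lra.
have Scomp x l (M : R) : (forall n, Pm (x n) = x n) ->
    (\forall n \near U, nm (x n) <= M) -> wlim ip U x l ->
    slim U (fun n => Pp (S (x n))) (Pp (S l)).
  move=> Px xM xl; have Pl : Pm l = l.
    have bPm : bd Pm 1 by move=> z; rewrite mul1r; apply: nmPm.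
    have h := wlim_map ip_norm (@lin_Pm R H Pm) bPm xl.
    by apply: (wlim_unique ip_norm UU h); apply: (wlim_near UU) xl; apply: nearW => n; rewrite Px.
  have h := ucvgM UU 2 (Gcomp Px xM xl).
  apply: (slim_squeeze UU _ h); apply: nearW => n.
  rewrite -PpB -(linB Slin) -GB //; apply: bG.
  by rewrite PmB Px Pl.
have [K [W [[Kl Wl Kb KWP KWE] W2 WN]]] :=
  invpair_ex ip_norm Pp_proj Pm_proj PpDPm UU Uoo Slin Sbd Shalf Scomp.
exists K, W; split => // u Pu.
set xi := Pp u + K (W u); exists (s xi).
have [PK _] := KWP u; have [PKW _] := KWP (W u); have [_ PW] := KWP u.
have e1 : Pp xi = u by rewrite /xi PpD Ppi (Ppm PKW) addr0.
have e2 : Pm xi = K (W u) by rewrite /xi PmD PmPp0 PKW add0r.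
have := PpS xi; have := PmS xi; rewrite KWE PmD PpD PK PW (Ppm PK) (Pmp PW) add0r addr0 e1 e2.
have := us xi; have := ms xi; rewrite e1 e2 /up /um => m1 u1 k1 w1.
have := PpDPm (A (s xi)); have := PpDPm (s xi); move: w1 k1 u1 m1.
have := Ds xi; move: (s xi) (Pp (A _)) (Pm (A _)) (Pp (s xi)) (Pm (s xi)).
move=> h a b c d Dh w1 k1 u1 m1 hE AE; rewrite k1 -m1 w1 -u1; split => //.
- by rewrite -AE -{1}hE; vec ip_norm.
- by rewrite -AE -{1}hE; vec ip_norm.
Qed.

(** The graph of [K] serves as [L]. In the coordinate [u] of [A d + it *: d = u + K u], the operator
    A - l on [L] becomes a nonzero multiple of 1 - ka W on H_+, which [neumann] inverts. *)
Lemma surj_invariant : exists L, [/\ max_nonnegative_subspace ip J L, invariant_under A L &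
  spectrum L (op_restr A L) `<=` [set z | 0 <= complex.Im z]].
Proof.
have [K [W [[Kl Wl] [Kb W2] KWP KWh WN]]] := invariant_graph.
pose L := [set v | Pm v = K (Pp v)].
have PK u : Pm (K u) = K u by case: (KWP u).
have PW u : Pp (W u) = W u by case: (KWP u).
have Leq v w : L v -> L w -> Pp v = Pp w -> v = w.
  by move=> Lv Lw e; apply: deq => //; rewrite Lv Lw e.
have L0 : L 0 by rewrite /L /= !linear0 (lin0 Kl).
have LP (c : R[i]) x y : L x -> L y -> L (c *: x + y).
  by rewrite /L /= !linearP /= => -> ->; rewrite Kl.
have LZ (c : R[i]) x : L x -> L (c *: x) by move=> /(LP c _ 0)/(_ L0); rewrite addr0.
have LD x y : L x -> L y -> L (x + y) by move=> /(LP 1 _ y); rewrite scale1r.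
have LB x y : L x -> L y -> L (x - y) by move=> Lx Ly; rewrite addrC -scaleN1r; apply: LP.
have PpK u : Pp u = u -> Pp (u + K u) = u by move=> Pu; rewrite PpD (Ppm (PK u)) addr0.
have Lg u : Pp u = u -> L (u + K u).
  by move=> Pu; rewrite /L /= PpK // PmD (Pmp Pu) PK add0r.
(* The fixed point equates [up - G um] for [h] and for [k], so [schur_bound] applied to [h - k]
   forces equal H_+ parts. This gives density of the domain in [L] and shows that every domain
   vector in [L] arises from some [u]. *)
have lift k : dom A k -> exists u h, [/\ Pp u = u, [/\ dom A h, A h + it *: h = u + K u &
    A h - it *: h = W u + K (W u)] & Pp h = Pp k].
  move=> Dk.
  have [||u uE] := @fixpoint _ _ (fun u => (up k - G (um k)) + G (K (W u))) 2^-1.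
  - by lra.
  - move=> u u'; rewrite opprD addrACA subrr add0r -(GB (PK _) (PK _)).
    have Pd : Pm (K (W u) - K (W u')) = K (W u) - K (W u') by rewrite PmB !PK.
    have := Gb Pd; rewrite -(linB Kl) -(linB Wl).
    have := Kb (W (u - u')); have := W2 (u - u'); have := nmge0 (u - u'); lra.
  have Pu : Pp u = u by rewrite -uE PpD PpB up_Pp /G !Ppi.
  have [h [Dh h1 h2]] := KWh u Pu; exists u, h; split => //.
  have uh : up h = u by rewrite /up -PpZ -PpD h1 PpK.
  have mh : um h = K (W u) by rewrite /um -PmZ -PmB h2 PmD (Pmp (PW u)) PK add0r.
  have := schur_bound (AB Dh Dk); rewrite upB // umB // uh mh.
  rewrite (GB (PK _) (um_Pm k)) -{1}uE.
  have -> : up k - G (um k) + G (K (W u)) - up k - (G (K (W u)) - G (um k)) = 0.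
    by move: (G _) (G _) => a b; vec ip_norm.
  rewrite nm0 => h0; apply/eqP; rewrite -subr_eq0 -PpB -nm_eq0 eq_le nmge0 andbT.
  by rewrite -(ler_pM2l t0) mulr0.
have it0 : (2 : R)%:C * it != 0.
  by rewrite eq_complex /= negb_and; apply/orP; right; apply: lt0r_neq0; have := t0; lra.
have hE h : h = ((2 : R)%:C * it)^-1 *: ((A h + it *: h) - (A h - it *: h)).
  have -> : (A h + it *: h) - (A h - it *: h) = ((2 : R)%:C * it) *: h by vec ip_norm.
  by rewrite scalerA mulVf // scale1r.
have AhE h : A h = (2^-1 : R)%:C *: ((A h + it *: h) + (A h - it *: h)).
  have -> : (A h + it *: h) + (A h - it *: h) = (2 : R)%:C *: A h by vec ip_norm.
  by rewrite scalerA -rmorphM mulVf ?pnatr_eq0 // scale1r.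
have hL u h : Pp u = u -> A h + it *: h = u + K u -> A h - it *: h = W u + K (W u) ->
    L h /\ L (A h).
  move=> Pu h1 h2; have e1 := hE h; have e2 := AhE h; rewrite h1 h2 in e1 e2.
  split; [rewrite e1|rewrite e2]; apply: LZ; last by apply: LD; apply: Lg.
  by apply: LB; apply: Lg.
have domL d : dom A d -> L d -> exists u, [/\ Pp u = u, A d + it *: d = u + K u &
    A d - it *: d = W u + K (W u)].
  move=> Dd Ld; have [u [h [Pu [Dh h1 h2] e]]] := lift d Dd.
  have [Lh _] := hL u h Pu h1 h2.
  by exists u; rewrite -(Leq _ _ Lh Ld e).
exists L; split.
- exact: (graph_max_nonneg ip_norm Pp_proj Pm_proj PpDPm).
- split=> [v Lv|x [Dx Lx]].
    apply/closure_nmP => e e0; have e2 : 0 < e / 2 by lra.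
    have [k Dk kv] := Adense v e2.
    have [u [h [Pu [Dh h1 h2] hk]]] := lift k Dk.
    have [Lh _] := hL u h Pu h1 h2.
    exists h; first by split.
    have Ld := LB _ _ Lv Lh.
    have := nmD (Pp (v - h)) (Pm (v - h)); rewrite PpDPm Ld.
    have := Kb (Pp (v - h)); have := nmPp (v - k); rewrite !PpB hk; lra.
  have [u [Pu h1 h2]] := domL x Dx Lx; exact: (hL u x Pu h1 h2).2.
move=> l nl; apply: contrapT => /negP; rewrite -ltNge => l0; apply: nl.
(* These are the coefficients with al (A + it) + be (A - it) = 2it (A - l); the squared moduli of
   [be] and [al] differ by 4 t Im l, which is negative here. *)
pose al := it - l; pose be := it + l.
have ab : cmod be < cmod al.
  apply: sqr_lt => //; rewrite !cmod_sqr /al /be /=.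
  have := mulr_gt0 t0 (_ : 0 < - complex.Im l); rewrite oppr_gt0 => /(_ l0).
  by case: (l) => a b /=; nra.
have a0 : al != 0 by rewrite -cmod_eq0; apply: lt0r_neq0; apply: le_lt_trans ab.
pose ka := - be / al; pose ga := al / ((2 : R)%:C * it).
have g0 : ga != 0 by rewrite mulf_neq0 // invr_eq0.
have ka1 : cmod ka < 1.
  by rewrite cmodM cmodN cmodV ltr_pdivrMr ?mul1r //; apply: le_lt_trans ab.
pose X u := ka *: W u.
have Xl : lin X by move=> c x y; rewrite /X Wl; vec ip_norm.
have X2 u : nm (X u) <= 2 * nm u.
  rewrite nmZ; apply: le_trans (W2 u).
  by have := ler_wpM2r (nmge0 (W u)) (ltW ka1); rewrite mul1r.
have XP u : Pp (X u) = X u by rewrite PpZ PW.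
have XN : exists N, forall u, Pp u = u -> nm (iter N X u) <= 2^-1 * nm u.
  have [N WNN] := WN ka ka1; exists N => u Pu; have := WNN u Pu; congr (nm _ <= _).
  elim: (N) => [|n IH]; first by rewrite expr0 scale1r.
  by rewrite !iterS -IH /X (linZ Wl) exprS scalerA.
have [C [C1 C2]] := neumann Xl X2 XP XN.
have key u d : Pp u = u -> A d + it *: d = u + K u -> A d - it *: d = W u + K (W u) ->
    A d - l *: d = ga *: ((u - X u) + K (u - X u)).
  move=> Pu h1 h2; rewrite (linB Kl) {2}/X (linZ Kl).
  have -> : (u - X u) + (K u - ka *: K (W u)) = (u + K u) - ka *: (W u + K (W u)).
    by rewrite /X; vec ip_norm.
  have e1 : ga * ka = - (be / ((2 : R)%:C * it)).
    rewrite /ga /ka; move: a0 it0; clearbody al be; move: (_ * it) => q a0 q0.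
    by field; rewrite a0 q0.
  have e2 : al *: (A d + it *: d) + be *: (A d - it *: d) = ((2 : R)%:C * it) *: (A d - l *: d).
    by rewrite /al /be; vec ip_norm.
  rewrite scalerBr scalerA e1 -h1 -h2.
  have -> : ga *: (A d + it *: d) - - (be / ((2 : R)%:C * it)) *: (A d - it *: d) =
      ((2 : R)%:C * it)^-1 *: (al *: (A d + it *: d) + be *: (A d - it *: d)).
    by rewrite /ga; move: (_^-1) (A d + _) (A d - _) => q p w; vec ip_norm.
  rewrite e2.
  by rewrite scalerA mulVf // scale1r.
have [M MP] : exists M : R, forall d, dom A d -> L d -> nm d <= M * nm (A d - l *: d).
  (* The 6 bounds [u + K u] by 2 and [W u + K (W u)] by 4 times [nm u], and [C] bounds [nm u] by
     [nm (u - X u)]. *)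
  exists (cmod ((2 : R)%:C * it)^-1 * (6 * `|C| * (cmod ga)^-1)) => d Dd Ld.
  have [u [Pu h1 h2]] := domL d Dd Ld; rewrite (key u d) // nmZ.
  rewrite {1}(hE d) h1 h2 nmZ -!mulrA; apply: ler_wpM2l; rewrite // mulKf ?cmod_eq0 //.
  have Pv : Pp (u - X u) = u - X u by rewrite PpB XP Pu.
  have h3 := nmPp ((u - X u) + K (u - X u)); rewrite PpK // in h3.
  have h4 := ler_wpM2l (normr_ge0 C) h3.
  have h5 := ler_wpM2r (nmge0 (u - X u)) (ler_norm C).
  have := nmB (u + K u) (W u + K (W u)); have := nmD u (K u); have := nmD (W u) (K (W u)).
  have := Kb u; have := Kb (W u); have := W2 u; have := C1 u Pu; lra.
split.
- move=> x y; rewrite !inE => -[Dx Lx] [Dy Ly] /= e; apply/eqP; rewrite -subr_eq0 -nm_eq0.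
  rewrite eq_le nmge0 andbT.
  have := MP (x - y) (AB Dx Dy) (LB _ _ Lx Ly); rewrite ABlin //.
  have -> : A x - A y - l *: (x - y) = (A x - l *: x) - (A y - l *: y) by vec ip_norm.
  by rewrite e subrr nm0 mulr0.
- apply/seteqP; split=> [_ [x [Dx Lx] <-]|f Lf] /=.
    have [u [Pu h1 h2]] := domL x Dx Lx; have [_ LA] := hL u x Pu h1 h2.
    by apply: LB => //; apply: LZ.
  have Pg : Pp (ga^-1 *: Pp f) = ga^-1 *: Pp f by rewrite PpZ Ppi.
  have [u Pu uE] := C2 _ Pg; have [h [Dh h1 h2]] := KWh u Pu.
  have [Lh LA] := hL u h Pu h1 h2; exists h; first by split.
  apply: Leq => //=; first by apply: LB => //; apply: LZ.
  by rewrite (key u h) // uE PpZ PpK // scalerA mulfV // scale1r.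
- exists M => _ [x [Dx Lx] <-] /=.
  case: xgetP => [y _ [[Dy Ly] <-]|/(_ x)]; last by case; split.
  by rewrite !nmE -rmorphM lecR; apply: MP.
Qed.

End Resolvent.
End Krein.

(** * Free ultrafilter, core approximation and the equivalence *)

Lemma ultra_oo : exists2 U : set_system nat, UltraFilter U & forall N, U [set n | (N <= n)%N].
Proof.
have [U [UU sU]] := @ultraFilterLemma nat \oo _.
by exists U => // N; apply: sU; exists N.
Qed.

Lemma core_approx (R : realType) (H : completeNormedModType R[i]) (A : partial_op H) (D : set H) h (e : R) :
  is_core A D -> dom A h -> 0 < e -> exists2 x, dom A x /\ D x &
    nm (h - x) < e /\ nm (A h - A x) < e.
Proof.
move=> [_ _ cl] Dh e0.
have : graph A (h, A h) by [].
rewrite -cl => /(_ [set p | nm (h - p.1) < e /\ nm (A h - p.2) < e]) [].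
  exists (ball h e%:C, ball (A h) e%:C).
    by split; apply: nbhsx_ballx; rewrite ltcR.
  by move=> [x y] [/=]; rewrite -!ball_normE /= !nmE !ltcR.
by move=> [x y] [[/= Dx ->] ?]; exists x.
Qed.

Theorem theorem2 (R : realType) (H : completeNormedModType R[i])
    (ip : {dot H for conjC})
    (ip_norm : forall x : H, `|x| ^+ 2 = ip x x)
    (H_separable : separable H)
    (Pp Pm : {linear H -> H})
    (Pp_proj : orthogonal_projection ip Pp)
    (Pm_proj : orthogonal_projection ip Pm)
    (PpDPm : forall x, Pp x + Pm x = x)
    (A : partial_op H)
    (A_op : operator_in setT A)
    (A_closed : closed_op A)
    (A_dense : densely_defined_in setT A)
    (A_core : is_core A (sum_set (dom A `&` range Pp) (dom A `&` range Pm)))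
    (mu : R[i]) (mu_gt0 : 0 < complex.Im mu) :
  let J x := Pp x - Pm x in
  let A12 := block Pp Pm A in
  let A21 := block Pm Pp A in
  let A22 := block Pm Pm A in
  krein_dissipative ip J A ->
  m_dissipative_in ip (range Pm) (op_opp A22) ->
  bounded_op (op_comp (op_inv (op_sub_scalar A22 mu)) A21) ->
  compact_op (range Pm) (range Pp)
    (op_comp A12 (op_inv (op_sub_scalar A22 mu))) ->
  (exists L : set H,
      [/\ max_nonnegative_subspace ip J L, invariant_under A L &
          spectrum L (op_restr A L) `<=` [set z | 0 <= complex.Im z]])
  <-> krein_m_dissipative ip J A.
Proof.
move=> J A12 A21 A22 Kd Bm _ Gc.
have [U UU Uoo] := ultra_oo.
have [/submodE[A0 AP] _ Alin _] := A_op.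
have Adense h (e : R) : 0 < e -> exists2 x, dom A x & nm (h - x) < e.
  by move=> e0; apply: ((closure_nmP _ _).1 (A_dense h I)).
have Acore h : dom A h -> forall e : R, 0 < e -> exists x z,
    [/\ dom A x /\ Pp x = x, dom A z /\ Pm z = z, nm (h - (x + z)) < e &
      nm (A h - A (x + z)) < e].
  move=> Dh e e0; have [_ [_ [x [Dx [x' _ xE]] [z [Dz [z' _ zE]] <-]]] [h1 h2]] := core_approx A_core Dh e0.
  exists x, z; split => //; split => //; first by rewrite -xE (Pp_idem Pp_proj).
  by rewrite -zE (Pm_idem Pm_proj).
have AJ x : dom A x -> 0 <= rip ip (Pp (A x) - Pm (A x)) ('i%C *: x).
  by move=> Dx; have [_ _ /(_ x Dx)] := Kd; rewrite (Im_ip ip).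
have [t [Rt [t0 RtP Gb Gcomp]]] := small_resolvent ip_norm Pp_proj Pm_proj PpDPm AP A0 Alin AJ UU Uoo mu_gt0 Bm Gc.
have JJ x : J (J x) = x.
  by rewrite /J !linearB /= (Pp_idem Pp_proj) (Pm_idem Pm_proj) (PpPm Pp_proj PpDPm) (PmPp Pm_proj PpDPm) -[RHS]PpDPm; vec ip_norm.
have JE h : J (J (A h) + (t%:C * 'i%C) *: h) = up Pp A t h + um Pm A t h.
  have lP := @lin_Pp R H Pp; have lM := @lin_Pm R H Pm.
  rewrite /J /up /um (linD lP) (linB lP) (linZ lP) (linD lM) (linB lM) (linZ lM).
  by rewrite !(Pp_idem Pp_proj) !(Pm_idem Pm_proj) !(PpPm Pp_proj PpDPm) !(PmPp Pm_proj PpDPm); vec ip_norm.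
split=> [[L [Lmax [_ Linv] Lspec]]|Km].
(* The point -it lies in the open lower half-plane, hence in the resolvent set of the restriction to
   [L]. *)
- have Lres v : L v -> exists h, [/\ dom A h, L h, L (A h) & A h + (t%:C * 'i%C) *: h = v].
    move=> Lv; have : resolvent_set L (op_restr A L) (- (t%:C * 'i%C)).
      apply: contrapT => /Lspec /=; lra.
    move=> [_ im _]; move: (Lv); rewrite -{1}im => -[h [Dh Lh] /= hv].
    exists h; split => //; first by apply: Linv.
    by rewrite -hv scaleNr opprK.
  have sur := invariant_surj ip_norm Pp_proj Pm_proj PpDPm AP Alin Acore AJ t0 RtP Gb Lmax Lres.
  (* Surjectivity of JA + it gives [h] in [dom A] with (S + it)(x - h) = 0 for a dissipative
     extension [S]; dissipativity at [x - h] then forces [x = h]. *)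
  split=> [//|S Sd [Ssub SE] x Sx].
  have [h [Dh]] := sur (J (S x + (t%:C * 'i%C) *: x)); rewrite -JE => /(congr1 J); rewrite !JJ => e.
  have [/submodE[_ SP] _ Slin _] := let: And3 h _ _ := Sd in h.
  have SxE := SE h Dh; have Sh := Ssub h Dh.
  have Sxh : dom S (x - h) by rewrite addrC -scaleN1r; apply: SP.
  have Exh : S (x - h) = - ((t%:C * 'i%C) *: (x - h)).
    rewrite addrC -scaleN1r Slin // SxE /=; apply/eqP; rewrite -subr_eq0.
    have -> : -1 *: J (A h) + S x - - ((t%:C * 'i%C) *: (-1 *: h + x)) =
      (S x + (t%:C * 'i%C) *: x) - (J (A h) + (t%:C * 'i%C) *: h) by vec ip_norm.
    by rewrite e subrr.
  have : 0 <= rip ip (S (x - h)) ('i%C *: (x - h)) by have [_ _ /(_ _ Sxh)] := Sd; rewrite (Im_ip ip).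
  rewrite Exh ripNl -scalerA ripZl ripi (rip_nm ip_norm) oppr_ge0 pmulr_rle0 // => h0.
  have : nm (x - h) == 0 by rewrite -sqrf_eq0 eq_le h0 sqr_ge0.
  by rewrite nm_eq0 subr_eq0 => /eqP ->.
- have sur xi : exists h, dom A h /\ up Pp A t h + um Pm A t h = xi.
    have [|||x Dx e] := @m_diss_surj _ _ _ ip_norm _ UU Uoo setT _ Km _ t t0 _ (J xi) => //.
    by exists x; split => //; rewrite -JE -[RHS]JJ -e.
  exact: (surj_invariant ip_norm Pp_proj Pm_proj PpDPm AP Alin Adense Acore AJ UU Uoo t0 RtP Gb Gcomp sur).
Qed.
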